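(* Let $K$ be a field, $n,m\ge 1$, and let $H \in K(x)^m$ be such that $\operatorname{trdeg}_K K(tH) \le 2$. Then there are $g \in K(x)$, $h \in K[y_1,y_2]^m$, and a pair $(p,q) \in K[x]^2$ such that (i) $H = g \cdot h(p,q)$ and $g \ne 0$; (ii) $h$ is either homogeneous and primitive (over $K[y_1,y_2]$), or zero; (iii) $(p,q)$ is primitive (over $K[x]$), but not constant (i.e. $(p,q)\notin K^2$). Moreover, whenever $g$, $h$, $(p,q)$ satisfy (i), (ii) and (iii), the following hold: (iv) $\operatorname{trdeg}_K K(tH) = \operatorname{trdeg}_K K\big(t\,h(p,q)\big) = \operatorname{trdeg}_K K(th)$; (v) the following are equivalent: $H \ne 0$; $h(p,q)$ is primitive (over $K[x]$); $h$ is primitive (over $K[y_1,y_2]$); $h \ne 0$; (vi) the following are equivalent: $\operatorname{trdeg}_K K(tH) \le 1$; $h(p,q) \in K^m$; $h \in K^m$; (vii) if $h \ne 0$, then $\deg h(p,q) = s \cdot \deg (p,q)$ and $\operatorname{codeg} h(p,q) = s \cdot \operatorname{codeg} (p,q)$, where $s := \deg h = \operatorname{codeg} h$; (viii) if $h \ne 0$, then $h(p,q)$ is homogeneous if and only if $(p,q)$ is homogeneous; (ix) if $\deg (p,q)$ is minimal (among all choices of $g,h,(p,q)$ satisfying (i), (ii), (iii)), then $K(p/q)$ is algebraically closed in $K(x)$.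
   Context: $x=(x_1,\dots,x_n)$ is an $n$-tuple of variables, $K[x]$ the polynomial ring and $K(x)$ its fraction field; $y_1,y_2$ are variables, and $t$ is a further indeterminate. For $H=(H_1,\dots,H_m)$, $tH=(tH_1,\dots,tH_m)$ and $K(tH)=K(tH_1,\dots,tH_m)$ (a subfield of $K(x,t)$); similarly $K(th)$ is a subfield of $K(y_1,y_2,t)$. For $h=(h_1,\dots,h_m)$, $h(p,q)=(h_1(p,q),\dots,h_m(p,q))$. An $m$-tuple $F\in R^m$ over an integral domain $R$ is primitive (over $R$) if $F\neq 0$ and every common divisor in $R$ of its components is a unit of $R$. For a tuple $F$ of polynomials (or a single polynomial), $\deg F$ (resp. $\operatorname{codeg} F$) is the largest (resp. smallest) degree of a term occurring in (a component of) $F$, with $\deg 0=-\infty$ and $\operatorname{codeg} 0=+\infty$. A nonzero tuple is homogeneous (of degree $d$) if every nonzero component is a homogeneous polynomial of the same degree $d$.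
   Formalization: In (viii), the implication from h(p,q) homogeneous to (p,q) homogeneous is stated only for h not in K^m; as printed it fails for H=(1), g=1, h=(1), (p,q)=(x_1,1), where h(p,q)=1 is homogeneous but (p,q) is not. *)

(* Defs.v *)
From Stdlib Require Import ClassicalEpsilon.
From HB Require Import structures.
From mathcomp Require Import all_boot all_order all_algebra.
From mathcomp Require Import fraction.
From mathcomp Require Import mpoly.
From mathcomp Require Import constructive_ereal.

Set Implicit Arguments.
Unset Strict Implicit.
Unset Printing Implicit Defensive.

Import Order.TTheory GRing.Theory.

Local Open Scope ring_scope.

(* Subfields of L containing the image of K are represented by predicates     *)
(* L -> Prop; families of elements of L are functions from 'I_k.              *)
Section TranscendenceDegree.
Variables (K L : fieldType) (iota : {rmorphism K -> L}).

Definition adjoin k (s : 'I_k -> L) (a : L) : Prop :=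
  exists N D : {mpoly K[k]},
    mmap iota s D != 0 /\ a = mmap iota s N / mmap iota s D.

Definition algebraic_over (E : L -> Prop) (a : L) : Prop :=
  exists f : {poly L}, [/\ f != 0, forall i, E f`_i & root f a].

Definition algebraically_closed_in (E : L -> Prop) : Prop :=
  forall a, algebraic_over E a -> E a.

Definition algebraically_independent k (b : 'I_k -> L) : Prop :=
  forall f : {mpoly K[k]}, mmap iota b f = 0 -> f = 0.

Definition transcendence_basis (E : L -> Prop) k (b : 'I_k -> L) : Prop :=
  [/\ forall i, E (b i), algebraically_independent b
    & forall a, E a -> algebraic_over (adjoin b) a].

(* The common cardinality of the transcendence bases of E over K.  This value *)
(* is meaningful only when a finite transcendence basis exists, which is the  *)
(* case for every finitely generated E.                                       *)
Definition trdeg (E : L -> Prop) : nat :=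
  epsilon (inhabits 0%N)
    (fun k => exists b : 'I_k -> L, transcendence_basis E b).

End TranscendenceDegree.

Section RationalFunctions.
Variables (K : fieldType) (n : nat).

Definition ratfun := {fraction {mpoly K[n]}}.

(* K(x, t), built as the field of fractions of K(x)[t]; t is 'X *)
Definition ratfun_t := {fraction {poly ratfun}}.

Definition ratfunC : {rmorphism K -> ratfun} :=
  @tofrac {mpoly K[n]} \o @mpolyC n K.

Definition ratfun_tC : {rmorphism K -> ratfun_t} :=
  @tofrac {poly ratfun} \o @polyC ratfun \o ratfunC.

(* trdeg_K K(tF) *)
Definition trdeg_t m (F : 'rV[ratfun]_m) : nat :=
  trdeg ratfun_tC (adjoin ratfun_tC (fun i => tofrac ('X * (F 0 i)%:P))).

(* K(p / q) *)
Definition adjoin_quot (p q : {mpoly K[n]}) : ratfun -> Prop :=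
  adjoin ratfunC (fun _ : 'I_1 => tofrac p / tofrac q).

Definition ratfun_row m (F : 'rV[{mpoly K[n]}]_m) : 'rV[ratfun]_m :=
  map_mx (@tofrac {mpoly K[n]}) F.

End RationalFunctions.

Definition primitive (R : idomainType) m (F : 'rV[R]_m) : Prop :=
  F != 0 /\
  forall d : R, (forall i, exists e, F 0 i = e * d) -> d \is a GRing.unit.

(* Degrees live in \bar int, so that deg 0 = -oo and codeg 0 = +oo. *)
Section PolynomialTuples.
Variables (K : fieldType) (n m : nat).
Implicit Type F : 'rV[{mpoly K[n]}]_m.

Definition deg F : \bar int :=
  \big[maxe/-oo%E]_(i < m) \big[maxe/-oo%E]_(u <- msupp (F 0 i)) (mdeg u)%:Z%:E.

Definition codeg F : \bar int :=
  \big[mine/+oo%E]_(i < m) \big[mine/+oo%E]_(u <- msupp (F 0 i)) (mdeg u)%:Z%:E.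

(* 0 \is d.-homog for every d, so only the nonzero components matter. *)
Definition homogeneous F : Prop :=
  F != 0 /\ exists d : nat, forall i, F 0 i \is d.-homog.

Definition constant_row F : Prop :=
  exists c : 'rV[K]_m, F = map_mx (@mpolyC n K) c.

End PolynomialTuples.

Definition pair_row (R : Type) (p q : R) : 'rV[R]_2 :=
  \row_i tnth [tuple p; q] i.

Definition subst_pair (K : fieldType) n m (h : 'rV[{mpoly K[2]}]_m)
    (p q : {mpoly K[n]}) : 'rV[{mpoly K[n]}]_m :=
  map_mx (fun f => f \mPo [tuple p; q]) h.

Definition decomposition (K : fieldType) n m (H : 'rV[ratfun K n]_m)
    (g : ratfun K n) (h : 'rV[{mpoly K[2]}]_m) (p q : {mpoly K[n]}) : Prop :=
  [/\ H = g *: ratfun_row (subst_pair h p q) /\ g != 0,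
      (homogeneous h /\ primitive h) \/ h = 0
    & primitive (pair_row p q) /\ ~ constant_row (pair_row p q)].

(* Main.v *)
(* Separating the homogeneous components in t, the relations between the t H_i are generated by
   the homogeneous relations between the H_i.  If trdeg K(tH) <= 2, any three of the H_i satisfy
   such a relation, so the quotients f_i = H_i / H_j are pairwise algebraically dependent.  By
   Lueroth's theorem, in the form of Gordan and Igusa, they all lie in a field K(u) with
   u = p / q reduced; homogenizing f_i = A_i(u) / B(u), after removing the common factor of the
   A_i, gives h.  To descend Lueroth's theorem from K(s) to K(x) over an arbitrary field, possibly
   finite, substitute x_i := s^(D^i): for large D this is a place of K(x) that is finite and
   nonconstant on the f_i, hence injective on the field they generate.

   The other claims rest on one consequence of Bezout's identity: if h is a primitive tuple of
   binary forms of degree s, then y_2^N is a combination of the h_i, and some h_i contains y_1^s.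
   So in every factorial K-algebra a prime dividing all h_i(a, b) divides a and b, and the
   h_i(a, b) do not all vanish unless a = b = 0.  Applied to (p, q) this gives primitivity,
   applied to the forms of highest or lowest degree of (p, q) it gives the (co)degree formulas.
   For (ix), let a be algebraic over K(p / q).  Then p / q and a lie in some K(p' / q'), and (p, q)
   is a pair of forms of degree r in (p', q').  Minimality of deg (p, q) forces r = 1, so that
   p' / q' is a Moebius transform of p / q and a lies in K(p / q). *)

From Stdlib Require Import ClassicalEpsilon.
From HB Require Import structures.
Require Import Defs.
From mathcomp Require Import all_boot all_order all_algebra.
From mathcomp Require Import fraction mxpoly polyXY ring zify.
From mathcomp Require Import mpoly.
From mathcomp Require Import constructive_ereal.

Set Implicit Arguments.
Unset Strict Implicit.
Unset Printing Implicit Defensive.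

Import Order.TTheory GRing.Theory Num.Theory.

Local Open Scope ring_scope.

(** * Factorial domains *)

(** Two representations carry the proof. A binary form of degree [s] is kept as a univariate
    polynomial together with the formal degree [s], and [hval] evaluates its homogenization in any
    ring; Euclid's algorithm in K[X] thus becomes available for forms, while a deficient degree of
    the univariate polynomial records a factor y_2. In the general lemmas, a field of fractions is
    any field L with an injective morphism from a factorial ring whose quotients exhaust L, so that
    the same lemmas serve K(s), K(x) and K(y_1, y_2). Factorization into primes is used for Gauss's
    lemma inside Lueroth's theorem, for reduced fractions, and for the primitivity of h(p, q). Since
    [trdeg] is chosen by [epsilon], it says nothing until all transcendence bases are known to have
    equally many elements; hence the exchange property and Steinitz's lemma. What is kept from them
    is that the transcendence degree is the maximal number of independent generators, which turns
    (iv) and (vi) into statements about relations. *)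

Definition divides (A : idomainType) (d a : A) := exists e, a = e * d.

Definition prime_elt (A : idomainType) (p : A) :=
  [/\ p != 0, p \isn't a GRing.unit
    & forall a b, divides p (a * b) -> divides p a \/ divides p b].

(** Asking for prime rather than irreducible factors puts uniqueness into the existence statement: a
    prime dividing the product divides one of the factors and is associated to it. *)
Definition prime_factored (A : idomainType) (a : A) :=
  exists (u : A) (s : seq A), [/\ u \is a GRing.unit,
    forall p, p \in s -> prime_elt p & a = u * \prod_(p <- s) p].

Definition factorial (A : idomainType) := forall a : A, a != 0 -> prime_factored a.

Section Factorial.
Variable R : idomainType.
Implicit Types (a b d p u : R) (s : seq R) (f g : {poly R}).

Lemma divides_mull d a b : divides d a -> divides d (b * a).
Proof. by case=> e ->; exists (b * e); rewrite mulrA. Qed.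

Lemma divides_add d a b : divides d a -> divides d b -> divides d (a + b).
Proof. by case=> e -> [e' ->]; exists (e + e'); rewrite mulrDl. Qed.

Lemma divides_sub d a b : divides d a -> divides d b -> divides d (a - b).
Proof. by case=> e -> [e' ->]; exists (e - e'); rewrite mulrBl. Qed.

Lemma divides0 d : divides d 0.
Proof. by exists 0; rewrite mul0r. Qed.

Lemma divides_refl d : divides d d.
Proof. by exists 1; rewrite mul1r. Qed.

Lemma divides_trans b a d : divides a b -> divides b d -> divides a d.
Proof. by move=> [e ->] [e' ->]; exists (e' * e); rewrite mulrA. Qed.

Lemma divides_sum d (I : Type) (r : seq I) (P : pred I) (F : I -> R) :
  (forall i, P i -> divides d (F i)) -> divides d (\sum_(i <- r | P i) F i).
Proof. by move=> dF; apply: big_ind => //; [exact: divides0 | exact: divides_add]. Qed.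

Lemma prime_eltX p a k : prime_elt p -> divides p (a ^+ k) -> divides p a.
Proof.
case=> p0 pU pM; elim: k => [|k IHk].
  rewrite expr0 => -[e e1]; case/negP: pU.
  by apply/unitrP; exists e; rewrite (mulrC p) -e1.
by rewrite exprS => /pM[].
Qed.

Lemma prime_elt_unitN p a : prime_elt p -> divides p a -> a \isn't a GRing.unit.
Proof.
case=> p0 pU _ [e ->]; apply: contra pU.
by rewrite unitrM => /andP[].
Qed.

Lemma prime_elt_irr p a b : prime_elt p -> p = a * b ->
  a \is a GRing.unit \/ b \is a GRing.unit.
Proof.
case=> p0 pU pM pab.
have [a0 b0] : a != 0 /\ b != 0.
  by apply/andP; rewrite -negb_or -mulf_eq0 -pab.
have : divides p (a * b) by rewrite -pab; apply: divides_refl.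
case/pM=> -[e Ee]; [right|left]; apply/unitrP; exists e.
  have E : a * (e * b) = a * 1 by rewrite mulr1 {2}Ee pab; ring.
  by move/(mulfI a0): E => E; rewrite (mulrC b).
have E : b * (e * a) = b * 1 by rewrite mulr1 {2}Ee pab; ring.
by move/(mulfI b0): E => E; rewrite (mulrC a).
Qed.

Lemma prime_divisor d : factorial R -> d != 0 -> d \isn't a GRing.unit ->
  exists2 p, prime_elt p & divides p d.
Proof.
move=> facR d0 dU; have [u [s [uU sP Ed]]] := facR _ d0.
case: s sP Ed => [|p s] sP Ed; first by rewrite Ed big_nil mulr1 uU in dU.
exists p; first by apply: sP; rewrite mem_head.
by rewrite Ed big_cons; exists (u * \prod_(q <- s) q); ring.
Qed.

(** Cancelling a prime shortens the list of prime factors by exactly one, so the length of such a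
    list is the measure for the recursions that strip common primes. *)
Lemma prime_factor_cancel u s p a : u \is a GRing.unit ->
    (forall q, q \in s -> prime_elt q) -> prime_elt p ->
    u * \prod_(q <- s) q = p * a ->
  exists u' s', [/\ u' \is a GRing.unit, forall q, q \in s' -> prime_elt q,
    size s = (size s').+1 & a = u' * \prod_(q <- s') q].
Proof.
elim: s u a => [|q s IHs] u a uU sP pP.
  rewrite big_nil mulr1 => Eu.
  have : u \isn't a GRing.unit by apply: (prime_elt_unitN pP); exists a; rewrite mulrC.
  by rewrite uU.
have qP : prime_elt q by apply: sP; rewrite mem_head.
have sP' r : r \in s -> prime_elt r by move=> rs; apply: sP; rewrite inE rs orbT.
have [p0 pU pM] := pP; have [q0 qU qM] := qP.
rewrite big_cons mulrCA => E.
have : divides p (q * (u * \prod_(j <- s) j)) by rewrite E mulrC; exists a.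
case/pM => [[e Ee]|[e Ee]].
  have [eU|] := prime_elt_irr qP Ee; last by rewrite (negbTE pU).
  exists (e * u), s; split=> //; first by rewrite unitrM eU.
  by apply: (mulfI p0); rewrite -E Ee; ring.
have [|u' [s' [u'U s'P Es Ee']]] := IHs u e uU sP' pP; first by rewrite Ee mulrC.
exists u', (q :: s'); split=> //=; rewrite ?Es //.
  by move=> r; rewrite inE => /predU1P[->|/s'P].
apply: (mulfI p0); rewrite -E Ee Ee' big_cons; ring.
Qed.

(** * Gauss's lemma and factorization in R[X] *)

Lemma divides_polyC p f : divides p%:P f <-> forall i, divides p f`_i.
Proof.
split=> [[e ->] i|H]; first by rewrite coefMC; exists e`_i.
have -> : f = \sum_(i < size f) f`_i *: 'X^i by rewrite -poly_def coefK.
apply: big_ind => [|x y [e ->] [e' ->]|i _].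
- by exists 0; rewrite mul0r.
- by exists (e + e'); rewrite mulrDl.
case: (H i) => e ->; exists (e *: 'X^i).
by rewrite [RHS]mulrC mul_polyC scalerA mulrC.
Qed.

Lemma lead_coef_split f : f = (f - lead_coef f *: 'X^((size f).-1)) + lead_coef f *: 'X^((size f).-1).
Proof. by rewrite subrK. Qed.

Lemma size_drop_lead f : f != 0 ->
  (size (f - lead_coef f *: 'X^((size f).-1))%R < size f)%N.
Proof.
move=> f0; have := f0; rewrite -size_poly_gt0 => s0.
rewrite -[X in (_ < X)%N](prednK s0) ltnS; apply/leq_sizeP => j.
rewrite leq_eqVlt => /predU1P[<-|lt]; rewrite coefB coefZ coefXn.
  by rewrite eqxx mulr1 -lead_coefE subrr.
by rewrite gtn_eqF // mulr0 subr0 nth_default // -(prednK s0).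
Qed.

(** If p divides f g, it divides the product of the leading coefficients, hence one of them;
    deleting that leading term keeps the product divisible by p and lowers the sum of the sizes. *)
Lemma prime_polyC p : prime_elt p -> prime_elt p%:P.
Proof.
case=> p0 pU pM; split; first by rewrite polyC_eq0.
  by rewrite poly_unitE size_polyC coefC eqxx /= p0 (negbTE pU) andbF.
have dvdT c k : divides p c -> divides p%:P (c *: 'X^k).
  by case=> e ->; exists (e *: 'X^k); rewrite [RHS]mulrC mul_polyC scalerA mulrC.
move=> f g; have [k] := ubnP (size f + size g)%N; elim: k f g => // k IHk f g lek.
have [->|f0] := eqVneq f 0; first by left; apply: (iffRL (divides_polyC _ _)) => i; rewrite coef0; apply: divides0.
have [->|g0] := eqVneq g 0; first by right; apply: (iffRL (divides_polyC _ _)) => i; rewrite coef0; apply: divides0.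
move=> dvdfg; have /divides_polyC/(_ (size (f * g)).-1) := dvdfg.
rewrite -lead_coefE lead_coefM => /pM[] dl.
  have df1 : divides p%:P ((f - lead_coef f *: 'X^((size f).-1)) * g).
    case: dvdfg (dvdT _ (size f).-1 dl) => e Ee [e' Ee'].
    by exists (e - e' * g); rewrite mulrBl Ee Ee'; ring.
  case/IHk: df1 => [|df|dg]; last by right.
    by apply: leq_trans (_ : (size f + size g <= k)%N) => //; rewrite ltn_add2r size_drop_lead.
  left; rewrite (lead_coef_split f); have [e' Ee'] := dvdT _ (size f).-1 dl.
  by case: df => e Ee; exists (e + e'); rewrite mulrDl -Ee -Ee'.
have df1 : divides p%:P (f * (g - lead_coef g *: 'X^((size g).-1))).
  case: dvdfg (dvdT _ (size g).-1 dl) => e Ee [e' Ee'].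
  by exists (e - e' * f); rewrite mulrBr Ee Ee'; ring.
case/IHk: df1 => [|df|dg]; first by apply: leq_trans (_ : (size f + size g <= k)%N) => //; rewrite ltn_add2l size_drop_lead.
  by left.
right; rewrite (lead_coef_split g); have [e' Ee'] := dvdT _ (size g).-1 dl.
by case: dg => e Ee; exists (e + e'); rewrite mulrDl -Ee -Ee'.
Qed.

Definition content_free f := forall p, prime_elt p -> ~ divides p%:P f.

(** Each prime of the denominator c divides the product of f and its cofactor, but not f, and so
    cancels from the cofactor. In this way divisibility over the field of fractions descends to
    R[X]. *)
Lemma content_free_divides f g c : factorial R -> content_free f -> c != 0 ->
  divides f (c *: g) -> divides f g.
Proof.
move=> facR fP c0; have [u [s [uU sP ->]]] := facR _ c0 => {c c0}.
elim: s sP => [|p s IHs] sP.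
  rewrite big_nil mulr1 => -[e Ee]; exists (u^-1 *: e).
  by rewrite -scalerAl -Ee scalerA mulVr // scale1r.
have pP : prime_elt p by apply: sP; rewrite mem_head.
rewrite big_cons mulrCA -scalerA => -[e Ee].
have [_ _] := prime_polyC pP; case/(_ e f).
- by rewrite -Ee -mul_polyC mulrC; eexists.
- move=> [e' Ee']; apply: IHs; first by move=> q qs; apply: sP; rewrite inE qs orbT.
  have p0 : p%:P != 0 by rewrite polyC_eq0; case: pP.
  exists e'; apply: (mulfI p0); rewrite mul_polyC Ee Ee'; ring.
- by move/fP.
Qed.

(** Every prime constant taken out of f uses up one prime factor of the leading coefficient, which
    bounds the recursion. *)
Lemma content_split f : factorial R -> f != 0 ->
  exists c g, [/\ c != 0, f = c *: g & content_free g].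
Proof.
move=> facR f0.
have [u [s [uU sP Es]]] : prime_factored (lead_coef f) by apply: facR; rewrite lead_coef_eq0.
have [k] := ubnP (size s); elim: k f u s uU sP Es f0 => // k IHk f u s uU sP Es f0 lek.
have [[p [pP [g Eg]]]|N] := classic (exists p, prime_elt p /\ divides p%:P f); last first.
  by exists 1, f; split; rewrite ?oner_eq0 ?scale1r // => p pP dp; apply: N; exists p.
have g0 : g != 0 by apply: contra_neq f0 => g0; rewrite Eg g0 mul0r.
have El : u * \prod_(q <- s) q = p * lead_coef g.
  by rewrite -Es Eg lead_coefM lead_coefC mulrC.
have [u' [s' [u'U s'P Es' Eg']]] := prime_factor_cancel uU sP pP El.
have [|c [h [c0 Eh hP]]] := IHk g u' s' u'U s'P Eg' g0; first by rewrite Es' in lek.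
exists (p * c), h; split=> //; first by rewrite mulf_neq0 //; case: pP.
by rewrite Eg Eh mulrC mul_polyC scalerA.
Qed.

(** A factorization over the field of fractions, written with its denominator c, moves to R[X]
    without a change of degrees, because every prime of c divides one of the two factors. *)
Lemma factor_over_scalar f g h c : factorial R -> c != 0 -> c *: f = g * h ->
  exists g' h', [/\ f = g' * h', size g' = size g & size h' = size h].
Proof.
move=> facR c0; have [u [s [uU sP ->]]] := facR _ c0 => {c c0}.
elim: s sP g h => [|p s IHs] sP g h.
  rewrite big_nil mulr1 => E; exists (u^-1 *: g), h; split=> //.
    by rewrite -scalerAl -E scalerA mulVr // scale1r.
  by rewrite size_scale // invr_eq0; apply: contraTneq uU => ->; rewrite unitr0.
have pP : prime_elt p by apply: sP; rewrite mem_head.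
have p0 : p != 0 by case: pP.
have p0' : p%:P != 0 by rewrite polyC_eq0.
have sP' q : q \in s -> prime_elt q by move=> qs; apply: sP; rewrite inE qs orbT.
rewrite big_cons mulrCA -scalerA => E.
have [_ _] := prime_polyC pP; case/(_ g h).
- by rewrite -E -mul_polyC mulrC; eexists.
- move=> [e Ee]; have [|g' [h' [Ef sg sh]]] := IHs sP' e h.
    by apply: (mulfI p0'); rewrite mul_polyC E Ee; ring.
  by exists g', h'; split=> //; rewrite sg Ee mulrC mul_polyC size_scale.
- move=> [e Ee]; have [|g' [h' [Ef sg sh]]] := IHs sP' g e.
    by apply: (mulfI p0'); rewrite mul_polyC E Ee; ring.
  by exists g', h'; split=> //; rewrite sh Ee mulrC mul_polyC size_scale.
Qed.

(** Let f divide a b. By irreducibility, the gcd of f and a over the field of fractions has the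
    degree of f or degree 0. In the first case f divides a up to a constant; in the second, Bezout's
    identity multiplied by b shows that f divides b up to a constant. *)
Lemma irreducible_prime f : factorial R -> content_free f -> (1 < size f)%N ->
    (forall g h, f = g * h -> (size g < size f)%N -> (size h < size f)%N -> False) ->
  prime_elt f.
Proof.
move=> facR fP sf irr; have f0 : f != 0 by rewrite -size_poly_gt0 ltnW.
split=> //; first by rewrite poly_unitE gtn_eqF.
move=> a b dab.
have [[c w] /= c0 Ew] := Pdiv.Idomain.dvdpP _ _ (dvdp_gcdl f a).
have [g' [h' [Ef sg sh]]] := factor_over_scalar facR c0 Ew.
have [w0 g0] : w != 0 /\ gcdp f a != 0.
  by apply/andP; rewrite -negb_or -mulf_eq0 -Ew -mul_polyC mulf_eq0 polyC_eq0 negb_or c0.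
have /(congr1 (fun q : {poly R} => size q)) := Ew; rewrite size_scale // size_mul // => Esz.
have := irr _ _ Ef; rewrite sg sh => {}irr.
have sw : (0 < size w)%N by rewrite size_poly_gt0.
have sgc : (0 < size (gcdp f a))%N by rewrite size_poly_gt0.
have [sw1|sw1] := eqVneq (size w) 1.
  left; have : gcdp f a %= f.
    by rewrite -dvdp_size_eqp ?dvdp_gcdl // Esz sw1.
  move=> /eqp_dvdl E; have := dvdp_gcdr f a; rewrite E.
  case/Pdiv.Idomain.dvdpP=> -[c' e'] /= c'0 E'.
  by apply: content_free_divides facR fP c'0 _; exists e'.
have [sg1|sg1] := eqVneq (size (gcdp f a)) 1; last first.
  by exfalso; apply: irr; rewrite Esz; case: (size w) (size (gcdp f a)) sw sgc sw1 sg1 => [|[|x]] [|[|y]] //= *; rewrite ?addnS ?addSn !ltnS ?leq_addr ?leq_addl.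
right; have [[x y] /= /eqp_size] := Bezoutp f a; rewrite sg1.
move=> /eqP/size_poly1P [c' c'0 E'].
apply: (content_free_divides facR fP c'0).
rewrite -mul_polyC -E' mulrDl -mulrA (mulrC f) mulrA.
case: dab => e Ee; exists (x * b + y * e).
by rewrite mulrDl -[y * e * f]mulrA -Ee; ring.
Qed.

Lemma prime_factored_mul (A : idomainType) (a b : A) :
  prime_factored a -> prime_factored b -> prime_factored (a * b).
Proof.
move=> [u [s [uU sP ->]]] [v [t [vU tP ->]]]; exists (u * v), (s ++ t).
split; rewrite ?unitrM ?uU //; last by rewrite big_cat /=; ring.
by move=> p; rewrite mem_cat => /orP[/sP|/tP].
Qed.

Lemma prime_factored_prime (A : idomainType) (p : A) : prime_elt p -> prime_factored p.
Proof.
move=> pP; exists 1, [:: p]; rewrite unitr1 big_seq1 mul1r; split=> // q.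
by rewrite inE => /eqP->.
Qed.

Lemma factorial_poly : factorial R -> factorial {poly R}.
Proof.
move=> facR f; have [k] := ubnP (size f); elim: k f => // k IHk f lek f0.
have [c [g [c0 Ef gP]]] := content_split facR f0.
have g0 : g != 0 by apply: contra_neq f0 => g0; rewrite Ef g0 scaler0.
have sfg : size f = size g by rewrite Ef size_scale.
rewrite Ef -mul_polyC; apply: prime_factored_mul.
  have [u [s [uU sP ->]]] := facR _ c0.
  exists u%:P, [seq q%:P | q <- s]; split.
  - by rewrite poly_unitE size_polyC coefC eqxx uU andbT; case: (eqVneq u 0) uU => // ->; rewrite unitr0.
  - by move=> p /mapP[q /sP qP ->]; apply: prime_polyC.
  - by rewrite polyCM big_map rmorph_prod.
have [sg|sg] := leqP (size g) 1.
  move: gP g0; rewrite (size1_polyC sg) polyC_eq0 => gP g0.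
  have [gU|gU] := boolP (g`_0 \is a GRing.unit).
    exists (g`_0)%:P, [::]; split=> //; last by rewrite big_nil mulr1.
    by rewrite poly_unitE size_polyC coefC eqxx gU g0.
  have [p pP [e Ee]] := prime_divisor facR g0 gU.
  by case: (gP p pP); exists e%:P; rewrite Ee polyCM.
have [[a [b [Eg sa sb]]]|N] := classic (exists a b : {poly R},
    [/\ g = a * b, (size a < size g)%N & (size b < size g)%N]).
  have [a0 b0] : a != 0 /\ b != 0.
    by apply/andP; rewrite -negb_or -mulf_eq0 -Eg.
  rewrite Eg; apply: prime_factored_mul; apply: IHk => //.
    by apply: leq_trans sa _; rewrite -sfg.
  by apply: leq_trans sb _; rewrite -sfg.
apply/prime_factored_prime/irreducible_prime => // a b Eg sa sb.
by apply: N; exists a, b.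
Qed.

End Factorial.

Lemma factorial_iso (A B : idomainType) (f : {rmorphism A -> B}) (g : {rmorphism B -> A}) :
  cancel f g -> cancel g f -> factorial B -> factorial A.
Proof.
move=> fK gK facB a a0.
have f0 : f a != 0 by rewrite -[X in _ != X](rmorph0 f) (can_eq fK).
have [u [s [uU sP Ea]]] := facB _ f0.
have gU x : (g x \is a GRing.unit) -> x \is a GRing.unit.
  by move=> U; rewrite -[x]gK; apply: rmorph_unit.
exists (g u), (map g s); split; first exact: rmorph_unit.
  move=> _ /mapP[q /sP [q0 qU qM] ->]; split.
  - by rewrite -[X in _ != X](rmorph0 g) (can_eq gK).
  - by apply: contra qU; apply: gU.
  - move=> x y [e Ee]; have /qM : divides q (f x * f y).
      by exists (f e); rewrite -rmorphM Ee rmorphM gK.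
    case=> -[e' Ee']; [left|right]; exists (g e'); by rewrite -rmorphM -Ee' fK.
by rewrite big_map -rmorph_prod -rmorphM -Ea fK.
Qed.

(** * Polynomial rings over a field are factorial *)

Lemma mpoly_rmorph_ext (n : nat) (R S : comNzRingType)
    (f g : {rmorphism {mpoly R[n]} -> S}) :
    (forall c, f c%:MP = g c%:MP) -> (forall i, f 'X_i = g 'X_i) ->
  f =1 g.
Proof.
move=> fgC fgX p; rewrite [p]mpolyE !rmorph_sum /=; apply: eq_bigr => m _.
rewrite -mul_mpolyC !rmorphM /= fgC; congr (_ * _).
rewrite mpolyXE_id !rmorph_prod /=; apply: eq_bigr => i _.
by rewrite !rmorphXn /= fgX.
Qed.

Lemma muni_widen (n : nat) (R : comNzRingType) (i : 'I_n) :
  muni ('X_(widen_ord (leqnSn n) i) : {mpoly R[n.+1]}) = ('X_i)%:P.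
Proof.
rewrite muniE msuppX big_seq1 mcoeffX eqxx scale1r mnm1E.
have /negbTE-> : widen_ord (leqnSn n) i != ord_max by rewrite -val_eqE /= ltn_eqF.
rewrite expr0 alg_polyC; congr (_%:P); congr 'X_[_]; apply/mnmP => j.
by rewrite mnmE !mnm1E -val_eqE /= val_eqE.
Qed.

Lemma muni_max (n : nat) (R : comNzRingType) :
  muni ('X_ord_max : {mpoly R[n.+1]}) = 'X.
Proof.
rewrite muniE msuppX big_seq1 mcoeffX eqxx scale1r mnm1E eqxx expr1.
set m := [multinom _ | _ < _]; suff -> : m = 0%MM by rewrite mpolyX0 scale1r.
apply/mnmP => j; rewrite mnmE mnm1E mnm0E -val_eqE /= gtn_eqF //.
Qed.

Lemma ord_max_or_widen (n : nat) (i : 'I_n.+1) :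
  i = ord_max \/ exists j, i = widen_ord (leqnSn n) j.
Proof.
have [->|N] := eqVneq i ord_max; first by left.
have lt : (i < n)%N by rewrite ltn_neqAle -ltnS ltn_ord andbT.
by right; exists (Ordinal lt); apply: val_inj.
Qed.

Section MuniIso.
Variables (n : nat) (R : comNzRingType).

Definition muni_inv : {poly {mpoly R[n]}} -> {mpoly R[n.+1]} :=
  horner_eval ('X_ord_max : {mpoly R[n.+1]}) \o map_poly (@mwiden n R).
HB.instance Definition _ := GRing.RMorphism.copy muni_inv
  [the {rmorphism {poly {mpoly R[n]}} -> {mpoly R[n.+1]}} of
   horner_eval ('X_ord_max : {mpoly R[n.+1]}) \o map_poly (@mwiden n R)].

Lemma mwidenXi i : mwiden ('X_i : {mpoly R[n]}) = 'X_(widen_ord (leqnSn n) i).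
Proof. by rewrite mwidenX mnmwiden1. Qed.

Lemma muniK : cancel (@muni n R) muni_inv.
Proof.
pose f := [the {rmorphism _ -> _} of muni_inv \o @muni n R].
apply: (@mpoly_rmorph_ext _ _ _ f idfun) => [c|i] /=.
  by rewrite muniC /muni_inv /= map_polyC /= horner_evalE hornerC mwidenC.
have [->|[j ->]] := ord_max_or_widen i.
  by rewrite muni_max /muni_inv /= map_polyX horner_evalE hornerX.
by rewrite muni_widen /muni_inv /= map_polyC horner_evalE hornerC /= mwidenXi.
Qed.

Lemma muni_mwiden p : muni (mwiden p) = p%:P :> {poly {mpoly R[n]}}.
Proof.
apply: (@mpoly_rmorph_ext _ _ _
  [the {rmorphism _ -> _} of @muni n R \o @mwiden n R] polyC) => [c|i] /=.
  by rewrite mwidenC muniC.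
by rewrite mwidenXi muni_widen.
Qed.

Lemma muni_invK : cancel muni_inv (@muni n R).
Proof.
move=> p; elim/poly_ind: p => [|p c IHp]; first by rewrite !rmorph0.
rewrite !rmorphD !rmorphM /= IHp; congr (_ * _ + _); last first.
  by rewrite /muni_inv /= map_polyC horner_evalE hornerC /= muni_mwiden.
by rewrite /muni_inv /= map_polyX horner_evalE hornerX muni_max.
Qed.

End MuniIso.

Lemma factorial_field (K : fieldType) : factorial K.
Proof.
move=> a a0; exists a, [::]; split=> //; first by rewrite unitfE.
by rewrite big_nil mulr1.
Qed.

Lemma factorial_mpoly (K : fieldType) n : factorial {mpoly K[n]}.
Proof.
elim: n => [|n IHn]; last first.
  exact: factorial_iso (@muniK n K) (@muni_invK n K) (factorial_poly IHn).
move=> p p0; exists p, [::]; split=> //; last by rewrite big_nil mulr1.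
have Ep : p = (p@_0%MM)%:MP by rewrite mpolyKC.
rewrite Ep; apply: (rmorph_unit (@mpolyC 0 K)); rewrite unitfE.
by apply: contra_neq p0 => E; rewrite Ep E mpolyC0.
Qed.

(** * Coprime elements and reduced fractions *)

Definition coprime_elts (A : idomainType) (a b : A) :=
  forall d, divides d a -> divides d b -> d \is a GRing.unit.

Lemma pair_row0 (T : Type) (a b : T) : pair_row a b 0 ord0 = a.
Proof. by rewrite mxE (tnth_nth a). Qed.

Lemma pair_row1 (T : Type) (a b : T) : pair_row a b 0 ord_max = b.
Proof. by rewrite mxE (tnth_nth a). Qed.

Lemma ord2P (i : 'I_2) : i = ord0 \/ i = ord_max.
Proof. by case: i => -[|[|//]] lti; [left | right]; apply: val_inj. Qed.

Section Coprime.
Variable R : idomainType.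
Implicit Types (a b c d : R).

Lemma primitive_pairP a b : primitive (pair_row a b) <-> coprime_elts a b.
Proof.
split=> [[_ H] d da db|H].
  by apply: H => i; case: (ord2P i) => ->; rewrite ?pair_row0 ?pair_row1.
split=> [|d H2]; last first.
  apply: H; [have := H2 ord0 | have := H2 ord_max].
    by rewrite pair_row0.
  by rewrite pair_row1.
apply/eqP => /rowP E; have := E ord_max; have := E ord0.
rewrite pair_row0 pair_row1 !mxE => a0 b0; have := H 0.
by rewrite unitr0 b0 a0 => H'; have := H' (divides0 _) (divides0 _).
Qed.

Lemma coprime_neq0 a b : coprime_elts a b -> a != 0 \/ b != 0.
Proof.
have [->|a0] := eqVneq a 0; last by left.
move=> H; right; apply: contraTneq (H b (divides0 _) (divides_refl _)) => ->.
by rewrite unitr0.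
Qed.

Lemma coprime_sym a b : coprime_elts a b -> coprime_elts b a.
Proof. by move=> H d db da; apply: H. Qed.

Lemma coprime_prime a b : factorial R ->
  coprime_elts a b <->
  ((a != 0 \/ b != 0) /\ forall p, prime_elt p -> divides p a -> divides p b -> False).
Proof.
move=> facR; split=> [H|[ab0 H] d da db].
  split=> [|p [_ /negP pU _] pa pb]; [exact: coprime_neq0 | exact/pU/H].
apply/negPn/negP => dU.
have d0 : d != 0.
  apply/eqP => d0; move: da db; rewrite d0 => -[e Ee] [e' Ee'].
  by case: ab0; rewrite ?Ee ?Ee' mulr0 eqxx.
have [p pP pd] := prime_divisor facR d0 dU.
by apply: (H p pP); apply: divides_trans pd _.
Qed.

Lemma gauss a b c : factorial R -> b != 0 -> coprime_elts a b ->
  divides b (a * c) -> divides b c.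
Proof.
move=> facR b0; have [u [s [uU sP ->]]] := facR _ b0 => {b b0}.
elim: s c sP => [|p s IHs] c sP.
  by move=> _ _; rewrite big_nil mulr1; exists (c * u^-1); rewrite divrK.
have pP : prime_elt p by apply: sP; rewrite mem_head.
have [p0 pU pM] := pP.
rewrite big_cons => cop [e Ee].
have [|pa|[c' Ec]] := pM a c; first by rewrite Ee; exists (e * u * \prod_(j <- s) j); ring.
  case/negP: pU; apply: cop => //; exists (u * \prod_(j <- s) j); ring.
have [|||d Ed] := IHs c'.
- by move=> q qs; apply: sP; rewrite inE qs orbT.
- move=> d da ds; apply: cop => //; apply: (divides_trans ds).
  by exists p; ring.
- by exists e; apply: (mulIf p0); rewrite -mulrA -Ec Ee; ring.
by exists d; rewrite Ec Ed; ring.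
Qed.

Lemma coprime_fraction_eq a b a' b' : factorial R -> coprime_elts a b ->
  coprime_elts a' b' -> b != 0 -> b' != 0 -> a * b' = a' * b ->
  exists2 u, u \is a GRing.unit & a = u * a' /\ b = u * b'.
Proof.
move=> facR cop cop' b0 b'0 E.
have [v Ev] : divides b b' by apply: (gauss facR b0 cop); exists a'.
have [u Eu] : divides b' b by apply: (gauss facR b'0 cop'); exists a.
exists u; last by split=> //; apply: (mulIf b'0); rewrite E Eu; ring.
apply/unitrP; exists v.
have E1 : v * u = 1 by apply: (mulIf b'0); rewrite mul1r -mulrA -Eu -Ev.
by split; rewrite ?[u * v]mulrC.
Qed.

Lemma fraction_rep (z : {fraction R}) :
  exists a b, b != 0 /\ z = tofrac a / tofrac b.
Proof.
elim/quotW: z => x; exists (frac x).1, (frac x).2; split; first exact: denom_ratioP.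
have d0 : tofrac (frac x).2 != 0 by rewrite tofrac_eq0 denom_ratioP.
apply: (canRL (mulfK d0)); unlock tofrac; rewrite -[LHS]FracField.pi_mul.
apply/eqmodP; rewrite /= /FracField.equivf /FracField.mulf.
by rewrite !numden_Ratio ?oner_neq0 ?mulr1 ?denom_ratioP //= mulrC.
Qed.

Lemma coprime_reduce a b : factorial R -> b != 0 ->
  exists a' b', [/\ coprime_elts a' b', b' != 0 & a * b' = a' * b].
Proof.
move=> facR b0; have [u [s [uU sP Eb]]] := facR _ b0.
have [k] := ubnP (size s); elim: k a b b0 u s uU sP Eb => // k IHk a b b0 u s uU sP Eb lek.
have [[p [pP [a' Ea'] [b' Eb']]]|N] := classic (exists p, [/\ prime_elt p, divides p a & divides p b]).
  have p0 : p != 0 by case: pP.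
  have b'0 : b' != 0 by apply: contra_neq b0 => b'0; rewrite Eb' b'0 mul0r.
  have E : u * \prod_(q <- s) q = p * b' by rewrite -Eb Eb' mulrC.
  have [u' [s' [u'U s'P Es' Eb'']]] := prime_factor_cancel uU sP pP E.
  have [|a1 [b1 [cop b10 E1]]] := IHk a' b' b'0 u' s' u'U s'P Eb''; first by rewrite Es' in lek.
  by exists a1, b1; split=> //; rewrite Ea' Eb' mulrA -E1; ring.
exists a, b; split=> //; apply/coprime_prime => //; split; first by right.
by move=> p pP pa pb; apply: N; exists p.
Qed.

End Coprime.

(** * Binary forms and their values *)

Section HomogeneousValue.
Variables (K A : comNzRingType) (iota : {rmorphism K -> A}).
Implicit Types (f g : {poly K}) (a b : A).

(* b^d f(a / b), without denominators when size f <= d.+1; higher coefficients are dropped *)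
Definition hval d f a b := \sum_(i < d.+1) iota f`_i * a ^+ i * b ^+ (d - i).

Lemma hvalD d f g a b : hval d (f + g) a b = hval d f a b + hval d g a b.
Proof.
rewrite -big_split /=; apply: eq_bigr => i _.
by rewrite coefD rmorphD !mulrDl.
Qed.

Lemma hval0 d a b : hval d 0 a b = 0.
Proof. by rewrite /hval big1 // => i _; rewrite coef0 rmorph0 !mul0r. Qed.

Lemma hvalZ d c f a b : hval d (c *: f) a b = iota c * hval d f a b.
Proof.
rewrite mulr_sumr /=; apply: eq_bigr => i _.
by rewrite coefZ rmorphM !mulrA.
Qed.

Lemma hval_sum d (I : Type) (r : seq I) (P : pred I) (F : I -> {poly K}) a b :
  hval d (\sum_(i <- r | P i) F i) a b = \sum_(i <- r | P i) hval d (F i) a b.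
Proof. exact: (big_morph (fun f => hval d f a b) (fun f g => hvalD d f g a b) (hval0 d a b)). Qed.

Lemma hvalXn d k a b : (k <= d)%N -> hval d 'X^k a b = a ^+ k * b ^+ (d - k).
Proof.
move=> led; rewrite /hval (bigD1 (Ordinal (led : (k < d.+1)%N))) //= big1 => [|i Ni].
  by rewrite coefXn eqxx rmorph1 mul1r addr0.
by rewrite coefXn; move: Ni; rewrite -val_eqE /= => /negbTE->; rewrite rmorph0 !mul0r.
Qed.

Lemma poly_wide f k : (size f <= k)%N -> f = \sum_(i < k) f`_i *: 'X^i.
Proof.
move=> lek; rewrite -poly_def; apply/polyP => i; rewrite coef_poly.
by case: ltnP => // le; rewrite nth_default // (leq_trans lek).
Qed.

Lemma hvalM d e f g a b : (size f <= d.+1)%N -> (size g <= e.+1)%N ->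
  hval (d + e) (f * g) a b = hval d f a b * hval e g a b.
Proof.
move=> sf sg; rewrite (poly_wide sf) (poly_wide sg) mulr_suml !hval_sum mulr_suml.
apply: eq_bigr => i _; rewrite mulr_sumr hval_sum mulr_sumr; apply: eq_bigr => j _.
have lei : (i <= d)%N by rewrite -ltnS ltn_ord.
have lej : (j <= e)%N by rewrite -ltnS ltn_ord.
rewrite -scalerAl -scalerAr -exprD !hvalZ !hvalXn ?leq_add //.
have -> : (d + e - (i + j) = (d - i) + (e - j))%N.
  by rewrite -{1}(subnK lei) -{1}(subnK lej) addnACA addnK.
by rewrite !exprD; ring.
Qed.

Lemma hval1 d a b : hval d 1 a b = b ^+ d.
Proof. by rewrite -[1](expr0 'X) hvalXn // expr0 mul1r subn0. Qed.

Lemma hvalC c a b : hval 0 c%:P a b = iota c.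
Proof. by rewrite /hval big_ord1 coefC eqxx !expr0 !mulr1. Qed.

(** Raising the formal degree by one multiplies the form by its second variable: a polynomial of
    deficient degree stands for a form divisible by y_2. *)
Lemma hval_lower d f a b : (size f <= d.+1)%N -> hval d.+1 f a b = b * hval d f a b.
Proof.
by move=> sf; rewrite -addn1 -[f]mulr1 hvalM ?size_poly1 // mulr1 hval1 expr1 mulrC.
Qed.

Lemma hval_lead d f a b : exists w, hval d f a b = iota f`_d * a ^+ d + w * b.
Proof.
exists (\sum_(i < d) iota f`_i * a ^+ i * b ^+ (d - i).-1).
rewrite /hval big_ord_recr /= subnn mulr1 addrC; congr (_ + _).
rewrite mulr_suml; apply: eq_bigr => i _; rewrite -!mulrA -exprSr prednK //.
by rewrite subn_gt0.
Qed.

Lemma hval_scale d f a b c : hval d f (c * a) (c * b) = c ^+ d * hval d f a b.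
Proof.
rewrite mulr_sumr; apply: eq_bigr => i _; have lei : (i <= d)%N by rewrite -ltnS ltn_ord.
have -> : c ^+ d = c ^+ i * c ^+ (d - i) by rewrite -exprD subnKC.
by rewrite !exprMn; ring.
Qed.

End HomogeneousValue.

Lemma hval_morph (K A B : comNzRingType) (iota : {rmorphism K -> A})
    (phi : {rmorphism A -> B}) d (f : {poly K}) (a b : A) :
  phi (hval iota d f a b) = hval (phi \o iota) d f (phi a) (phi b).
Proof.
rewrite rmorph_sum; apply: eq_bigr => i _.
by rewrite !rmorphM !rmorphXn.
Qed.

Lemma hval_frac (K : comNzRingType) (L : fieldType) (iota : {rmorphism K -> L}) d
    (f : {poly K}) (a b : L) : b != 0 -> (size f <= d.+1)%N ->
  hval iota d f a b = b ^+ d * (map_poly iota f).[a / b].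
Proof.
move=> b0 sf; rewrite {2}(poly_wide sf) rmorph_sum /= horner_sum mulr_sumr.
apply: eq_bigr => i _; have lei : (i <= d)%N by rewrite -ltnS ltn_ord.
rewrite map_polyZ map_polyXn hornerZ hornerXn expr_div_n.
have -> : b ^+ d = b ^+ i * b ^+ (d - i) by rewrite -exprD subnKC.
by field; rewrite expf_neq0.
Qed.

(** * Families of univariate polynomials without common factor *)

Section FieldFamilies.
Variables (K : fieldType) (m : nat).
Implicit Types (f : 'I_m -> {poly K}).

(** Euclid's algorithm on the ideal generated by the family: as long as a nonzero combination g
    fails to divide some [f i], the remainder of [f i] by g is a combination of smaller size. *)
Lemma poly_gcd_family f : exists g : {poly K}, exists u : 'I_m -> {poly K},
  g = \sum_i u i * f i /\ forall i, divides g (f i).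
Proof.
have [|N0] := classic (forall i, f i = 0).
  move=> f0; exists 0, (fun=> 0); split=> [|i]; last by rewrite f0; apply: divides0.
  by rewrite big1 // => i _; rewrite mul0r.
have [i0 fi0] : exists i, f i != 0.
  by apply: NNPP => N; apply: N0 => i; apply/eqP/negPn/negP => fi; apply: N; exists i.
suff H k (g : {poly K}) u : (size g < k)%N -> g = \sum_i u i * f i -> g != 0 ->
    exists g' : {poly K}, exists u' : 'I_m -> {poly K},
    g' = \sum_i u' i * f i /\ forall i, divides g' (f i).
  apply: (H (size (f i0)).+1 (f i0) (fun i => (i == i0)%:R)) => //.
  rewrite (bigD1 i0) //= eqxx mul1r big1 ?addr0 // => i /negbTE->.
  by rewrite mul0r.
elim: k g u => // k IHk g u lek Eg g0.
have [H|N] := classic (forall i, divides g (f i)); first by exists g, u.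
have [i Ni] : exists i, f i %% g != 0.
  apply: NNPP => N'; apply: N => i; exists (f i %/ g).
  have [E|E] := eqVneq (f i %% g) 0; last by case: N'; exists i.
  by rewrite {1}(divp_eq (f i) g) E addr0.
apply: (IHk (f i %% g) (fun j => (j == i)%:R - (f i %/ g) * u j)) => //.
  by rewrite -ltnS in lek; apply: leq_trans (ltn_modpN0 _ g0) lek.
rewrite (_ : \sum_j _ = \sum_j ((j == i)%:R * f j - (f i %/ g) * (u j * f j))); last first.
  by apply: eq_bigr => j _; rewrite mulrBl mulrA.
rewrite sumrB -mulr_sumr -Eg (bigD1 i) //= eqxx mul1r big1 ?addr0 => [|j /negbTE->]; last by rewrite mul0r.
by apply/esym/eqP; rewrite subr_eq addrC -divp_eq.
Qed.

(* The univariate dehomogenizations of a primitive tuple of binary forms of degree s. *)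
Definition good s f := [/\ forall i, (size (f i) <= s.+1)%N,
  exists i, size (f i) = s.+1 & exists u : 'I_m -> {poly K}, \sum_i u i * f i = 1].

Definition hval_row (A : comNzRingType) (iota : {rmorphism K -> A}) s f a b : 'rV[A]_m :=
  \row_i hval iota s (f i) a b.

Section Domain.
Variables (A : idomainType) (iota : {rmorphism K -> A}).

Lemma good_denominator_power s f a b : good s f ->
  exists N (v : 'I_m -> A), b ^+ N = \sum_i v i * hval iota s (f i) a b.
Proof.
case=> sf _ [u Eu].
(* The number [e] is large enough as formal degree of every [u i]. Homogenizing the identity for 1
   in formal degree [e + s] therefore splits each product, while 1 becomes b^(e + s). *)
pose e := \max_i size (u i); exists (e + s)%N, (fun i => hval iota e (u i) a b).
rewrite -(hval1 iota (e + s) a) -Eu hval_sum; apply: eq_bigr => i _.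
rewrite hvalM //; apply: leq_trans (leqnSn _).
exact: (leq_bigmax_cond i (F := fun i => size (u i))).
Qed.

Lemma good_common_prime s f a b p : good s f -> prime_elt p ->
  (forall i, divides p (hval iota s (f i) a b)) -> divides p a /\ divides p b.
Proof.
move=> fgood pP dp; have [sf [i0 si0] _] := fgood.
have pb : divides p b.
  have [N [v Ev]] := good_denominator_power a b fgood.
  apply: (prime_eltX pP (k := N)); rewrite Ev; apply: divides_sum => i _.
  exact/divides_mull.
split=> //; have [w Ew] := hval_lead iota s (f i0) a b.
have : divides p (iota (f i0)`_s * a ^+ s).
  rewrite -[X in divides p X](addrK (w * b)) -Ew.
  by apply: divides_sub; [apply: dp | apply: divides_mull].
have [p0 pU pM] := pP; case/pM; last exact: prime_eltX.
move=> pl; case/negP: (prime_elt_unitN pP pl); apply: rmorph_unit.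
by rewrite unitfE -[s]/(s.+1.-1) -si0 -lead_coefE lead_coef_eq0 -size_poly_gt0 si0.
Qed.

Lemma good_hval_neq0 s f a b : good s f -> a != 0 \/ b != 0 ->
  exists i, hval iota s (f i) a b != 0.
Proof.
move=> fgood ab0; have [sf [i0 si0] _] := fgood.
apply: NNPP => N; have E i : hval iota s (f i) a b = 0.
  by apply/eqP/negPn/negP => Ni; apply: N; exists i.
have [M [v Ev]] := good_denominator_power a b fgood.
have b0 : b = 0.
  apply/eqP; apply: contraTT isT => b0; have : b ^+ M != 0 by rewrite expf_neq0.
  by rewrite Ev big1 ?eqxx // => i _; rewrite E mulr0.
case: ab0; last by rewrite b0 eqxx.
have [w] := hval_lead iota s (f i0) a b; rewrite E b0 mulr0 addr0 => /esym/eqP.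
have /negbTE l0 : (f i0)`_s != 0.
  by rewrite -[s]/(s.+1.-1) -si0 -lead_coefE lead_coef_eq0 -size_poly_gt0 si0.
rewrite mulf_eq0 fmorph_eq0 l0 /=; by rewrite expf_eq0 => /andP[_ /eqP->]; rewrite eqxx.
Qed.

Lemma good_primitive s f a b : factorial A -> good s f -> coprime_elts a b ->
  primitive (hval_row iota s f a b).
Proof.
move=> facA fgood cop.
have [i0 Ni0] := good_hval_neq0 fgood (coprime_neq0 cop).
split=> [|d dd]; first by apply: contra_neq Ni0 => /rowP/(_ i0); rewrite !mxE.
apply/negPn/negP => dU.
have d0 : d != 0.
  apply: contra_neq Ni0 => d0; have [e] := dd i0.
  by rewrite mxE => ->; rewrite d0 mulr0.
have [p pP pd] := prime_divisor facA d0 dU.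
have [|pa pb] := @good_common_prime s f a b p fgood pP.
  by move=> i; apply: divides_trans pd _; have := dd i; rewrite mxE.
by have [_ /negP[]] := pP; apply: cop.
Qed.

End Domain.
End FieldFamilies.

(** * Binary forms and their dehomogenizations *)

Section BinaryForms.
Variable K : fieldType.
Local Notation Y0 := ('X_ord0 : {mpoly K[2]}).
Local Notation Y1 := ('X_ord_max : {mpoly K[2]}).

Definition dehom (h : {mpoly K[2]}) : {poly K} :=
  mmap (@polyC K) (fun i => if i == ord0 then 'X else 1) h.

Lemma mdeg2 (u : 'X_{1..2}) : mdeg u = (u ord0 + u ord_max)%N.
Proof. by rewrite mdegE big_ord_recl big_ord1; congr (_ + u _)%N; apply: val_inj. Qed.

Lemma mmap1_2 (A : comNzRingType) (v : 'I_2 -> A) (u : 'X_{1..2}) :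
  mmap1 v u = v ord0 ^+ u ord0 * v ord_max ^+ u ord_max.
Proof.
rewrite /mmap1 big_ord_recl big_ord1.
by rewrite (_ : lift ord0 ord0 = ord_max); last by apply: val_inj.
Qed.

Lemma dehomE h : dehom h = \sum_(u <- msupp h) h@_u *: 'X^(u ord0).
Proof.
rewrite /dehom /mmap; apply: eq_bigr => u _.
by rewrite mmap1_2 /= expr1n mulr1 mul_polyC.
Qed.

Lemma size_dehom d h : h \is d.-homog -> (size (dehom h) <= d.+1)%N.
Proof.
move=> /dhomogP hh; rewrite dehomE big_seq.
apply: (leq_trans (size_sum _ _ _)); apply/bigmax_leqP_seq => u us _.
apply: (leq_trans (size_scale_leq _ _)); rewrite size_polyXn ltnS.
have <- : mdeg u = d := hh u us.
by rewrite mdeg2 leq_addr.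
Qed.

Lemma hval_dehom d h : h \is d.-homog -> h = hval (@mpolyC 2 K) d (dehom h) Y0 Y1.
Proof.
move=> /dhomogP hh; rewrite dehomE hval_sum {1}[h]mpolyE; apply: eq_big_seq => u us.
have du : (u ord0 + u ord_max = d)%N by rewrite -mdeg2; apply: hh.
rewrite hvalZ hvalXn ?mul_mpolyC; last by rewrite -du leq_addr.
congr (_ *: _); by rewrite -du addKn -[LHS]mmap1_id mmap1_2.
Qed.

Lemma comp_dehom n d (h : {mpoly K[2]}) (p q : {mpoly K[n]}) : h \is d.-homog ->
  h \mPo [tuple p; q] = hval (@mpolyC n K) d (dehom h) p q.
Proof.
move=> hh; rewrite {1}(hval_dehom hh) hval_morph /= !comp_mpolyXU /=.
by apply: eq_bigr => i _; rewrite /= comp_mpolyC.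
Qed.

Lemma hval_homog n d e f (p q : {mpoly K[n]}) : p \is e.-homog -> q \is e.-homog ->
  hval (@mpolyC n K) d f p q \is (e * d).-homog.
Proof.
move=> hp hq; apply: rpred_sum => i _; have lei : (i <= d)%N by rewrite -ltnS ltn_ord.
rewrite -mulrA mul_mpolyC; apply: rpredZ.
have -> : (e * d = e * i + e * (d - i))%N by rewrite -mulnDr subnKC.
by apply: dhomogM; apply: dhomogMn.
Qed.

Lemma dhomog_unit n d (h : {mpoly K[n]}) : h \is d.-homog -> h \is a GRing.unit -> d = 0%N.
Proof.
move=> hh hU; have h0 : h != 0 by apply: contraTneq hU => ->; rewrite unitr0.
have /andP[/eqP Eh _] : mpoly_unit h by exact: hU.
apply: (dhomog_uniq h0 hh); rewrite Eh -[(h@_0%MM)%:MP]mulr1 mul_mpolyC.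
exact/rpredZ/dhomog1.
Qed.

Lemma dhomogXi n i : ('X_i : {mpoly K[n]}) \is 1.-homog.
Proof. by rewrite dhomogX /= mdeg1. Qed.

(** Each defect of the dehomogenizations yields a nonunit common divisor of the forms. If all
    degrees stay below s > 0, this is y_2; for s = 0 all forms would vanish. If the gcd of the
    dehomogenizations has positive degree, it is the homogenization of that gcd. *)
Lemma good_of_primitive m s (h : 'rV[{mpoly K[2]}]_m) :
  (forall i, h 0 i \is s.-homog) -> primitive h -> good s (fun i => dehom (h 0 i)).
Proof.
move=> hh [h0 hP]; have sf i := size_dehom (hh i).
have [i0 hi0] : exists i, h 0 i != 0.
  apply: NNPP => N; case/eqP: h0; apply/rowP => i; rewrite mxE.
  by apply/eqP/negPn/negP => Ni; apply: N; exists i.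
have fi0 : dehom (h 0 i0) != 0.
  by apply: contra_neq hi0 => E; rewrite (hval_dehom (hh i0)) E hval0.
split=> //.
  apply: NNPP => N.
  have lt i : (size (dehom (h 0%R i)) <= s)%N.
    by rewrite -ltnS ltn_neqAle sf andbT; apply/eqP => E; apply: N; exists i.
  case: s hh sf lt {N} => [|s] hh sf lt.
    by have := lt i0; rewrite leqn0 size_poly_eq0 (negbTE fi0).
  have : Y1 \is a GRing.unit.
    apply: hP => i; rewrite (hval_dehom (hh i)) hval_lower //.
    by rewrite mulrC; eexists.
  by move/(dhomog_unit (dhomogXi _)).
have [g [u [Eg dg]]] := poly_gcd_family (fun i => dehom (h 0 i)).
have g0 : g != 0.
  by apply: contra_neq fi0 => E; have [e] := dg i0; rewrite E mulr0.
have sg : size g = (size g).-1.+1 by rewrite prednK // size_poly_gt0.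
suff /eqP : (size g).-1 = 0%N.
  rewrite -eqSS -sg => /eqP/eqP/size_poly1P[c c0 Ec].
  exists (fun i => c^-1 *: u i); under eq_bigr => i _ do rewrite -scalerAl.
  by rewrite -scaler_sumr -Eg Ec -mul_polyC -polyCM mulVf.
have les : ((size g).-1 <= s)%N.
  have [e E] := dg i0; have e0 : e != 0 by apply: contra_neq fi0 => e0; rewrite E e0 mul0r.
  rewrite -ltnS -sg; apply: leq_trans (sf i0); rewrite E size_mul //.
  by rewrite sg addnS /= -{1}[(size g).-1.+1]add0n; case: (size e) (size_poly_gt0 e); rewrite ?e0 // => k _; rewrite addSn ltnS leq_addl.
have hg : hval (@mpolyC 2 K) (size g).-1 g Y0 Y1 \is (1 * (size g).-1).-homog.
  by apply: hval_homog; apply: dhomogXi.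
rewrite mul1n in hg; apply: (dhomog_unit hg).
apply: hP => i; have [e E] := dg i; rewrite (hval_dehom (hh i)) E.
exists (hval (@mpolyC 2 K) (s - (size g).-1) e Y0 Y1).
have se : (size e <= (s - (size g).-1).+1)%N.
  have [->|e0] := eqVneq e 0; first by rewrite size_poly0.
  have := sf i; rewrite E size_mul // {1}sg addnS /= => le.
  by rewrite -subSn // leq_subRL ?(leq_trans les) // addnC.
have sg' : (size g <= (size g).-1.+1)%N by rewrite -sg.
by rewrite -(hvalM _ _ _ se sg') subnK.
Qed.

End BinaryForms.

(** * Algebraic elements of a field of fractions *)

Section RationalRoot.
Variables (K : fieldType) (A : idomainType) (L : fieldType).
Variables (iota : {rmorphism K -> A}) (j : {rmorphism A -> L}).
Hypothesis j_inj : injective j.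
Hypothesis j_frac : forall z, exists a b, b != 0 /\ z = j a / j b.
Hypothesis facA : factorial A.

Lemma fraction_eq0 a : (j a == 0) = (a == 0).
Proof. by rewrite -(inj_eq j_inj) rmorph0. Qed.

Lemma coprime_fraction z : exists a b, [/\ coprime_elts a b, b != 0 & z = j a / j b].
Proof.
have [a [b [b0 ->]]] := j_frac z.
have [a' [b' [cop b'0 E]]] := coprime_reduce a facA b0.
exists a', b'; split=> //; apply/eqP.
by rewrite eqr_div ?fraction_eq0 // -!rmorphM E.
Qed.

(** The rational root theorem with invertible leading coefficient: homogenizing f(a / b) = 0 shows
    that a prime factor of b divides a power of a, against coprimality. *)
Lemma rational_root (f : {poly K}) (a b : A) : f != 0 -> coprime_elts a b -> b != 0 ->
  (map_poly (j \o iota) f).[j a / j b] = 0 -> b \is a GRing.unit.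
Proof.
move=> f0 cop b0 E.
have fb0 : j b != 0 by rewrite fraction_eq0.
have sf : (size f <= (size f).-1.+1)%N by rewrite prednK // size_poly_gt0.
have : hval iota (size f).-1 f a b = 0.
  by apply/eqP; rewrite -fraction_eq0 hval_morph hval_frac // E mulr0.
have [w ->] := hval_lead iota (size f).-1 f a b => /eqP; rewrite addr_eq0 => /eqP Ew.
have lU : iota (lead_coef f) \is a GRing.unit by apply: rmorph_unit; rewrite unitfE lead_coef_eq0.
apply/negPn/negP => bU; have [p pP pb] := prime_divisor facA b0 bU.
have [_ /negP pU pM] := pP; apply: pU; apply: cop => //.
have : divides p (iota (lead_coef f) * a ^+ (size f).-1).
  by rewrite lead_coefE Ew -mulNr; apply: divides_mull.
case/pM; last exact: prime_eltX.
by move/(prime_elt_unitN pP); rewrite lU.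
Qed.

(** If z is nonzero and algebraic, so is its inverse. The rational root theorem, applied to both,
    makes the reduced numerator and denominator units. *)
Lemma algebraic_fraction z :
  algebraicOver (j \o iota) z -> exists2 c, z = j c & c = 0 \/ c \is a GRing.unit.
Proof.
have [->|z0] := eqVneq z 0; first by exists 0; [rewrite rmorph0 | left].
move=> zalg; have [a [b [cop b0 Ez]]] := coprime_fraction z.
have a0 : a != 0 by apply: contra_neq z0 => a0; rewrite Ez a0 rmorph0 mul0r.
have bU : b \is a GRing.unit.
  by have [f f0 /rootP] := zalg; rewrite Ez; apply: rational_root.
have aU : a \is a GRing.unit.
  have [f f0 /rootP] := algebraic_inv zalg; rewrite Ez invf_div.
  exact: (rational_root f0 (coprime_sym cop) a0).
exists (a / b); last by right; rewrite unitrM aU unitrV.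
by rewrite rmorphM rmorphV // Ez.
Qed.

End RationalRoot.

(** * Transcendence degree *)

Section Subfields.
Variable L : fieldType.
Implicit Types (E : L -> Prop) (a b x y : L).

Definition subfield E := [/\ E 1, forall x y, E x -> E y -> E (x - y)
  & forall x y, E x -> E y -> E (x / y)].

(** A boolean version of E, obtained from the informative excluded middle. It makes the elements of
    E a [fieldType], to which polynomial division and [algebraicOver] apply. *)
Definition subfield_mem E (HE : subfield E) : L -> bool :=
  fun x => if excluded_middle_informative (E x) then true else false.

Lemma subfield_memP E (HE : subfield E) x : reflect (E x) (subfield_mem HE x).
Proof. by rewrite /subfield_mem; case: excluded_middle_informative; constructor. Qed.

Lemma subfield_divring_closed E (HE : subfield E) : divring_closed (subfield_mem HE).
Proof.
case: (HE) => E1 EB ED; split=> [|x y /subfield_memP Ex /subfield_memP Ey|x y /subfield_memP Ex /subfield_memP Ey].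
- exact/subfield_memP.
- exact/subfield_memP/EB.
- exact/subfield_memP/ED.
Qed.

HB.instance Definition _ E (HE : subfield E) :=
  GRing.isDivringClosed.Build L (subfield_mem HE) (subfield_divring_closed HE).

Record subfield_type E (HE : subfield E) :=
  SubfieldElt { subfield_val : L; _ : subfield_mem HE subfield_val }.

HB.instance Definition _ E (HE : subfield E) := [isSub for @subfield_val E HE].
HB.instance Definition _ E (HE : subfield E) := [Choice of subfield_type HE by <:].
HB.instance Definition _ E (HE : subfield E) := [SubChoice_isSubComUnitRing of subfield_type HE by <:].
HB.instance Definition _ E (HE : subfield E) := [SubComUnitRing_isSubIntegralDomain of subfield_type HE by <:].
HB.instance Definition _ E (HE : subfield E) := [SubIntegralDomain_isSubField of subfield_type HE by <:].


Section OneSubfield.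
Variables (E : L -> Prop) (HE : subfield E).

Lemma subfield0 : E 0.
Proof. by case: HE => E1 EB _; rewrite -(subrr 1); apply: EB. Qed.

Lemma subfieldN x : E x -> E (- x).
Proof. by case: HE => _ EB _ Ex; rewrite -sub0r; apply: EB => //; apply: subfield0. Qed.

Lemma subfieldD x y : E x -> E y -> E (x + y).
Proof.
by case: HE => _ EB _ Ex Ey; rewrite -[y]opprK; apply: EB => //; apply: subfieldN.
Qed.

Lemma subfieldV x : E x -> E x^-1.
Proof. by case: HE => E1 _ ED Ex; rewrite -div1r; apply: ED. Qed.

Lemma subfieldM x y : E x -> E y -> E (x * y).
Proof. by case: HE => E1 _ ED Ex Ey; rewrite -[y]invrK; apply: ED => //; apply: subfieldV. Qed.

Lemma subfieldX x k : E x -> E (x ^+ k).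
Proof.
move=> Ex; elim: k => [|k IHk]; first by rewrite expr0; case: HE.
by rewrite exprS; apply: subfieldM.
Qed.

Lemma subfield_sum (I : Type) (r : seq I) (P : pred I) (F : I -> L) :
  (forall i, P i -> E (F i)) -> E (\sum_(i <- r | P i) F i).
Proof. by move=> EF; apply: big_ind => //; [exact: subfield0 | exact: subfieldD]. Qed.

Lemma subfield_horner (f : {poly L}) x : (forall i, E f`_i) -> E x -> E f.[x].
Proof.
move=> Ef Ex; rewrite horner_coef; apply: subfield_sum => i _.
exact/subfieldM/subfieldX.
Qed.

Definition subfield_elt x (Ex : E x) : subfield_type HE :=
  SubfieldElt (introT (subfield_memP HE x) Ex).

Lemma subfield_valP (u : subfield_type HE) : E (val u).
Proof. by case: u => x /= /subfield_memP. Qed.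

Lemma subfield_poly_lift (f : {poly L}) : (forall i, E f`_i) ->
  exists g : {poly subfield_type HE}, map_poly val g = f.
Proof.
move=> Ef; exists (\poly_(i < size f) subfield_elt (Ef i)).
apply/polyP => i; rewrite coef_map coef_poly /=.
by case: ltnP => // le; rewrite nth_default.
Qed.

Lemma algebraic_overP a :
  algebraic_over E a <-> algebraicOver (val : subfield_type HE -> L) a.
Proof.
split=> [[f [f0 Ef fa]]|[g g0 ga]].
  have [g Eg] := subfield_poly_lift Ef; exists g; last by rewrite Eg.
  by apply: contra_neq f0 => g0; rewrite -Eg g0 map_poly0.
exists (map_poly val g); rewrite map_poly_eq0; split=> // i.
by rewrite coef_map; apply: subfield_valP.
Qed.

Lemma algebraic_over_id a : E a -> algebraic_over E a.
Proof.
move=> Ea; apply/algebraic_overP; exact: (algebraic_id _ (subfield_elt Ea)).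
Qed.

Lemma algebraic_over_subfield : subfield (algebraic_over E).
Proof.
split=> [|x y /algebraic_overP Ax /algebraic_overP Ay|x y /algebraic_overP Ax /algebraic_overP Ay].
- by apply: algebraic_over_id; case: HE.
- exact/algebraic_overP/algebraic_sub.
- exact/algebraic_overP/algebraic_div.
Qed.

Lemma algebraic_over_trans a :
  algebraic_over (algebraic_over E) a -> algebraic_over E a.
Proof.
case=> f [f0 Ef fa]; apply/algebraic_overP/integral_algebraic.
apply: (integral_root f0 fa) => _ /(nthP 0)[i _ <-].
exact/integral_algebraic/algebraic_overP.
Qed.

End OneSubfield.

Lemma algebraic_over_mono E1 E2 a : (forall x, E1 x -> E2 x) ->
  algebraic_over E1 a -> algebraic_over E2 a.
Proof. by move=> sub [f [f0 Ef fa]]; exists f; split=> // i; apply: sub. Qed.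

(** The morphism [ev] stands for embeddings as well as for evaluations at a point, so it is the
    image of a denominator that must not vanish. *)
Lemma clear_denominators (A : idomainType) (ev : {rmorphism A -> L}) (f : {poly L}) :
    (forall i, exists N D, ev D != 0 /\ f`_i = ev N / ev D) ->
  exists (d : A) (g : {poly A}), ev d != 0 /\ map_poly ev g = ev d *: f.
Proof.
elim/poly_ind: f => [_|f c IHf H].
  by exists 1, 0; rewrite rmorph1 oner_neq0 map_poly0 scaler0.
have [i|d [g [d0 Eg]]] := IHf; first by have := H i.+1; rewrite coefD coefMX coefC /= addr0.
have [N [D [D0]]] := H 0%N; rewrite coefD coefMX coefC /= add0r => Ec.
exists (d * D), (D%:P * g * 'X + (d * N)%:P); rewrite rmorphM mulf_neq0 //; split=> //.
rewrite rmorphD !rmorphM /= map_polyX !map_polyC /= Eg Ec rmorphM -!mul_polyC !polyCM.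
have E : (ev N)%:P = (ev D)%:P * (ev N / ev D)%:P by rewrite -polyCM mulrC divfK.
by rewrite {1}E polyCM; ring.
Qed.

End Subfields.

Lemma map_horner_swap (F : nzRingType) (L : comNzRingType) (phi : {rmorphism F -> L})
    (g : {poly {poly F}}) a b :
  (map_poly (horner_eval b \o map_poly phi) g).[a] =
  (map_poly (horner_eval a \o map_poly phi) (swapXY g)).[b].
Proof.
rewrite (map_poly_comp (horner_eval b) (map_poly phi)) -horner_swapXY horner2_swapXY.
rewrite horner_polyC swapXY_map -map_poly_comp.
by congr (_.[_]); apply: eq_map_poly => p.
Qed.

(** * Relative algebraic closure and its exchange property *)

Section Closure.
Variables (K L : fieldType) (iota : {rmorphism K -> L}).
Implicit Types (A B : L -> Prop) (a b x y : L).

(** K(A) as the intersection of all subfields containing K and A. Membership is exploited by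
    applying it to a suitably chosen subfield, without explicit rational expressions. *)
Definition generated A x :=
  forall E, subfield E -> (forall k, E (iota k)) -> (forall a, A a -> E a) -> E x.

Lemma generated_subfield A : subfield (generated A).
Proof.
split=> [E [? ? ?]|x y gx gy E HE EK EA|x y gx gy E HE EK EA] //.
  by have [_ EB _] := HE; apply: EB; [apply: gx | apply: gy].
by have [_ _ ED] := HE; apply: ED; [apply: gx | apply: gy].
Qed.

Lemma generatedK A k : generated A (iota k).
Proof. by move=> E HE EK EA. Qed.

Lemma generated_id A a : A a -> generated A a.
Proof. by move=> Aa E HE EK EA; apply: EA. Qed.

(** The relative algebraic closure of K(A) in L, treated as the closure operator of a matroid. *)
Definition acl A := algebraic_over (generated A).

Lemma acl_subfield A : subfield (acl A).
Proof. exact/algebraic_over_subfield/generated_subfield. Qed.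

Lemma generated_acl A x : generated A x -> acl A x.
Proof. exact/algebraic_over_id/generated_subfield. Qed.

Lemma acl_id A a : A a -> acl A a.
Proof. by move=> Aa; apply: generated_acl; apply: generated_id. Qed.

Lemma acl_sub A B x : (forall a, A a -> acl B a) -> acl A x -> acl B x.
Proof.
move=> sub Ax; apply: algebraic_over_trans; first exact: generated_subfield.
apply: algebraic_over_mono Ax => y gy; apply: (gy (acl B)) => //; first exact: acl_subfield.
by move=> k; apply: generated_acl; apply: generatedK.
Qed.

Lemma generated_mono A B x : generated A x -> (forall a, A a -> B a) -> generated B x.
Proof. by move=> gx sub E HE EK EB; apply: gx => // a /sub /EB. Qed.

Lemma acl_mono A B x : (forall a, A a -> B a) -> acl A x -> acl B x.
Proof. by move=> sub; apply: acl_sub => a /sub; apply: acl_id. Qed.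

Definition adjoin1 A b x := A x \/ x = b.

Lemma generated_adjoin1 A b x : generated (adjoin1 A b) x ->
  exists N D : {poly subfield_type (generated_subfield A)},
    (map_poly val D).[b] != 0 /\ x = (map_poly val N).[b] / (map_poly val D).[b].
Proof.
move=> gx; apply: (gx (fun x => exists N D : {poly subfield_type (generated_subfield A)},
  (map_poly val D).[b] != 0 /\ x = (map_poly val N).[b] / (map_poly val D).[b])).
- split=> [|_ _ [N [D [D0 ->]]] [N' [D' [D'0 ->]]]|_ _ [N [D [D0 ->]]] [N' [D' [D'0 ->]]]].
  + by exists 1, 1; rewrite rmorph1 hornerC oner_neq0 divr1.
  + exists (N * D' - N' * D), (D * D').
    rewrite rmorphB !rmorphM /= !hornerE mulf_neq0 //; split=> //.
    by field; rewrite D0 D'0.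
  (* Division by 0 yields 0, and this value needs the separate representation 0 / 1. *)
  have [Nz|Nz] := eqVneq (map_poly val N').[b] 0.
    by exists 0, 1; rewrite Nz mul0r invr0 mulr0 rmorph0 rmorph1 horner0 hornerC oner_neq0 mul0r.
  exists (N * D'), (D * N'); rewrite !rmorphM /= !hornerE mulf_neq0 //; split=> //.
  by field; rewrite D0 D'0 Nz.
- move=> k; exists (subfield_elt (generated_subfield A) (@generatedK A k))%:P, 1.
  by rewrite rmorph1 map_polyC !hornerC oner_neq0 divr1.
move=> a [Aa|->].
  exists (subfield_elt (generated_subfield A) (generated_id Aa))%:P, 1.
  by rewrite rmorph1 map_polyC !hornerC oner_neq0 divr1.
by exists 'X, 1; rewrite rmorph1 map_polyX hornerX hornerC oner_neq0 divr1.
Qed.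

(** An equation for a over K(A, b) becomes, without denominators, a polynomial in two variables over
    K(A) that vanishes at a and b. Read in the other variable it is an equation for b over K(A, a),
    nontrivial since a is not a root of any nonzero polynomial over K(A). *)
Lemma acl_exchange A a b : acl (adjoin1 A b) a -> ~ acl A a -> acl (adjoin1 A a) b.
Proof.
move=> [f [f0 Ef fa]] Na; pose F := subfield_type (generated_subfield A).
pose ev x : {rmorphism {poly F} -> L} := horner_eval x \o map_poly val.
have [|d [g [d0 Eg]]] := @clear_denominators L {poly F} (ev b) f.
  by move=> i; apply: generated_adjoin1.
have g0 : g != 0.
  apply/eqP => g0; move/eqP: Eg; rewrite g0 map_poly0 eq_sym.
  by rewrite -mul_polyC mulf_eq0 polyC_eq0 (negbTE d0) (negbTE f0).
rewrite /ev in d0 Eg; have gab : (map_poly (horner_eval a \o map_poly val) (swapXY g)).[b] = 0.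
  by rewrite -map_horner_swap Eg hornerZ (rootP fa) mulr0.
exists (map_poly (horner_eval a \o map_poly val) (swapXY g)); split.
- apply: contra_neq g0 => /polyP H; apply/eqP; rewrite -swapXY_eq0; apply/eqP/polyP => i.
  rewrite coef0; have := H i; rewrite coef_map coef0 -[LHS]/((map_poly val (swapXY g)`_i).[a]) => E.
  apply/eqP/negPn/negP => Ni; apply: Na; apply/(algebraic_overP (generated_subfield A)).
  by exists (swapXY g)`_i => //; apply/rootP.
- move=> i; rewrite coef_map -[X in generated _ X]/((map_poly val (swapXY g)`_i).[a]).
  apply: (subfield_horner (generated_subfield (adjoin1 A a))).
  + move=> j.
rewrite coef_map; exact: (generated_mono (subfield_valP (swapXY g)`_i`_j) (fun y Ay => or_introl Ay)).
  + by apply: generated_id; right.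
- exact/rootP.
Qed.

(** Independence of a list over A, one element after the other. Keeping A variable lets Steinitz's
    lemma move generators into A one at a time instead of exchanging list entries. *)
Fixpoint free A (c : seq L) : Prop :=
  if c is x :: c' then ~ acl A x /\ free (adjoin1 A x) c' else True.

Definition adjoin_seq A (s : seq L) x := A x \/ x \in s.

Lemma free_sub A B c : (forall x, B x -> acl A x) -> free A c -> free B c.
Proof.
elim: c A B => // x c IHc A B sub [Nx Fc]; split; first by move/(acl_sub sub).
apply: IHc Fc => y [By|->]; last by apply: acl_id; right.
by apply: acl_mono (sub _ By) => z; left.
Qed.

Lemma free_drop A b c : free A c -> free (adjoin1 A b) c \/
  exists c', [/\ size c = (size c').+1, {subset c' <= c} & free (adjoin1 A b) c'].
Proof.
elim: c A => [|x c IHc] A; first by left.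
move=> [Nx Fc]; have [Ax|Nx'] := classic (acl (adjoin1 A b) x).
  right; exists c; split=> // [y yc|]; first by rewrite inE yc orbT.
  apply: free_sub Fc => y [Ay|->]; first by apply: acl_id; left.
  exact: acl_exchange.
have swap y : adjoin1 (adjoin1 A b) x y -> adjoin1 (adjoin1 A x) b y.
  by move=> [[]|]; [left; left | right | left; right].
have [F|[c' [sc sub F]]] := IHc _ Fc.
  left; split=> //; apply: free_sub F => y /swap; exact: acl_id.
right; exists (x :: c'); split; rewrite /= ?sc //.
  by move=> y; rewrite !inE => /predU1P[->|/sub->]; rewrite ?eqxx ?orbT.
by split=> //; apply: free_sub F => y /swap; apply: acl_id.
Qed.

Lemma steinitz A (b c : seq L) : free A c ->
  (forall x, x \in c -> acl (adjoin_seq A b) x) -> (size c <= size b)%N.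
Proof.
elim: b A c => [|b0 b IHb] A c Fc cb.
  case: c Fc cb => // x c [Nx _] cb; case: Nx.
  by apply: acl_mono (cb x (mem_head _ _)) => y [].
have cb' x : x \in c -> acl (adjoin_seq (adjoin1 A b0) b) x.
  move=> /cb; apply: acl_mono => y [Ay|]; first by left; left.
  by rewrite inE => /predU1P[->|yb]; [left; right | right].
have [F|[c' [-> sub F]]] := free_drop b0 Fc.
  by apply: leqW; apply: IHb F cb'.
by rewrite ltnS; apply: IHb F _ => x /sub; apply: cb'.
Qed.

Lemma free_rcons A c x : free A (rcons c x) <-> free A c /\ ~ acl (adjoin_seq A c) x.
Proof.
elim: c A => [|y c IHc] A /=.
  split=> [[N _]|[_ N]].
    by split=> // /acl_mono H; apply: N; apply: H => z [].
  by split=> // /acl_mono H; apply: N; apply: H => z; left.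
have E : acl (adjoin_seq (adjoin1 A y) c) x <-> acl (adjoin_seq A (y :: c)) x.
  split; apply: acl_mono => z.
    by move=> [[]|]; [left | move=> ->; right; rewrite mem_head | move=> zc; right; rewrite inE zc orbT].
  by move=> [Az|]; [left; left | rewrite inE => /predU1P[->|]; [left; right | right]].
split=> [[Ny /IHc[Fc Nx]]|[[Ny Fc] Nx]].
  by split=> // /E.
by split=> //; apply/IHc; split=> // /E.
Qed.

Lemma mmap_generated A k (s : 'I_k -> L) p :
  (forall i, generated A (s i)) -> generated A (mmap iota s p).
Proof.
move=> gs; have gA := generated_subfield A.
rewrite /mmap; apply: (subfield_sum gA) => u _; apply: (subfieldM gA).
  exact: generatedK.
apply: big_ind => [|x y|i _]; first by case: gA.
  exact: (subfieldM gA).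
exact: (subfieldX gA).
Qed.

Definition family k (s : 'I_k -> L) x := exists i, x = s i.

Lemma adjoin_subfield k (s : 'I_k -> L) : subfield (adjoin iota s).
Proof.
split=> [|_ _ [N [D [D0 ->]]] [N' [D' [D'0 ->]]]|_ _ [N [D [D0 ->]]] [N' [D' [D'0 ->]]]].
+ by exists 1, 1; rewrite rmorph1 oner_neq0 divr1.
+ exists (N * D' - N' * D), (D * D').
  rewrite rmorphB !rmorphM /= mulf_neq0 //; split=> //.
  by field; rewrite D0 D'0.
have [Nz|Nz] := eqVneq (mmap iota s N') 0.
  by exists 0, 1; rewrite Nz mul0r invr0 mulr0 rmorph0 rmorph1 oner_neq0 mul0r.
exists (N * D'), (D * N'); rewrite !rmorphM /= mulf_neq0 //; split=> //.
by field; rewrite D0 D'0 Nz.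
Qed.

Lemma adjoin_generated k (s : 'I_k -> L) x : adjoin iota s x <-> generated (family s) x.
Proof.
split=> [[N [D [_ ->]]]|gx].
  by apply: (subfieldM (generated_subfield _)); [|apply: (subfieldV (generated_subfield _))];
    apply: mmap_generated => i; apply: generated_id; exists i.
apply: (gx (adjoin iota s)); first exact: adjoin_subfield.
  by move=> c; exists c%:MP, 1; rewrite rmorph1 oner_neq0 divr1 mmapC.
by move=> _ [i ->]; exists 'X_i, 1; rewrite rmorph1 oner_neq0 divr1 mmapX mmap1U.
Qed.

Lemma algebraic_adjoin k (s : 'I_k -> L) x :
  algebraic_over (adjoin iota s) x <-> acl (family s) x.
Proof. by split; apply: algebraic_over_mono => y /adjoin_generated. Qed.

Local Notation widen := (widen_ord (leqnSn _)).

Lemma mmap_muni k (b : 'I_k.+1 -> L) p :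
  mmap iota b p = (map_poly (mmap iota (b \o widen)) (muni p)).[b ord_max].
Proof.
pose f : {rmorphism {mpoly K[k.+1]} -> L} :=
  horner_eval (b ord_max) \o map_poly (mmap iota (b \o widen)) \o @muni k K.
apply: (@mpoly_rmorph_ext _ _ _ (mmap iota b) f) => [c|i] /=.
  by rewrite mmapC muniC map_polyC /= horner_evalE hornerC mmapC.
rewrite mmapX mmap1U; have [->|[j ->]] := ord_max_or_widen i.
  by rewrite muni_max map_polyX horner_evalE hornerX.
by rewrite muni_widen map_polyC /= horner_evalE hornerC mmapX mmap1U.
Qed.

(** This translates independence, defined by polynomials, into the closure [acl], one element at a
    time: a polynomial in k + 1 variables is read as a polynomial in the last one, with coefficients
    that are polynomials in the others. *)
Lemma algebraically_independentS k (b : 'I_k.+1 -> L) :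
  algebraically_independent iota b <->
  algebraically_independent iota (b \o widen) /\ ~ acl (family (b \o widen)) (b ord_max).
Proof.
split=> [bi|[bi Nb] p].
  split=> [p p0|].
    have /bi/eqP : mmap iota b (mwiden p) = 0.
      by rewrite mmap_muni muni_mwiden map_polyC /= hornerC.
    by rewrite -(mwiden0 k K) (inj_eq (@inj_mwiden _ _)) => /eqP.
  move=> /algebraic_adjoin[f [f0 Ef fa]].
  have [|d [g [d0 Eg]]] := @clear_denominators L {mpoly K[k]} (mmap iota (b \o widen)) f.
    by move=> i; have [N [D [D0 E]]] := Ef i; exists N, D.
  have /bi : mmap iota b (muni_inv g) = 0.
    by rewrite mmap_muni muni_invK /= Eg hornerZ (rootP fa) mulr0.
  move/(congr1 (@muni k K)); rewrite muni_invK muni0 => g0.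
  move/eqP: Eg; rewrite g0 map_poly0 eq_sym -mul_polyC mulf_eq0 polyC_eq0.
  by rewrite (negbTE d0) (negbTE f0).
rewrite mmap_muni => E; apply: (can_inj (@muniK k K)); rewrite rmorph0.
apply/polyP => i; rewrite coef0; apply: bi; apply/eqP/negPn/negP => Ni; apply: Nb.
apply/algebraic_adjoin; exists (map_poly (mmap iota (b \o widen)) (muni p)).
split; last exact/rootP.
  by apply: contra_neq Ni => /polyP/(_ i); rewrite coef_map coef0.
by move=> j; rewrite coef_map; exists (muni p)`_j, 1; rewrite rmorph1 oner_neq0 divr1.
Qed.

Lemma algebraically_independent0 (b : 'I_0 -> L) : algebraically_independent iota b.
Proof.
move=> p; rewrite -[p]mpolyKC mmapC => /eqP; rewrite fmorph_eq0 => /eqP->.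
exact: mpolyC0.
Qed.

Lemma algebraically_independent_free k (b : 'I_k -> L) :
  algebraically_independent iota b -> free (fun=> False) [seq b i | i <- enum 'I_k].
Proof.
elim: k b => [|k IHk] b; first by rewrite enum_ord0.
move=> /algebraically_independentS[/IHk Fb Nb].
rewrite enum_ordSr map_rcons -map_comp; apply/free_rcons; split=> //.
apply: contra_not Nb; apply: acl_mono => x [//|/mapP[i _ ->]].
by exists i.
Qed.

Lemma transcendence_basis_max E k (b : 'I_k -> L) l (c : 'I_l -> L) :
    transcendence_basis iota E b -> algebraically_independent iota c ->
    (forall i, E (c i)) -> (l <= k)%N.
Proof.
case=> Eb bi Ealg ci Ec.
have := @steinitz (fun=> False) [seq b i | i <- enum 'I_k] [seq c i | i <- enum 'I_l].
rewrite !size_map -!enumT !size_enum_ord; apply; first exact: algebraically_independent_free.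
move=> _ /mapP[i _ ->]; have /algebraic_adjoin := Ealg _ (Ec i).
by apply: acl_mono => _ [j ->]; right; apply: map_f; rewrite mem_enum.
Qed.

(** The cardinality picked by [trdeg] is unspecified among those of the bases; comparing two bases
    in both directions shows that there is only one. *)
Lemma trdeg_basis E k (b : 'I_k -> L) : transcendence_basis iota E b -> trdeg iota E = k.
Proof.
move=> bE; rewrite /trdeg.
have [c cE] := epsilon_spec (inhabits 0%N)
  (fun k => exists b : 'I_k -> L, transcendence_basis iota E b) (ex_intro _ k (ex_intro _ b bE)).
move: (epsilon _ _) c cE => l c cE.
have [Eb bi _] := bE; have [Ec ci _] := cE.
by apply/eqP; rewrite eqn_leq (transcendence_basis_max bE ci Ec) (transcendence_basis_max cE bi Eb).
Qed.

(** The basis is taken among the generators. One that lies outside the closure of those already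
    chosen can be appended, and Steinitz's lemma bounds the number of independent generators by
    m. *)
Lemma extend_to_basis m (F : 'I_m -> L) l (tau : 'I_l -> 'I_m) :
    algebraically_independent iota (F \o tau) ->
  exists k (sigma : 'I_k -> 'I_m), transcendence_basis iota (adjoin iota F) (F \o sigma).
Proof.
have bound k (s : 'I_k -> 'I_m) : algebraically_independent iota (F \o s) -> (k <= m)%N.
  move=> si; have := @steinitz (fun=> False) [seq F i | i <- enum 'I_m] [seq (F \o s) i | i <- enum 'I_k].
  rewrite !size_map -!enumT !size_enum_ord; apply; first exact: algebraically_independent_free.
  by move=> _ /mapP[i _ ->]; apply: acl_id; right; apply: map_f; rewrite mem_enum.
have [j] := ubnP (m - l)%N; elim: j l tau => // j IHj l tau lej ti.
have [H|N] := classic (forall i, acl (family (F \o tau)) (F i)).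
  exists l, tau; split=> // [i|a /adjoin_generated ga].
    by apply/adjoin_generated; apply: generated_id; exists (tau i).
  apply/algebraic_adjoin; apply: (acl_sub _ (generated_acl ga)) => _ [i ->].
  exact: H.
have [i Ni] : exists i, ~ acl (family (F \o tau)) (F i).
  by apply: NNPP => N'; apply: N => i; apply: NNPP => Ni; apply: N'; exists i.
pose s (u : 'I_l.+1) := if unlift ord_max u is Some v then tau v else i.
have Es : F \o s \o widen =1 F \o tau.
  move=> v /=; rewrite /s (_ : widen v = lift ord_max v) ?liftK //.
  by apply: val_inj; rewrite /= /bump leqNgt ltn_ord.
have Em : s ord_max = i by rewrite /s unlift_none.
have si : algebraically_independent iota (F \o s).
  apply/algebraically_independentS; split=> [p|].
    rewrite /mmap (eq_bigr (fun m => iota p@_m * mmap1 (F \o tau) m)); first exact: ti.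
    by move=> u _; rewrite (mmap1_eq _ Es).
  rewrite /= Em; apply: contra_not Ni; apply: acl_mono => _ [v ->].
  by exists v; rewrite -Es.
have ltm := bound _ _ si.
by apply: IHj si; rewrite subnS prednK ?subn_gt0.
Qed.

(** Everything later uses the transcendence degree in this form only: the largest number of
    independent generators, attained by a choice [sigma] of indices. *)
Lemma trdeg_adjoin m (F : 'I_m -> L) :
  (exists sigma : 'I_(trdeg iota (adjoin iota F)) -> 'I_m,
     algebraically_independent iota (F \o sigma)) /\
  (forall l (tau : 'I_l -> 'I_m), algebraically_independent iota (F \o tau) ->
     (l <= trdeg iota (adjoin iota F))%N).
Proof.
have e0 : 'I_0 -> 'I_m by case.
have [k [s sb]] := extend_to_basis (@algebraically_independent0 (F \o e0)).
rewrite (trdeg_basis sb); split; first by exists s; case: sb.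
move=> l tau ti; apply: (transcendence_basis_max sb ti) => i.
by apply/adjoin_generated; apply: generated_id; exists (tau i).
Qed.

End Closure.

(** * Lueroth's theorem *)

Section SimpleExtension.
Variables (K L : fieldType) (iota : {rmorphism K -> L}) (u : L).

Definition simple_ext := adjoin iota (fun _ : 'I_1 => u).

Lemma simple_ext_subfield : subfield simple_ext.
Proof. exact: adjoin_subfield. Qed.

Lemma simple_extK c : simple_ext (iota c).
Proof. by apply/adjoin_generated; apply: generatedK. Qed.

Lemma simple_ext_gen : simple_ext u.
Proof. by apply/adjoin_generated; apply: generated_id; exists ord0. Qed.

Lemma simple_ext_min (E : L -> Prop) x :
  subfield E -> (forall c, E (iota c)) -> E u -> simple_ext x -> E x.
Proof. by move=> HE EK Eu /adjoin_generated; apply=> // _ [_ ->]. Qed.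

Lemma simple_extP x : simple_ext x <-> exists N D : {poly K},
  (map_poly iota D).[u] != 0 /\ x = (map_poly iota N).[u] / (map_poly iota D).[u].
Proof.
split=> [[N [D [D0 ->]]]|[N [D [_ ->]]]].
  pose f := mmap (@polyC K) (fun _ : 'I_1 => 'X).
  have E p : mmap iota (fun _ => u) p = (map_poly iota (f p)).[u].
    pose ev : {rmorphism {mpoly K[1]} -> L} := horner_eval u \o map_poly iota \o f.
    apply: (@mpoly_rmorph_ext _ _ _ (mmap iota (fun _ => u)) ev) => [c|i] /=.
      by rewrite /f !mmapC map_polyC /= horner_evalE hornerC.
    by rewrite /f !mmapX !mmap1U map_polyX horner_evalE hornerX.
  by exists (f N), (f D); rewrite -!E.
have H p : simple_ext (map_poly iota p).[u].
  apply: (subfield_horner simple_ext_subfield) => [i|]; last exact: simple_ext_gen.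
  by rewrite coef_map; apply: simple_extK.
by apply: (subfieldM simple_ext_subfield) => //; apply: (subfieldV simple_ext_subfield).
Qed.

End SimpleExtension.

Lemma modp_subfield (L : fieldType) (E : L -> Prop) (f g : {poly L}) :
  subfield E -> (forall i, E f`_i) -> (forall i, E g`_i) -> forall i, E (f %% g)`_i.
Proof.
move=> HE Ef Eg i; have [f' <-] := subfield_poly_lift HE Ef.
have [g' <-] := subfield_poly_lift HE Eg.
have -> : map_poly val f' %% map_poly val g' = map_poly val (f' %% g').
  by rewrite (map_modp (val : subfield_type HE -> L)).
by rewrite coef_map; apply: subfield_valP.
Qed.

Section Luroth.
Variables (K L : fieldType) (j : {rmorphism {poly K} -> L}).
Hypothesis j_inj : injective j.
Hypothesis j_frac : forall z, exists a b, b != 0 /\ z = j a / j b.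

Definition poly_base : {rmorphism K -> L} := j \o @polyC K.

Lemma map_j_inj : injective (map_poly j).
Proof. exact: map_inj_poly j_inj (rmorph0 j). Qed.

Lemma map_jM p q : map_poly j (p * q) = map_poly j p * map_poly j q.
Proof. exact: (rmorphM (map_poly j)). Qed.

Lemma map_jZ c p : map_poly j (c *: p) = j c *: map_poly j p.
Proof. exact: (map_polyZ j). Qed.

Lemma horner_jX p : (map_poly poly_base p).[j 'X] = j p.
Proof.
rewrite horner_coef size_map_poly [in RHS](poly_wide (leqnn (size p))) rmorph_sum.
by apply: eq_bigr => i _; rewrite coef_map /= -mul_polyC rmorphM /= rmorphXn.
Qed.

Variables (E : L -> Prop) (HE : subfield E) (EK : forall c, E (poly_base c)).
Local Notation F := (subfield_type HE).
Local Notation s := (j 'X).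

Lemma map_valM (p q : {poly F}) : map_poly val (p * q) = map_poly val p * map_poly val q.
Proof. exact: (rmorphM (map_poly (val : F -> L))). Qed.

Definition constF : K -> F := fun c => subfield_elt HE (EK c).

Lemma constF_is_zmod : zmod_morphism constF.
Proof. by move=> x y; apply: val_inj; apply: (rmorphB poly_base). Qed.

Lemma constF_is_monoid : monoid_morphism constF.
Proof.
split=> [|x y]; apply: val_inj; first exact: (rmorph1 poly_base).
exact: (rmorphM poly_base).
Qed.

HB.instance Definition _ := GRing.isZmodMorphism.Build K F constF constF_is_zmod.
HB.instance Definition _ := GRing.isMonoidMorphism.Build K F constF constF_is_monoid.

Lemma map_constF p : map_poly val (map_poly constF p) = map_poly poly_base p.
Proof. by rewrite -map_poly_comp; apply: eq_map_poly. Qed.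

Lemma cross_neq0 (a b : {poly K}) u : b != 0 -> u = j a / j b  ->
  (forall c, u <> poly_base c) -> exists k l, a`_k * b`_l - a`_l * b`_k != 0.
Proof.
move=> b0 Eu Nu; apply: NNPP => N.
have H k l : a`_k * b`_l = a`_l * b`_k.
  by apply/eqP; rewrite -subr_eq0; apply/negPn/negP => H; apply: N; exists k, l.
have [l bl0] : exists l, b`_l != 0 by exists (size b).-1; rewrite -lead_coefE lead_coef_eq0.
apply: (Nu (a`_l / b`_l)).
have Ea : a = (a`_l / b`_l)%:P * b.
  apply/polyP => k; rewrite coefCM; apply: (mulIf bl0); rewrite H.
  by field.
by rewrite Eu {1}Ea rmorphM mulfK // (fraction_eq0 j_inj).
Qed.

(* a(Z) b(s) - a(s) b(Z), as a polynomial in Z over K[s] *)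
Definition bezoutian (a b : {poly K}) : {poly {poly K}} :=
  map_poly polyC a * b%:P - a%:P * map_poly polyC b.

Lemma coef_bezoutian a b k : (bezoutian a b)`_k = a`_k *: b - b`_k *: a.
Proof. by rewrite coefB coefMC coefCM !coef_map /= !mul_polyC mulrC mul_polyC. Qed.

Lemma swap_bezoutian a b : swapXY (bezoutian a b) = - bezoutian a b.
Proof.
apply/polyP => i; apply/polyP => k; rewrite coef_swapXY !coefN !coef_bezoutian.
by rewrite !coefB !coefZ opprB mulrC [X in _ - X]mulrC.
Qed.

Lemma sizeY_bezoutian a b :
  (size (swapXY (bezoutian a b)) <= maxn (size a) (size b))%N.
Proof.
rewrite -sizeYE; apply/bigmax_leqP => i _; rewrite coef_bezoutian.
apply: leq_trans (size_polyD _ _) _; rewrite size_polyN geq_max; apply/andP; split.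
  by apply: leq_trans (size_scale_leq _ _) _; rewrite leq_max leqnn orbT.
by apply: leq_trans (size_scale_leq _ _) _; rewrite leq_max leqnn.
Qed.

(** By Cramer's rule with a nonzero minor c = a_k b_l - a_l b_k, both c a and c b are combinations
    of coefficients of the Bezoutian, so a common divisor of these divides a and b. *)
Lemma divides_bezoutian_unit a b q u : b != 0 -> coprime_elts a b ->
    u = j a / j b  -> (forall c, u <> poly_base c) ->
  (forall k, divides q (bezoutian a b)`_k) -> q \is a GRing.unit.
Proof.
move=> b0 cop Eu Nu dq; have [k [l kl0]] := cross_neq0 b0 Eu Nu.
set c := _ - _ in kl0.
have cU : c%:P \is a GRing.unit by rewrite poly_unitE size_polyC coefC eqxx unitfE kl0.
have aux (x : {poly K}) : divides q (c *: x) -> divides q x.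
  move=> [e Ee]; exists (c^-1 *: e).
  by rewrite -scalerAl -Ee scalerA mulVf // scale1r.
apply: cop; apply: aux.
  have -> : c *: a = a`_l *: (bezoutian a b)`_k - a`_k *: (bezoutian a b)`_l.
    rewrite !coef_bezoutian /c -!mul_polyC polyCB !polyCM; ring.
  by apply: divides_sub; rewrite -mul_polyC; apply: divides_mull.
have -> : c *: b = b`_l *: (bezoutian a b)`_k - b`_k *: (bezoutian a b)`_l.
  rewrite !coef_bezoutian /c -!mul_polyC polyCB !polyCM; ring.
by apply: divides_sub; rewrite -mul_polyC; apply: divides_mull.
Qed.

Lemma bezoutian_neq0 a b u : b != 0 -> u = j a / j b  ->
  (forall c, u <> poly_base c) -> bezoutian a b != 0.
Proof.
move=> b0 Eu Nu; have [k [l]] := cross_neq0 b0 Eu Nu; apply: contra_neq => P0.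
have := coef_bezoutian a b k; rewrite P0 coef0 => /polyP/(_ l).
rewrite coef0 coefB !coefZ => E0; rewrite [RHS]E0; ring.
Qed.

(** For u = a(s) / b(s), this polynomial a(Z) - u b(Z) over E vanishes at s and is, up to the factor
    b(s), the Bezoutian of a and b. *)
Definition pencil (a b : {poly K}) (u : F) : {poly F} := map_poly constF a - u *: map_poly constF b.

Lemma val_pencil a b u : map_poly val (pencil a b u) =
  map_poly poly_base a - val u *: map_poly poly_base b.
Proof.
rewrite /pencil (rmorphB (map_poly (val : F -> L))) -!map_constF; congr (_ - _).
exact: (map_polyZ (val : F -> L)).
Qed.

Lemma map_pencil a b u : j b != 0  -> val u = j a / j b ->
  map_poly j (bezoutian a b) = j b *: map_poly val (pencil a b u).
Proof.
move=> b0 Eu; rewrite val_pencil; apply/polyP => k.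
have Ec c : (map_poly poly_base c)`_k = j (c`_k)%:P by rewrite coef_map.
have -> : (map_poly j (bezoutian a b))`_k =
    j ((a`_k)%:P * b - (b`_k)%:P * a).
  by rewrite coef_map coef_bezoutian !mul_polyC.
rewrite coefZ coefB coefZ !Ec rmorphB !rmorphM Eu mulrBr (mulrC (j b)).
by rewrite mulrA (mulrCA (j b)) mulfV // mulr1 (mulrC (j a)).
Qed.

Lemma root_pencil a b u : j b != 0  -> val u = j a / j b ->
  (map_poly val (pencil a b u)).[s] = 0.
Proof.
move=> b0 Eu; rewrite val_pencil hornerD hornerN hornerZ !horner_jX Eu.
by rewrite divfK ?subrr.
Qed.

(** The minimal polynomial of s over E. The pencil of a nonconstant element of E is a first
    polynomial vanishing at s, and taking remainders lowers the degree until all others are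
    divisible. *)
Lemma annihilator : (exists2 e, E e & forall c, e <> poly_base c) ->
  exists f : {poly F}, [/\ f != 0, lead_coef f = 1, (map_poly val f).[s] = 0
   & forall g : {poly F}, (map_poly val g).[s] = 0 -> f %| g].
Proof.
case=> e Ee Ne; have [a [b [b0 Ede]]] := j_frac e.
have fb0 : j b != 0  by rewrite (fraction_eq0 j_inj).
pose u := subfield_elt HE Ee; have Eu : val u = j a / j b by [].
have f0 : pencil a b u != 0.
  apply: contra_neq (bezoutian_neq0 b0 Eu Ne) => E0.
  have := map_pencil fb0 Eu; rewrite E0 map_poly0 scaler0 -(map_poly0 j); exact: map_j_inj.
have := root_pencil fb0 Eu; have [k] := ubnP (size (pencil a b u)).
elim: k (pencil a b u) f0 => // k IHk f f0 lek fs.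
have [H|N] := classic (forall g : {poly F}, (map_poly val g).[s] = 0 -> f %| g).
  have l0 : lead_coef f != 0 by rewrite lead_coef_eq0.
  exists ((lead_coef f)^-1 *: f); split.
  - by rewrite -mul_polyC mulf_neq0 // polyC_eq0 invr_eq0.
  - by rewrite lead_coefZ mulVf.
  - by rewrite map_polyZ hornerZ fs mulr0.
  - by move=> g /H; rewrite dvdpZl ?invr_eq0.
have [g [gs Ng]] : exists g : {poly F}, (map_poly val g).[s] = 0 /\ ~~ (f %| g).
  by apply: NNPP => N'; apply: N => g gs; apply/negPn/negP => Ng; apply: N'; exists g.
apply: (IHk (g %% f)) => //; first by apply: leq_trans (ltn_modpN0 _ f0) lek.
have := gs; rewrite {1}(divp_eq g f) rmorphD rmorphM hornerD hornerM fs mulr0 add0r.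
exact: id.
Qed.

(** If all coefficients were in K, then s would be algebraic over K. *)
Lemma annihilator_nonconstant (f : {poly F}) : f != 0 -> (map_poly val f).[s] = 0 ->
  exists i, forall c, val f`_i <> poly_base c.
Proof.
move=> f0 fs; apply: NNPP => N.
have [|d [g [d0 Eg]]] := @clear_denominators L K poly_base (map_poly val f).
  move=> i; have [c Ec] : exists c, val f`_i = poly_base c.
    by apply: NNPP => N'; apply: N; exists i => c Ec; apply: N'; exists c.
  by exists c, 1; rewrite rmorph1 oner_neq0 divr1 coef_map.
have : j g = 0 by rewrite -horner_jX Eg hornerZ fs mulr0.
move/eqP; rewrite (fraction_eq0 j_inj) => /eqP g0; case/eqP: f0.
apply/polyP => i; apply: val_inj; rewrite coef0 -[RHS]/0.
have /polyP/(_ i) := Eg; rewrite g0 map_poly0 coef0 coefZ coef_map => /esym/eqP.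
by rewrite mulf_eq0 (negbTE d0) => /eqP.
Qed.

Lemma primitive_multiple (f : {poly F}) : f != 0 -> exists (g : {poly {poly K}}) (delta : L),
  [/\ content_free g, delta != 0 & map_poly j g = delta *: map_poly val f].
Proof.
move=> f0.
have [|d [g0 [d0 Eg0]]] := @clear_denominators L {poly K} j (map_poly val f).
  move=> i; have [a [b [b0 ->]]] := j_frac (map_poly val f)`_i.
  by exists a, b; rewrite (fraction_eq0 j_inj).
have facK := factorial_poly (factorial_field (K := K)).
have g00 : g0 != 0.
  apply: contra_neq f0 => g00; apply/polyP => i; apply: val_inj; rewrite coef0 -[RHS]/0.
  have /polyP/(_ i) := Eg0; rewrite g00 map_poly0 coef0 coefZ coef_map => /esym/eqP.
  by rewrite mulf_eq0 (negbTE d0) => /eqP.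
have [c [g [c0 Eg gP]]] := content_split facK g00.
have fc0 : j c != 0 by rewrite (fraction_eq0 j_inj).
exists g, ((j c)^-1 * j d); split; first exact: gP.
  by rewrite mulf_neq0 // invr_eq0.
have Ec : map_poly j g0 = j c *: map_poly j g.
  by rewrite Eg map_jZ.
by rewrite -scalerA -Eg0 Ec scalerA mulVf // scale1r.
Qed.

Lemma size_le_mull (a w : {poly K}) : w * a != 0 -> (size a <= size (w * a)%R)%N.
Proof.
move=> wa0; have [w0 a0] : w != 0 /\ a != 0 by apply/andP; rewrite -negb_or -mulf_eq0.
by rewrite size_mul // -(prednK (_ : (0 < size w)%N)) ?size_poly_gt0 // addSn leq_addl.
Qed.

(** The core of Lueroth's theorem: the minimal polynomial f of s over E is proportional to the
    pencil of any of its nonconstant coefficients u = a / b. A content-free multiple g of f in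
    K[s][Z] divides the Bezoutian of a and b by Gauss's lemma, and comparing degrees in s leaves
    only a constant cofactor. *)
Lemma annihilator_bezoutian (f : {poly F}) (u : F) i (a b : {poly K}) :
    lead_coef f = 1 -> (map_poly val f).[s] = 0 ->
    (forall g : {poly F}, (map_poly val g).[s] = 0 -> f %| g) ->
    u = f`_i -> (forall c, val u <> poly_base c) ->
    coprime_elts a b -> b != 0 -> val u = j a / j b ->
  exists2 kappa, kappa != 0 &
    map_poly poly_base a - val u *: map_poly poly_base b = kappa *: map_poly val f.
Proof.
move=> f1 fs fdiv Eu Nu cop b0 Euab.
have f0 : f != 0 by rewrite -lead_coef_eq0 f1 oner_neq0.
have facK := factorial_poly (factorial_field (K := K)).
have [g [delta [gP d0 Eg]]] := primitive_multiple f0.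
have fb0 : j b != 0 by rewrite (fraction_eq0 j_inj).
have Eg0 k : j g`_k = delta * val f`_k.
  have /polyP/(_ k) := Eg; rewrite coefZ coef_map => ->.
  by rewrite (coef_map (val : F -> L)).
have EgD : j g`_(size f).-1 = delta.
  by rewrite Eg0 -lead_coefE f1 mulr1.
have gD0 : g`_(size f).-1 != 0 by rewrite -(fraction_eq0 j_inj) EgD.
have g0 : g != 0 by apply: contra_neq gD0 => ->; rewrite coef0.
have Egi : g`_i * b = a * g`_(size f).-1.
  apply/eqP; rewrite -(inj_eq j_inj); apply/eqP; rewrite !rmorphM EgD Eg0 -Eu Euab.
  by rewrite -mulrA divfK // mulrC.
have [w Ew] : divides b g`_(size f).-1.
  by apply: (gauss facK b0 cop); exists g`_i.
have Ewi : g`_i = w * a.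
  by apply: (mulIf b0); rewrite Egi Ew mulrCA mulrA.
have w0 : w != 0 by apply: contra_neq gD0 => w0; rewrite Ew w0 mul0r.
have a0 : a != 0.
  apply: contra_not_neq (Nu 0) => a0; first by rewrite Euab a0 (rmorph0 j) mul0r rmorph0.
(* The coefficients of g at [i] and at the top have the ratio a / b, hence are w a and w b. So the
   degree of g in s is at least max(deg a, deg b), which bounds the degree of the Bezoutian in s. *)
have le_size : (maxn (size a) (size b) <= size (swapXY g))%N.
  rewrite -sizeYE geq_max; apply/andP; split.
    apply: leq_trans (max_size_coefXY g i); rewrite Ewi; apply: size_le_mull.
    by rewrite mulf_neq0.
  apply: leq_trans (max_size_coefXY g (size f).-1); rewrite Ew; apply: size_le_mull.
  by rewrite mulf_neq0.
have P0 := bezoutian_neq0 b0 Euab Nu.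
have [e Ee] : divides g (bezoutian a b).
  have [q Eq] := dvdpP _ _ (fdiv _ (root_pencil fb0 Euab)).
  have [|d [Q [d0' EQ]]] := @clear_denominators L {poly K} j
    ((j b / delta) *: map_poly val q).
    move=> k; have [x [y [y0 ->]]] := j_frac ((j b / delta) *: map_poly val q)`_k.
    by exists x, y; rewrite (fraction_eq0 j_inj).
  apply: (content_free_divides facK gP (c := d)); first by rewrite -(fraction_eq0 j_inj).
  exists Q; apply: map_j_inj; rewrite map_jM map_jZ EQ Eg.
  rewrite (map_pencil fb0 Euab) Eq map_valM.
  rewrite -!scalerAl -scalerAr !scalerA; congr (_ *: _).
  by rewrite -!mulrA mulVf // mulr1.
have e0 : e != 0 by apply: contra_neq P0 => e0; rewrite Ee e0 mul0r.
(* Degrees in s are read off after exchanging the variables, under which the Bezoutian only changes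
   sign. The cofactor is then free of s; as a polynomial q in Z alone it divides all coefficients of
   the Bezoutian, so it is a unit. *)
have Esw : - bezoutian a b = swapXY e * swapXY g.
  by rewrite -swap_bezoutian Ee; apply: (rmorphM swapXY).
have se : (size (swapXY e) <= 1)%N.
  have := leq_trans (sizeY_bezoutian a b) le_size.
  rewrite swap_bezoutian Esw size_mul ?swapXY_eq0 //.
  rewrite -(prednK (_ : (0 < size (swapXY g))%N)) ?size_poly_gt0 ?swapXY_eq0 //.
  by rewrite addnS /= -[X in (_ <= X)%N]add1n leq_add2r.
have [q Eq] : exists q, swapXY e = q%:P by exists (swapXY e)`_0; apply: size1_polyC.
have qU : q \is a GRing.unit.
  apply: (divides_bezoutian_unit b0 cop Euab Nu) => k.
  exists (- (swapXY g)`_k); have /polyP/(_ k) := Esw; rewrite coefN Eq coefCM => E1.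
  by rewrite -[LHS]opprK E1 mulNr mulrC.
have [c c0 Eqc] : exists2 c, c != 0 & q = c%:P.
  by move: qU; rewrite poly_unitE => /andP[/size_poly1P[c c0 ->] _]; exists c.
have EP : bezoutian a b = c%:P *: g.
  rewrite Ee -[e]swapXYK Eq Eqc swapXY_polyC map_polyC /=.
  by rewrite mul_polyC.
exists ((j b)^-1 * (j c%:P * delta)).
  by rewrite !mulf_neq0 ?invr_eq0 // (fraction_eq0 j_inj) polyC_eq0.
rewrite -!scalerA -Eg -map_jZ -EP (map_pencil fb0 Euab) scalerA mulVf // scale1r.
by rewrite val_pencil.
Qed.

(** Instead of comparing degrees of field extensions, v = x(s) / y(s) in E is computed inside K(u).
    The polynomial x(Z) - v y(Z) vanishes at s, hence is divisible by the pencil M of u. So x and y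
    modulo M, whose coefficients lie in K(u), differ by the factor v, and v is a quotient of two
    such coefficients. *)
Theorem luroth : (exists2 e, E e & forall c, e <> poly_base c) ->
  exists u, E u /\ forall v, E v -> simple_ext poly_base u v.
Proof.
move=> /annihilator[f [f0 f1 fs fdiv]].
have [i Nu] := annihilator_nonconstant f0 fs.
have facK := factorial_poly (factorial_field (K := K)).
have [a [b [cop b0 Eu]]] := coprime_fraction j_inj j_frac facK (val f`_i).
have [kappa k0 EM] := annihilator_bezoutian f1 fs fdiv erefl Nu cop b0 Eu.
exists (val f`_i); split; first exact: subfield_valP.
move=> v Ev; set M := _ - _ in EM.
have [x [y [y0 Exy]]] := j_frac v.
have fy0 : j y != 0 by rewrite (fraction_eq0 j_inj).
have Evv : val (subfield_elt HE Ev) = j x / j y by [].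
have dM : M %| map_poly poly_base x - v *: map_poly poly_base y.
  have /fdiv/dvdpP[q Eq] := root_pencil fy0 Evv.
  rewrite EM dvdpZl //; apply/dvdpP; exists (map_poly val q).
  by rewrite -map_valM -Eq val_pencil.
have Emod : map_poly poly_base x %% M = v *: (map_poly poly_base y %% M).
  by apply/eqP; rewrite -subr_eq0 -modpZl -modpN -modpD; apply/eqP/modp_eq0P.
have Ms : M.[s] = 0 by rewrite EM hornerZ fs mulr0.
have [k yk0] : exists k, (map_poly poly_base y %% M)`_k != 0.
  apply: NNPP => N; case/eqP: fy0; rewrite -horner_jX.
  rewrite (divp_eq (map_poly poly_base y) M).
  have -> : map_poly poly_base y %% M = 0.
    by apply/polyP => k; rewrite coef0; apply/eqP/negPn/negP => Nk; apply: N; exists k.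
  by rewrite addr0 hornerM Ms mulr0.
have HS := simple_ext_subfield poly_base (val f`_i).
have SC p l : simple_ext poly_base (val f`_i) (map_poly poly_base p)`_l.
  by rewrite coef_map; apply: simple_extK.
have SM l : simple_ext poly_base (val f`_i) M`_l.
  rewrite coefB coefZ; have [_ SB _] := HS; apply: SB => //.
  by apply: (subfieldM HS) => //; apply: simple_ext_gen.
have -> : v = (map_poly poly_base x %% M)`_k / (map_poly poly_base y %% M)`_k.
  by rewrite Emod coefZ mulfK.
by apply: (subfieldM HS); [|apply: (subfieldV HS)]; apply: modp_subfield.
Qed.

End Luroth.

(** * Specialization to one variable *)

Section Specialization.
Variables (K : fieldType) (A : idomainType) (L M : fieldType).
Variables (c0 : {rmorphism K -> A}) (j : {rmorphism A -> L}) (psi : {rmorphism A -> M}).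
Hypothesis j_inj : injective j.

(* psi, extended to a place from L to M *)
Definition specializes (f : L) (F : M) :=
  exists c d, [/\ psi d != 0, f = j c / j d & F = psi c / psi d].

Lemma spec_denominator d : psi d != 0 -> j d != 0.
Proof.
apply: contra_neq => jd0; rewrite (_ : d = 0) ?rmorph0 //.
by apply: j_inj; rewrite rmorph0.
Qed.

Lemma specializes_fun f F F' : specializes f F -> specializes f F' -> F = F'.
Proof.
move=> [c [d [d0 Ef ->]]] [c' [d' [d'0 Ef' ->]]].
have /eqP := Ef; rewrite Ef' eqr_div ?spec_denominator // -!rmorphM (inj_eq j_inj) => /eqP E.
by apply/eqP; rewrite eqr_div // -!rmorphM E.
Qed.

Lemma specializes_base c : specializes (j c) (psi c).
Proof. by exists c, 1; rewrite !rmorph1 !divr1 oner_neq0. Qed.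

Lemma specializes1 : specializes 1 1.
Proof. by have := specializes_base 1; rewrite !rmorph1. Qed.

Lemma specializesB f F g G : specializes f F -> specializes g G -> specializes (f - g) (F - G).
Proof.
move=> [c [d [d0 -> ->]]] [c' [d' [d'0 -> ->]]]; exists (c * d' - c' * d), (d * d').
have jd := spec_denominator d0; have jd' := spec_denominator d'0.
rewrite !rmorphB !rmorphM mulf_neq0 //; split=> //; first by field; rewrite jd jd'.
by field; rewrite d0 d'0.
Qed.

Lemma specializesM f F g G : specializes f F -> specializes g G -> specializes (f * g) (F * G).
Proof.
move=> [c [d [d0 -> ->]]] [c' [d' [d'0 -> ->]]]; exists (c * c'), (d * d').
by rewrite !rmorphM mulf_neq0 // !invfM; split=> //; rewrite mulrACA.
Qed.

Lemma specializesV f F : specializes f F -> F != 0 -> specializes f^-1 F^-1.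
Proof.
move=> [c [d [d0 -> ->]]]; rewrite mulf_eq0 invr_eq0 negb_or => /andP[c0' _].
by exists d, c; rewrite !invf_div.
Qed.

Lemma specializes0 : specializes 0 0.
Proof. by have := specializesB specializes1 specializes1; rewrite !subrr. Qed.

Lemma specializesD f F g G : specializes f F -> specializes g G -> specializes (f + g) (F + G).
Proof.
move=> sf sg; rewrite -[g]opprK -[G]opprK -[- g]sub0r -[- G]sub0r.
by apply/(specializesB sf)/specializesB => //; apply: specializes0.
Qed.

Lemma specializesX f F k : specializes f F -> specializes (f ^+ k) (F ^+ k).
Proof.
move=> sf; elim: k => [|k IHk]; first by rewrite !expr0; apply: specializes1.
by rewrite !exprS; apply: specializesM.
Qed.

Lemma specializes_sum (I : Type) (r : seq I) (f : I -> L) (F : I -> M) :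
  (forall i, specializes (f i) (F i)) ->
  specializes (\sum_(i <- r) f i) (\sum_(i <- r) F i).
Proof.
move=> sf; elim: r => [|i r IHr]; first by rewrite !big_nil; apply: specializes0.
by rewrite !big_cons; apply: specializesD.
Qed.

Local Notation jK := (j \o c0).
Local Notation psiK := (psi \o c0).

Lemma specializes_horner (p : {poly K}) f F : specializes f F ->
  specializes (map_poly jK p).[f] (map_poly psiK p).[F].
Proof.
move=> sf; rewrite !horner_coef !size_map_poly; apply: specializes_sum => i.
rewrite !coef_map; apply: specializesM; last exact: specializesX.
exact: specializes_base.
Qed.

Definition transcendental (F : M) := ~ algebraicOver psiK F.

(** A nonzero D(f), with D a polynomial over K, specializes to D(F), which is nonzero because F is
    transcendental: the place is finite on K(f). *)
Lemma specializes_simple_ext f F e : specializes f F -> transcendental F ->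
  simple_ext jK f e -> exists G, specializes e G.
Proof.
move=> sf tF /simple_extP[N [D [D0 ->]]].
have DF0 : (map_poly psiK D).[F] != 0.
  apply: contra_not_neq tF => DF0; exists D; last exact/rootP.
  by apply: contra_neq D0 => ->; rewrite map_poly0 horner0.
exists ((map_poly psiK N).[F] / (map_poly psiK D).[F]).
apply: specializesM; first exact: specializes_horner.
by apply: specializesV => //; apply: specializes_horner.
Qed.

(* If w <> 0, then 1 is a combination of positive powers of w with coefficients in K(f), on
   which the place is finite because F is transcendental; hence w cannot specialize to 0. *)
Lemma specializes_inj f F w : specializes f F -> transcendental F ->
  algebraic_over (simple_ext jK f) w -> specializes w 0 -> w = 0.
Proof.
move=> sf tF aw sw; apply/eqP/negPn/negP => w0.
have HS := simple_ext_subfield jK f.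
have := (subfieldV (algebraic_over_subfield HS)) _ aw.
move=> /(algebraic_overP HS)/integral_algebraic[p pmon /rootP pw].
suff /(specializes_fun specializes1)/eqP : specializes 1 0 by rewrite oner_eq0.
have p0 := monic_neq0 pmon.
pose q := map_poly val p; have sq : size q = (size p).-1.+1.
  by rewrite size_map_poly prednK // size_poly_gt0.
have E1 : \sum_(i < (size p).-1) q`_i * w ^+ ((size p).-1 - i) + 1 = 0.
  have wN : w ^+ (size p).-1 != 0 by rewrite expf_neq0.
  transitivity (w ^+ (size p).-1 * q.[w^-1]); last by rewrite pw mulr0.
  rewrite horner_coef sq big_ord_recr /=.
  have -> : q`_(size p).-1 = 1.
    by rewrite coef_map -lead_coefE (monicP pmon); apply: (rmorph1 (val : subfield_type HS -> L)).
  rewrite mul1r mulrDr -exprMn mulfV // expr1n; congr (_ + _).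
  rewrite mulr_sumr. apply: eq_bigr => i _.
  have lei : (i <= (size p).-1)%N by apply: ltnW.
  have -> : w ^+ (size p).-1 = w ^+ ((size p).-1 - i) * w ^+ i by rewrite -exprD subnK.
  by rewrite exprVn [RHS]mulrCA mulfK ?expf_neq0.
have -> : 1 = 0 - \sum_(i < (size p).-1) q`_i * w ^+ ((size p).-1 - i) :> L.
  by apply/eqP; rewrite sub0r -addr_eq0 addrC E1.
rewrite -[0 : M](subrr 0); apply: specializesB; first exact: specializes0.
rewrite [X in specializes _ X](_ : 0 = \sum_(i < (size p).-1) (0 : M)); last by rewrite big1.
apply: specializes_sum => i.
have [G sG] : exists G, specializes q`_i G.
  apply: (specializes_simple_ext sf tF); rewrite coef_map.
  exact: (subfield_valP _).
rewrite -[0 : M](mulr0 G); apply: specializesM => //.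
have -> : (0 : M) = 0 ^+ ((size p).-1 - i) by rewrite expr0n subn_eq0 leqNgt ltn_ord.
exact: specializesX.
Qed.

Lemma specializes_generated m (f : 'I_m -> L) (F : 'I_m -> M) v :
    (forall i, specializes (f i) (F i)) -> generated psiK (family F) v ->
  exists2 u, generated jK (family f) u & specializes u v.
Proof.
move=> sf; have gS := generated_subfield jK (family f).
move=> gv; apply: (gv (fun v => exists2 u, generated jK (family f) u & specializes u v)).
- split=> [|x y [u gu su] [u' gu' su']|x y [u gu su] [u' gu' su']].
  + by exists 1; [case: gS | exact: specializes1].
  + by exists (u - u'); [case: gS => _ SB _; apply: SB | exact: specializesB].
  have [->|y0] := eqVneq y 0.
    by exists 0; [exact: (subfield0 gS) | rewrite invr0 mulr0; exact: specializes0].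
  exists (u / u'); first by case: gS => _ _ SD; apply: SD.
  by apply: specializesM => //; apply: specializesV.
- by move=> c; exists (jK c); [exact: generatedK | exact: specializes_base].
- by move=> _ [i ->]; exists (f i) => //; apply: generated_id; exists i.
Qed.

(** A generator u of the field K(F) lifts to some u' in K(f). If F i = N(u) / D(u), then f i - N(u')
    / D(u') is algebraic over K(f i0) and specializes to 0, so it vanishes. *)
Lemma simple_ext_of_specialization m (f : 'I_m -> L) (F : 'I_m -> M) i0 :
    (forall i, specializes (f i) (F i)) -> transcendental (F i0) ->
    (forall i, algebraic_over (simple_ext jK (f i0)) (f i)) ->
    (exists u, generated psiK (family F) u /\
       forall v, generated psiK (family F) v -> simple_ext psiK u v) ->
  exists u, forall i, simple_ext jK u (f i).
Proof.
move=> sf tF af [u [gu Hu]].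
have [u' gu' su'] := specializes_generated sf gu.
exists u' => i.
have /Hu/simple_extP[N [D [D0 EF]]] : generated psiK (family F) (F i).
  by apply: generated_id; exists i.
have sD := specializes_horner D su'.
have D'0 : (map_poly jK D).[u'] != 0.
  apply: contra_neq D0 => D'0; apply: (specializes_fun sD).
  by rewrite D'0; apply: specializes0.
suff : f i - (map_poly jK N).[u'] / (map_poly jK D).[u'] = 0.
  by move/eqP; rewrite subr_eq0 => /eqP->; apply/simple_extP; exists N, D.
have HS := simple_ext_subfield jK (f i0).
have HA := algebraic_over_subfield HS.
apply: (specializes_inj (sf i0) tF); last first.
  rewrite -(subrr (F i)); apply: specializesB => //; rewrite EF.
  by apply: specializesM; [exact: specializes_horner | exact: specializesV].
have SK c : algebraic_over (simple_ext jK (f i0)) (jK c).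
  by apply: (algebraic_over_id HS); apply: simple_extK.
have Au' : algebraic_over (simple_ext jK (f i0)) u'.
  apply: (gu' (algebraic_over (simple_ext jK (f i0)))); [exact: HA | exact: SK |].
  by move=> _ [k ->]; apply: af.
have AH p : algebraic_over (simple_ext jK (f i0)) (map_poly jK p).[u'].
  by apply: (subfield_horner HA); [move=> k; rewrite coef_map; apply: SK | exact: Au'].
have [_ AB AD] := HA; apply: AB => //; exact: AD.
Qed.

End Specialization.

(** * Kronecker substitution *)

Section Kronecker.
Variables (K : fieldType) (n D : nat).

Lemma base_expansion_inj k (u v : 'I_k -> nat) :
    (forall i, (u i < D)%N) -> (forall i, (v i < D)%N) ->
  (\sum_i u i * D ^ i = \sum_i v i * D ^ i)%N -> u =1 v.
Proof.
elim: k u v => [|k IHk] u v uD vD; first by move=> _ [].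
rewrite !big_ord_recl !expn0 !muln1.
have E (w : 'I_k.+1 -> nat) : (\sum_(i < k) w (lift ord0 i) * D ^ lift ord0 i =
    D * \sum_(i < k) w (lift ord0 i) * D ^ i)%N.
  by rewrite big_distrr; apply: eq_bigr => i _; rewrite /= expnS mulnCA.
rewrite !E => Euv.
have D0 : (0 < D)%N by apply: leq_ltn_trans (uD ord0).
have E0 : u ord0 = v ord0.
  have := congr1 (modn^~ D) Euv.
  by rewrite ![(_ + D * _)%N]addnC ![(D * _)%N]mulnC !modnMDl !modn_small.
have E1 : (fun i => u (lift ord0 i)) =1 (fun i => v (lift ord0 i)).
  apply: IHk => [i|i|]; [exact: uD | exact: vD |].
  by move/eqP: Euv; rewrite E0 eqn_add2l eqn_pmul2l // => /eqP.
by move=> i; case: (unliftP ord0 i) => [i'|] ->; rewrite ?E0 ?E1.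
Qed.

Definition kronecker : {mpoly K[n]} -> {poly K} :=
  mmap (@polyC K) (fun i : 'I_n => 'X^(D ^ i)).

HB.instance Definition _ := GRing.RMorphism.copy kronecker
  [the {rmorphism {mpoly K[n]} -> {poly K}} of mmap (@polyC K) (fun i : 'I_n => 'X^(D ^ i))].

Lemma kroneckerC c : kronecker c%:MP = c%:P.
Proof. exact: mmapC. Qed.

Lemma kroneckerE p :
  kronecker p = \sum_(u <- msupp p) p@_u *: 'X^(\sum_i u i * D ^ i).
Proof.
apply: eq_bigr => u _; rewrite mul_polyC; congr (_ *: _).
rewrite /mmap1 (big_morph (fun k => 'X^k : {poly K}) (fun a b => exprD 'X a b) (expr0 'X)).
by apply: eq_bigr => i _; rewrite -exprM mulnC.
Qed.

(** Since [msize] is the total degree plus one, all exponents are below D. They are the base D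
    digits of the exponent of X, and distinct monomials do not collide. *)
Lemma kronecker_eq0 p : (msize p <= D)%N -> kronecker p = 0 -> p = 0.
Proof.
move=> sp E; apply/eqP/negPn/negP => p0; have us := mlead_supp p0.
have lt u i : u \in msupp p -> (u i < D)%N.
  move=> /msize_mdeg_lt ltu; apply: leq_trans sp; apply: leq_ltn_trans ltu.
  by rewrite mdegE (bigD1 i) //= leq_addr.
have /polyP/(_ (\sum_i mlead p i * D ^ i)%N) := E.
rewrite kroneckerE coef0 coef_sum (bigD1_seq (mlead p)) ?msupp_uniq //=.
rewrite coefZ coefXn eqxx mulr1 big_seq_cond big1 => [/eqP|u /andP[u_s Nu]].
  by rewrite addr0 mleadc_eq0 (negbTE p0).
rewrite coefZ coefXn; case: eqP => [E1|_]; last by rewrite mulr0.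
case/eqP: Nu; apply/mnmP => i; apply: (base_expansion_inj _ _ (esym E1)) => k; exact: lt.
Qed.

End Kronecker.

Lemma mpoly_unitC (K : fieldType) n (c : {mpoly K[n]}) :
  c = 0 \/ c \is a GRing.unit -> exists k, c = k%:MP.
Proof.
case=> [->|cU]; first by exists 0; rewrite mpolyC0.
have /andP[/eqP Ec _] : mpoly_unit c by exact: cU.
by exists c@_0%MM.
Qed.

Lemma algebraic_constant_poly (K M : fieldType) (i : {rmorphism {poly K} -> M}) z :
    injective i -> (forall z, exists a b, b != 0 /\ z = i a / i b) ->
  algebraicOver (poly_base i) z -> exists c, z = poly_base i c.
Proof.
move=> i_inj i_frac za.
have [c -> cU] := algebraic_fraction i_inj i_frac (factorial_poly (factorial_field (K := K))) za.
suff [k ->] : exists k, c = k%:P by exists k.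
case: cU => [->|]; first by exists 0.
by rewrite poly_unitE => /andP[/size_poly1P[k _ ->] _]; exists k.
Qed.

(** * The theorem of Gordan and Igusa *)

Section GordanIgusa.
Variables (K : fieldType) (n : nat) (L M : fieldType).
Variables (j : {rmorphism {mpoly K[n]} -> L}) (i : {rmorphism {poly K} -> M}).
Hypothesis j_inj : injective j.
Hypothesis j_frac : forall z, exists a b, b != 0 /\ z = j a / j b.
Hypothesis i_inj : injective i.
Hypothesis i_frac : forall z, exists a b, b != 0 /\ z = i a / i b.

Local Notation jK := (j \o @mpolyC n K).

Lemma algebraic_constant z : algebraicOver jK z -> exists c, z = jK c.
Proof.
move=> za; have [c -> cU] := algebraic_fraction j_inj j_frac (@factorial_mpoly K n) za.
by have [k ->] := mpoly_unitC cU; exists k.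
Qed.

Lemma gordan_igusa m (f : 'I_m -> L) i0 :
    (forall c, f i0 <> jK c) ->
    (forall k, algebraic_over (simple_ext jK (f i0)) (f k)) ->
  exists u, forall k, simple_ext jK u (f k).
Proof.
move=> fN fA.
have [ab Eab] : exists ab : 'I_m -> {mpoly K[n]} * {mpoly K[n]},
    forall k, (ab k).2 != 0 /\ f k = j (ab k).1 / j (ab k).2.
  apply: (@fin_all_exists _ (fun=> ({mpoly K[n]} * {mpoly K[n]})%type)
    (fun k x => x.2 != 0 /\ f k = j x.1 / j x.2)) => k; have [a [b H]] := j_frac (f k).
  by exists (a, b).
(* This bounds the sizes of all numerators and denominators, and of a - c b for a constant c when
   [f i0] = a / b. So no denominator is killed and [f i0] does not become constant. *)
pose D := \max_k maxn (msize (ab k).1) (msize (ab k).2).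
have leD k : (maxn (msize (ab k).1) (msize (ab k).2) <= D)%N.
  exact: (leq_bigmax_cond k (F := fun k => maxn (msize (ab k).1) (msize (ab k).2))).
pose psi : {rmorphism {mpoly K[n]} -> M} := i \o @kronecker K n D.
pose F k := psi (ab k).1 / psi (ab k).2.
have psiC c : psi c%:MP = poly_base i c by rewrite /psi /= kroneckerC.
have psi0 p : (msize p <= D)%N -> psi p = 0 -> p = 0.
  move=> sp /eqP; rewrite /psi /= -(rmorph0 i) (inj_eq i_inj) => /eqP.
  exact: kronecker_eq0.
have b0 k : psi (ab k).2 != 0.
  have [b0 _] := Eab k; apply: contra_neq b0 => E; apply: (psi0 _ _ E).
  exact: leq_trans (leq_maxr _ _) (leD k).
have sf k : specializes j psi (f k) (F k).
  by exists (ab k).1, (ab k).2; have [_ ?] := Eab k.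
have tF : transcendental (@mpolyC n K) psi (F i0).
  move=> [p p0 pF].
  have /(algebraic_constant_poly i_inj i_frac)[c Ec] : algebraicOver (poly_base i) (F i0).
    exists p => //; rewrite (_ : map_poly (poly_base i) p = map_poly (psi \o @mpolyC n K) p) //.
    by apply: eq_map_poly => c; rewrite -psiC.
  apply: (fN c); have [jb0 ->] := Eab i0.
  have jb0' : j (ab i0).2 != 0 by rewrite (fraction_eq0 j_inj).
  suff E : (ab i0).1 - c *: (ab i0).2 = 0.
    move/eqP: E; rewrite subr_eq0 => /eqP->; rewrite -mul_mpolyC rmorphM mulfK //.
  apply: psi0.
    apply: leq_trans (mmeasureD_le _ _ _) (leq_trans _ (leD i0)).
    by rewrite geq_max leq_maxl /= mmeasureN (leq_trans (msizeZ_le _ _)) ?leq_maxr.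
  rewrite -mul_mpolyC rmorphB rmorphM psiC -Ec /F divfK ?subrr //.
apply: (simple_ext_of_specialization j_inj sf tF fA).
have gS := generated_subfield (psi \o @mpolyC n K) (family F).
have [c||u [gu Hu]] := luroth i_inj i_frac gS.
- by rewrite -psiC; apply: generatedK.
- exists (F i0); first by apply: generated_id; exists i0.
  move=> c Ec; apply: tF; exists ('X - c%:P); first by rewrite -size_poly_gt0 size_XsubC.
  apply/rootP; rewrite rmorphB /= map_polyX map_polyC /= !hornerE Ec.
  by rewrite -psiC subrr.
exists u; split=> // v /Hu.
apply: simple_ext_min; first exact: simple_ext_subfield.
  by move=> c; rewrite -psiC; apply: simple_extK.
exact: simple_ext_gen.
Qed.

End GordanIgusa.

(** * Graded components and degrees *)

Section Degrees.
Variables (K : fieldType) (n : nat).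
Implicit Types p q : {mpoly K[n]}.

Lemma mcoeff_pihomog d p u : (pihomog mdeg d p)@_u = if mdeg u == d then p@_u else 0.
Proof.
rewrite pihomogE raddf_sum /=; under eq_bigr => v _ do rewrite mcoeffZ mcoeffX.
have [us|us] := boolP (u \in msupp p); last first.
  rewrite (memN_msupp_eq0 us) if_same big_seq_cond big1 // => v /andP[vs _].
  by case: eqP vs => [->|_ _]; [rewrite (negbTE us) | rewrite mulr0].
rewrite big_mkcond (bigD1_seq u) ?msupp_uniq //= eqxx mulr1 big1 ?addr0 // => v /negbTE->.
by rewrite mulr0 if_same.
Qed.

Section Grading.
Variables (m : nat) (A : comNzRingType) (iota : {rmorphism K -> A}) (F : 'I_m -> A).

Lemma coef_graded (P : {mpoly K[m]}) d :
  (mmap (@polyC A \o iota) (fun i => 'X * (F i)%:P) P)`_d = mmap iota F (pihomog mdeg d P).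
Proof.
rewrite [in LHS]/mmap coef_sum pihomogE (raddf_sum (mmap iota F)) [RHS]big_mkcond /=.
apply: eq_bigr => u _.
have -> : mmap1 (fun i => 'X * (F i)%:P) u = 'X^(mdeg u) * (mmap1 F u)%:P.
  rewrite /mmap1 (eq_bigr (fun i => 'X ^+ u i * ((F i) ^+ u i)%:P)) => [|i _].
    by rewrite big_split /= -rmorph_prod mdegE expr_sum.
  by rewrite exprMn -rmorphXn.
rewrite mulrCA -polyCM coefXnM; case: ltngtP => // [lt|->].
  by rewrite coefC subn_eq0 leqNgt lt.
by rewrite subnn coefC eqxx mmapZ mmapX.
Qed.

End Grading.

(** The substitution x_i := t x_i: the coefficient of t^d is the homogeneous component of degree d,
    so degree and codegree become the highest and lowest exponent of t. *)
Definition graded : {mpoly K[n]} -> {poly {mpoly K[n]}} :=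
  mmap (@polyC _ \o @mpolyC n K) (fun i => 'X * ('X_i)%:P).

HB.instance Definition _ := GRing.RMorphism.copy graded
  [the {rmorphism {mpoly K[n]} -> {poly {mpoly K[n]}}} of
   mmap (@polyC _ \o @mpolyC n K) (fun i => 'X * ('X_i)%:P)].

Lemma gradedC c : graded c%:MP = c%:MP%:P.
Proof. exact: mmapC. Qed.

Lemma coef_gradedE p d : (graded p)`_d = pihomog mdeg d p.
Proof.
rewrite /graded coef_graded.
exact: (@mpoly_rmorph_ext _ _ _ (mmap (@mpolyC n K) (fun i => 'X_i)) idfun
  (fun c => mmapC _ _ c) (fun i => etrans (mmapX _ _ _) (mmap1U _ _))).
Qed.

Lemma coef_graded_neq0 p d :
  (graded p)`_d != 0 <-> exists2 u, u \in msupp p & mdeg u = d.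
Proof.
rewrite coef_gradedE; split=> [N|[u us ud]].
  apply: NNPP => N'; case/eqP: N; apply/mpolyP => u; rewrite mcoeff_pihomog mcoeff0.
  case: eqP => // ud; apply/eqP; rewrite mcoeff_eq0; apply/negP => us.
  by apply: N'; exists u.
apply/eqP => /mpolyP/(_ u); rewrite mcoeff_pihomog ud eqxx mcoeff0 => /eqP.
by rewrite mcoeff_eq0 us.
Qed.

Lemma graded_hval s f p q :
  graded (hval (@mpolyC n K) s f p q) =
  hval (@polyC _ \o @mpolyC n K) s f (graded p) (graded q).
Proof.
rewrite hval_morph; apply: eq_bigr => i _.
by rewrite -[X in X * _ * _ = _]/(graded (f`_i)%:MP) gradedC.
Qed.

Section Rows.
Variable m : nat.
Implicit Type F : 'rV[{mpoly K[n]}]_m.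

Definition has_deg F D := (forall i k, (D < k)%N -> (graded (F 0 i))`_k = 0) /\
  exists i, (graded (F 0 i))`_D != 0.

Definition has_codeg F C := (forall i k, (k < C)%N -> (graded (F 0 i))`_k = 0) /\
  exists i, (graded (F 0 i))`_C != 0.

Lemma row_neq0 (R : nmodType) (G : 'rV[R]_m) : G != 0 -> exists i, G 0 i != 0.
Proof.
move=> G0; apply: NNPP => N; case/eqP: G0; apply/rowP => i; rewrite mxE.
by apply/eqP/negPn/negP => Ni; apply: N; exists i.
Qed.

Lemma graded_neq0 p : p != 0 -> exists d, (graded p)`_d != 0.
Proof.
move=> /mlead_supp us; exists (mdeg (mlead p)); apply/coef_graded_neq0.
by exists (mlead p).
Qed.

Lemma has_degP F D : has_deg F D -> deg F = D%:Z%:E.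
Proof.
move=> [H [i /coef_graded_neq0[u us ud]]]; apply: le_anti; apply/andP; split.
  apply: bigmax_le => [|i' _]; first exact: leNye.
  rewrite big_seq; apply: bigmax_le => [|v vs]; first exact: leNye.
  rewrite lee_fin lez_nat leqNgt; apply/negP => ltv.
  have := H i' _ ltv; apply/eqP/coef_graded_neq0; by exists v.
apply: (le_trans _ (le_bigmax _ _ i)); rewrite -ud.
exact: (le_bigmax_seq -oo%E u xpredT (fun u : 'X_{1..n} => (mdeg u)%:Z%:E) us isT).
Qed.

Lemma has_codegP F C : has_codeg F C -> codeg F = C%:Z%:E.
Proof.
move=> [H [i /coef_graded_neq0[u us ud]]]; apply: le_anti; apply/andP; split.
  apply: (le_trans (bigmin_le _ i _)); rewrite -ud /=.
  exact: (ge_bigmin_seq +oo%E u xpredT (fun u : 'X_{1..n} => (mdeg u)%:Z%:E) us isT).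
apply: le_bigmin => [|i' _]; first exact: leey.
rewrite big_seq; apply: le_bigmin => [|v vs]; first exact: leey.
rewrite lee_fin lez_nat leqNgt; apply/negP => ltv.
have := H i' _ ltv; apply/eqP/coef_graded_neq0; by exists v.
Qed.

Lemma has_deg_exists F : F != 0 -> exists D, has_deg F D.
Proof.
move=> /row_neq0[i Fi0].
have ex : exists D, [exists i, (graded (F 0 i))`_D != 0].
  by have [d dP] := graded_neq0 Fi0; exists d; apply/existsP; exists i.
have ub D : [exists i, (graded (F 0 i))`_D != 0] -> (D <= \max_i size (graded (F 0%R i)))%N.
  move=> /existsP[k kP]; apply: leq_trans (leq_bigmax_cond k (F := fun k => size (graded (F 0 k))) isT).
  by rewrite leqNgt; apply: contra kP => /ltnW/(nth_default 0)->.
have [D /existsP DP Dmax] := ex_maxnP ex ub; exists D; split=> // k d ltd.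
apply/eqP/negPn/negP => N; suff : (d <= D)%N by rewrite leqNgt ltd.
by apply: Dmax; apply/existsP; exists k.
Qed.

Lemma has_codeg_exists F : F != 0 -> exists C, has_codeg F C.
Proof.
move=> /row_neq0[i Fi0].
have ex : exists D, [exists i, (graded (F 0 i))`_D != 0].
  by have [d dP] := graded_neq0 Fi0; exists d; apply/existsP; exists i.
have [C /existsP CP Cmin] := ex_minnP ex; exists C; split=> // k d ltd.
apply/eqP/negPn/negP => N; suff : (C <= d)%N by rewrite leqNgt ltd.
by apply: Cmin; apply/existsP; exists k.
Qed.

Lemma homogeneousP F d : (forall i, F 0 i \is d.-homog) <->
  forall i k, k != d -> (graded (F 0 i))`_k = 0.
Proof.
split=> [H i k Nk|H i].
  apply/eqP/negPn/negP => /coef_graded_neq0[u us ud].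
  by have := dhomogP _ _ _ (H i) u us => /= E; rewrite -ud E eqxx in Nk.
apply/dhomogP => u us /=; apply/eqP/negPn/negP => /(H i).
by apply/eqP/coef_graded_neq0; exists u.
Qed.

Lemma homogeneous_has_deg F d : (forall i, F 0 i \is d.-homog) -> F != 0 ->
  has_deg F d /\ has_codeg F d.
Proof.
move=> /homogeneousP H /row_neq0[i Fi0].
have [k kP] := graded_neq0 Fi0.
have Ek : k = d by apply/eqP/negPn/negP => /(H i) E; rewrite E eqxx in kP.
rewrite Ek in kP; split; split; try by exists i.
  by move=> i' k' lt; apply: H; rewrite gtn_eqF.
by move=> i' k' lt; apply: H; rewrite ltn_eqF.
Qed.

Lemma homogeneous_of_deg F D : has_deg F D -> has_codeg F D -> homogeneous F.
Proof.
move=> [H1 [i Fi]] [H2 _]; split.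
  apply/eqP => F0; case/eqP: Fi; by rewrite F0 mxE (rmorph0 graded) coef0.
exists D; apply/homogeneousP => k d; rewrite neq_ltn => /orP[]; [exact: H2 | exact: H1].
Qed.

Lemma has_deg_fun F d d' : has_deg F d -> has_deg F d' -> d = d'.
Proof.
by move=> /has_degP H /has_degP; rewrite H => -[].
Qed.

Lemma has_codeg_fun F d d' : has_codeg F d -> has_codeg F d' -> d = d'.
Proof. by move=> /has_codegP H /has_codegP; rewrite H => -[]. Qed.

Lemma constant_row_deg0 F : has_deg F 0 -> constant_row F.
Proof.
case=> H _; exists (\row_i (F 0 i)@_0%MM); apply/rowP => i; rewrite !mxE.
apply/mpolyP => u; rewrite mcoeffC; have [->|Nu] := eqVneq u 0%MM; first by rewrite mulr1.
rewrite mulr0; apply: memN_msupp_eq0; apply/negP => us.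
have : (0 < mdeg u)%N by rewrite lt0n mdeg_eq0.
by move=> /(H i)/eqP; apply/negP/coef_graded_neq0; exists u.
Qed.

Lemma constant_row_homog F : constant_row F -> forall i, F 0 i \is 0.-homog.
Proof.
move=> [c ->] i; rewrite !mxE -[c 0 i]mulr1 mpolyCM mul_mpolyC.
by apply: rpredZ; apply: dhomog1.
Qed.

Lemma has_deg0_constant F D : has_deg F D -> constant_row F -> D = 0%N.
Proof.
move=> FD /constant_row_homog Fh; have [_ [i Fi]] := FD.
have F0 : F != 0.
  by apply/eqP => F0; case/eqP: Fi; rewrite F0 mxE (rmorph0 graded) coef0.
by have [H _] := homogeneous_has_deg Fh F0; apply: has_deg_fun FD H.
Qed.

End Rows.

Lemma coef_top_mul (A : nzRingType) (P Q : {poly A}) a b :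
    (forall k, (a < k)%N -> P`_k = 0) -> (forall k, (b < k)%N -> Q`_k = 0) ->
  (P * Q)`_(a + b) = P`_a * Q`_b /\ forall k, (a + b < k)%N -> (P * Q)`_k = 0.
Proof.
move=> HP HQ; split=> [|k lt].
  rewrite coefM (bigD1 (Ordinal (leq_addr b a : (a < (a + b).+1)%N))) //= addKn.
  rewrite big1 ?addr0 // => i; rewrite -val_eqE /= neq_ltn => /orP[lt|lt].
    by rewrite HQ ?mulr0 // ltn_subRL ltn_add2r.
  by rewrite HP ?mul0r.
rewrite coefM big1 // => i _; have [lti|lei] := ltnP a i; first by rewrite HP ?mul0r.
by rewrite HQ ?mulr0 // ltn_subRL (leq_ltn_trans _ lt) // leq_add2r.
Qed.

Section TopCoefficient.
Variables (A : comNzRingType) (iota : {rmorphism K -> A}).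

Lemma coef_top_exp (P : {poly A}) a i : (forall k, (a < k)%N -> P`_k = 0) ->
  (P ^+ i)`_(a * i) = P`_a ^+ i /\ forall k, (a * i < k)%N -> (P ^+ i)`_k = 0.
Proof.
move=> HP; elim: i => [|i [IH1 IH2]].
  rewrite muln0 !expr0 coef1; split=> // -[|k] //; by rewrite coef1.
by rewrite !exprS mulnS -IH1; apply: coef_top_mul.
Qed.

(** D is a common bound for both degrees, so one of the coefficients of P and Q at D may be 0. The
    coefficient at s D is the value of the form at them in every case. *)
Lemma coef_top_hval s f (P Q : {poly A}) D :
    (forall k, (D < k)%N -> P`_k = 0) -> (forall k, (D < k)%N -> Q`_k = 0) ->
  (hval (@polyC A \o iota) s f P Q)`_(s * D) = hval iota s f P`_D Q`_D /\
  forall k, (s * D < k)%N -> (hval (@polyC A \o iota) s f P Q)`_k = 0.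
Proof.
move=> HP HQ.
have H (i : 'I_s.+1) : (P ^+ i * Q ^+ (s - i))`_(s * D) = P`_D ^+ i * Q`_D ^+ (s - i) /\
    forall k, (s * D < k)%N -> (P ^+ i * Q ^+ (s - i))`_k = 0.
  have -> : (s * D = D * i + D * (s - i))%N.
    by rewrite -mulnDr subnKC ?(mulnC D) // -ltnS ltn_ord.
  have [E1 H1] := coef_top_exp i HP; have [E2 H2] := coef_top_exp (s - i) HQ.
  by rewrite -E1 -E2; apply: coef_top_mul.
split=> [|k lt]; rewrite /hval coef_sum.
  by apply: eq_bigr => i _; rewrite -!mulrA coefCM; have [-> _] := H i.
by apply: big1 => i _; rewrite -mulrA coefCM; have [_ ->] := H i; rewrite ?mulr0.
Qed.

Lemma coef_low_hval s f (P Q : {poly A}) C :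
    (forall k, (k < C)%N -> P`_k = 0) -> (forall k, (k < C)%N -> Q`_k = 0) ->
  (hval (@polyC A \o iota) s f P Q)`_(s * C) = hval iota s f P`_C Q`_C /\
  forall k, (k < s * C)%N -> (hval (@polyC A \o iota) s f P Q)`_k = 0.
Proof.
have drop (R : {poly A}) : (forall k, (k < C)%N -> R`_k = 0) -> R = 'X^C * drop_poly C R.
  move=> HR; apply/polyP => k; rewrite coefXnM coef_drop_poly.
  by case: ltnP => [/HR//|le]; rewrite subnK.
move=> /drop EP /drop EQ.
have -> : P`_C = (drop_poly C P)`_0 by rewrite coef_drop_poly.
have -> : Q`_C = (drop_poly C Q)`_0 by rewrite coef_drop_poly.
rewrite {1 3}EP {1 3}EQ hval_scale -exprM mulnC.
split=> [|k lt]; rewrite coefXnM; last by rewrite lt.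
(* After division by X^C the lowest coefficient is the value at 0, and evaluation commutes with
   [hval]. *)
rewrite ltnn subnn -!horner_coef0 -!horner_evalE hval_morph.
by apply: eq_bigr => i _; rewrite /= horner_evalE hornerC.
Qed.

End TopCoefficient.

Lemma good_has_deg m s (f : 'I_m -> {poly K}) p q D : good s f ->
  has_deg (pair_row p q) D -> has_deg (hval_row (@mpolyC n K) s f p q) (s * D).
Proof.
move=> fgood [H [i Hi]].
have Hp k : (D < k)%N -> (graded p)`_k = 0 by move=> /(H ord0); rewrite pair_row0.
have Hq k : (D < k)%N -> (graded q)`_k = 0 by move=> /(H ord_max); rewrite pair_row1.
split=> [l k lt|]; first by rewrite mxE graded_hval; have [_ ->] := coef_top_hval (@mpolyC n K) s (f l) Hp Hq.
have [|l Nl] := good_hval_neq0 (@mpolyC n K) (a := (graded p)`_D) (b := (graded q)`_D) fgood.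
  by case: (ord2P i) Hi => ->; rewrite ?pair_row0 ?pair_row1; [left | right].
by exists l; rewrite mxE graded_hval; have [-> _] := coef_top_hval (@mpolyC n K) s (f l) Hp Hq.
Qed.

Lemma good_has_codeg m s (f : 'I_m -> {poly K}) p q C : good s f ->
  has_codeg (pair_row p q) C -> has_codeg (hval_row (@mpolyC n K) s f p q) (s * C).
Proof.
move=> fgood [H [i Hi]].
have Hp k : (k < C)%N -> (graded p)`_k = 0 by move=> /(H ord0); rewrite pair_row0.
have Hq k : (k < C)%N -> (graded q)`_k = 0 by move=> /(H ord_max); rewrite pair_row1.
split=> [l k lt|]; first by rewrite mxE graded_hval; have [_ ->] := coef_low_hval (@mpolyC n K) s (f l) Hp Hq.
have [|l Nl] := good_hval_neq0 (@mpolyC n K) (a := (graded p)`_C) (b := (graded q)`_C) fgood.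
  by case: (ord2P i) Hi => ->; rewrite ?pair_row0 ?pair_row1; [left | right].
by exists l; rewrite mxE graded_hval; have [-> _] := coef_low_hval (@mpolyC n K) s (f l) Hp Hq.
Qed.

End Degrees.

(** * Homogeneous relations *)

Section HomogeneousIndependence.
Variable K : fieldType.

Definition hom_independent (A : comNzRingType) (iota : {rmorphism K -> A}) k (F : 'I_k -> A) :=
  forall d (P : {mpoly K[k]}), P \is d.-homog -> mmap iota F P = 0 -> P = 0.

Lemma mmap_scale (A : comNzRingType) (iota : {rmorphism K -> A}) k (F : 'I_k -> A) g d
    (P : {mpoly K[k]}) : P \is d.-homog ->
  mmap iota (fun i => g * F i) P = g ^+ d * mmap iota F P.
Proof.
move=> /dhomogP hP; rewrite /mmap mulr_sumr; apply: eq_big_seq => u us.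
have <- : mdeg u = d := hP u us.
rewrite mulrCA; congr (_ * _); rewrite /mmap1 mdegE expr_sum -big_split /=.
by apply: eq_bigr => i _; rewrite exprMn.
Qed.

Lemma mmap_comp (A B : comNzRingType) (iota : {rmorphism K -> A}) (phi : {rmorphism A -> B})
    k (F : 'I_k -> A) P :
  phi (mmap iota F P) = mmap (phi \o iota) (fun i => phi (F i)) P.
Proof.
rewrite /mmap rmorph_sum; apply: eq_bigr => u _.
rewrite rmorphM /mmap1 rmorph_prod; congr (_ * _).
by apply: eq_bigr => i _; rewrite rmorphXn.
Qed.

Lemma eq_mmap (A : comNzRingType) (iota iota' : {rmorphism K -> A}) k (F G : 'I_k -> A) P :
  iota =1 iota' -> F =1 G -> mmap iota F P = mmap iota' G P.
Proof.
by move=> Ei E; apply: eq_bigr => u _; rewrite Ei (mmap1_eq _ E).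
Qed.

(** A relation of degree d evaluated at the F i is g^d times its value at the G i. For this reason
    the factor g of a decomposition does not affect the transcendence degree of K(tH). *)
Lemma hom_independent_scale (A : idomainType) (iota : {rmorphism K -> A}) k (F G : 'I_k -> A) g :
  g != 0 -> (forall i, F i = g * G i) ->
  hom_independent iota F <-> hom_independent iota G.
Proof.
move=> g0 EF; have E d P : P \is d.-homog -> mmap iota F P = g ^+ d * mmap iota G P.
  by move=> hP; rewrite -mmap_scale //; apply: eq_mmap.
split=> H d P hP P0; apply: (H d P hP); first by rewrite (E d) // P0 mulr0.
by move/eqP: P0; rewrite (E d) // mulf_eq0 expf_eq0 (negbTE g0) andbF => /eqP.
Qed.

Lemma hom_independent_inj (A B : comNzRingType) (iota : {rmorphism K -> A})
    (phi : {rmorphism A -> B}) k (F : 'I_k -> A) : injective phi ->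
  hom_independent (phi \o iota) (fun i => phi (F i)) <-> hom_independent iota F.
Proof.
move=> phi_inj; split=> H d P hP P0; apply: (H d P hP).
  by rewrite -mmap_comp P0 rmorph0.
by apply: phi_inj; rewrite mmap_comp P0 rmorph0.
Qed.

Lemma t_independent (L M : fieldType) (iota : {rmorphism K -> L}) (e : {rmorphism {poly L} -> M})
    k (F : 'I_k -> L) : injective e ->
  algebraically_independent (e \o @polyC L \o iota) (fun i => e ('X * (F i)%:P)) <->
  hom_independent iota F.
Proof.
move=> e_inj.
have E P : mmap (e \o @polyC L \o iota) (fun i => e ('X * (F i)%:P)) P = 0 <->
    forall d, mmap iota F (pihomog mdeg d P) = 0.
  have -> : mmap (e \o @polyC L \o iota) (fun i => e ('X * (F i)%:P)) P =
      e (mmap (@polyC L \o iota) (fun i => 'X * (F i)%:P) P).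
    by rewrite mmap_comp; apply: eq_mmap.
  split=> [P0 d|H].
    rewrite -coef_graded (_ : mmap _ _ P = 0) ?coef0 //.
    by apply: e_inj; rewrite P0 rmorph0.
  rewrite (_ : mmap _ _ P = 0) ?rmorph0 //.
  by apply/polyP => d; rewrite coef_graded coef0.
split=> [H d P hP P0|H P /E HP].
  apply: H; apply/E => d'; have [->|Nd] := eqVneq d' d; first by rewrite pihomog_dE.
  by rewrite (pihomog_ne0 _ hP) ?mmap0 // eq_sym.
apply/mpolyP => u; rewrite mcoeff0.
have := H _ _ (pihomogP mdeg (mdeg u) P) (HP _) => /mpolyP/(_ u).
by rewrite mcoeff_pihomog eqxx mcoeff0.
Qed.

Lemma tofrac_inj (R : idomainType) : injective (@tofrac R).
Proof. by move=> a b /eqP; rewrite tofrac_eq => /eqP. Qed.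

Lemma trdeg_t_independent n m (F : 'rV[ratfun K n]_m) :
  (exists sigma : 'I_(trdeg_t F) -> 'I_m, hom_independent (@ratfunC K n) (fun i => F 0 (sigma i))) /\
  (forall l (tau : 'I_l -> 'I_m), hom_independent (@ratfunC K n) (fun i => F 0 (tau i)) ->
     (l <= trdeg_t F)%N).
Proof.
have [[s si] maxF] := trdeg_adjoin (@ratfun_tC K n) (fun i => tofrac ('X * (F 0 i)%:P)).
have H l (tau : 'I_l -> 'I_m) := t_independent (@ratfunC K n)
  (fun i => F 0 (tau i)) (@tofrac_inj {poly ratfun K n}).
split; first by exists s; apply/H.
by move=> l tau /H; apply: maxF.
Qed.

Lemma trdeg_t_eq n n' m (F : 'rV[ratfun K n]_m) (G : 'rV[ratfun K n']_m) :
    (forall l (tau : 'I_l -> 'I_m), hom_independent (@ratfunC K n) (fun i => F 0 (tau i)) <->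
       hom_independent (@ratfunC K n') (fun i => G 0 (tau i))) ->
  trdeg_t F = trdeg_t G.
Proof.
move=> H; have [[s si] maxF] := trdeg_t_independent F.
have [[s' si'] maxG] := trdeg_t_independent G.
apply/eqP; rewrite eqn_leq; apply/andP; split.
  exact: (maxG _ s (proj1 (H _ s) si)).
exact: (maxF _ s' (proj2 (H _ s') si')).
Qed.

Lemma dhomog_mmap n k (F : 'I_k -> {mpoly K[n]}) e d (P : {mpoly K[k]}) :
  (forall i, F i \is e.-homog) -> P \is d.-homog -> mmap (@mpolyC n K) F P \is (e * d).-homog.
Proof.
move=> hF hP; rewrite /mmap big_seq; apply: rpred_sum => u us.
rewrite mul_mpolyC; apply: rpredZ.
have <- : mdeg u = d by have := dhomogP _ _ _ hP u us.
rewrite mdegE /mmap1; elim/big_rec2: _ => [|i Q t _ IH]; first by rewrite muln0; exact: dhomog1.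
by rewrite mulnDr; apply: dhomogM => //; apply: dhomogMn.
Qed.

Lemma hom_independent_sub (A : comNzRingType) (iota : {rmorphism K -> A}) k l
    (F : 'I_k -> A) (lek : (l <= k)%N) :
  hom_independent iota F -> hom_independent iota (fun i : 'I_l => F (widen_ord lek i)).
Proof.
move=> H d P hP P0; pose v := fun i : 'I_l => 'X_(widen_ord lek i) : {mpoly K[k]}.
have : mmap (@mpolyC k K) v P = 0.
  apply: (H d); last by rewrite mmap_comp -[RHS]P0; apply: eq_mmap => [c|i];
    rewrite /= ?mmapC // mmapX mmap1U.
  rewrite -[d]mul1n; apply: dhomog_mmap => // i; exact: dhomogXi.
(* This undoes [v]: it keeps the first l variables and sends the others to 0, so that P is recovered
   from its image. *)
pose w := fun i : 'I_k => if insub (val i) is Some i' then 'X_(i' : 'I_l) else 0 : {mpoly K[l]}.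
move=> /(congr1 (mmap (@mpolyC l K) w)); rewrite mmap_comp mmap0 => <-.
rewrite -[LHS](@mpoly_rmorph_ext _ _ _ (mmap (@mpolyC l K) (fun i => 'X_i)) idfun
  (fun c => mmapC _ _ c) (fun i => etrans (mmapX _ _ _) (mmap1U _ _))).
apply: eq_mmap => [c|i]; rewrite /= ?mmapC // mmapX mmap1U /w /=.
by rewrite insubT //= => lti; congr 'X_[U_(_)]; apply: val_inj.
Qed.

End HomogeneousIndependence.

Section FamilyNormalization.
Variable K : fieldType.

(** Dividing by the gcd turns its Bezout identity into one for 1; the largest remaining degree is
    taken as formal degree, so that some member attains it. *)
Lemma normalize_family m (A : 'I_m -> {poly K}) i0 : A i0 != 0 ->
  exists (G : {poly K}) s A', [/\ G != 0, forall i, A i = A' i * G & good s A'].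
Proof.
move=> A0; have [G [u [EG dG]]] := poly_gcd_family A.
have G0 : G != 0 by apply: contra_neq A0 => G0; have [e] := dG i0; rewrite G0 mulr0.
pose Q i := A i %/ G.
have EA i : A i = Q i * G by rewrite /Q; have [e ->] := dG i; rewrite mulpK.
pose s := \max_i size (Q i).
have le i : (size (Q i) <= s)%N.
  exact: (leq_bigmax_cond i (F := fun i => size (Q i))).
have s0 : (0 < s)%N.
  apply: leq_trans (le i0); rewrite size_poly_gt0.
  by apply: contra_neq A0 => E; rewrite EA E mul0r.
exists G, s.-1, Q; split=> //; split.
- by move=> i; rewrite prednK.
- rewrite prednK //; apply: NNPP => N.
  suff : (s <= s.-1)%N by rewrite -{1}(prednK s0) ltnn.
  rewrite {1}/s; apply/bigmax_leqP => i _; rewrite -ltnS prednK // ltn_neqAle le andbT.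
  by apply/eqP => E; apply: N; exists i.
exists u; apply: (mulIf G0); rewrite mul1r {2}EG mulr_suml; apply: eq_bigr => i _.
by rewrite -mulrA -EA.
Qed.

Lemma simple_ext_common_denominator (L : fieldType) (iota : {rmorphism K -> L}) u
    m (f : 'I_m -> L) : (forall k, simple_ext iota u (f k)) ->
  exists (A : 'I_m -> {poly K}) (B : {poly K}), (map_poly iota B).[u] != 0 /\
    forall k, f k = (map_poly iota (A k)).[u] / (map_poly iota B).[u].
Proof.
move=> fu; pose ev : {rmorphism {poly K} -> L} := horner_eval u \o map_poly iota.
(* The family is packed into the coefficients of one polynomial, for which a common denominator is
   available. *)
pose F := \poly_(k < m) (if insub k is Some k' then f k' else 0).
have [|d [g [d0 Eg]]] := @clear_denominators L {poly K} ev F.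
  move=> i; rewrite coef_poly; case: ltnP => lti; last first.
    by exists 0, 1; rewrite rmorph0 rmorph1 oner_neq0 mul0r.
  by rewrite insubT; have /simple_extP := fu (Sub i lti).
exists (fun k => g`_k), d; split=> // k.
have /polyP/(_ k) := Eg; rewrite coef_map coefZ coef_poly ltn_ord (insubT (fun x => (x < m)%N) (ltn_ord k)) => E.
rewrite -[LHS](mulfK d0) -[RHS]/(ev g`_k / ev d) E (mulrC (ev d)).
by congr (f _ * _ / _); apply: val_inj.
Qed.

End FamilyNormalization.

(** * From homogeneous relations to algebraic dependence of quotients *)

Section Dependence.
Variables (K L : fieldType) (iota : {rmorphism K -> L}).

Lemma acl_empty (b : 'I_0 -> L) x : acl iota (family b) x -> algebraicOver iota x.
Proof.
case=> f [f0 Ef fx].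
have [|d [g [d0 Eg]]] := @clear_denominators L K iota f.
  move=> i; apply: (Ef i (fun y => exists N D, iota D != 0 /\ y = iota N / iota D)).
  - split.
    + by exists 1, 1; rewrite !rmorph1 oner_neq0 divr1.
    + move=> _ _ [N [D [D0 ->]]] [N' [D' [D'0 ->]]]; exists (N / D - N' / D'), 1.
      by rewrite rmorphB !fmorph_div rmorph1 oner_neq0 divr1.
    + move=> _ _ [N [D [D0 ->]]] [N' [D' [D'0 ->]]]; exists (N / D / (N' / D')), 1.
      by rewrite !fmorph_div rmorph1 oner_neq0 divr1.
  - by move=> c; exists c, 1; rewrite rmorph1 oner_neq0 divr1.
  - by move=> a [[k ltk0] _].
exists g; last by rewrite Eg rootE hornerZ (rootP fx) mulr0.
apply: contra_neq f0 => g0; move/eqP: Eg; rewrite g0 map_poly0 eq_sym.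
by rewrite -mul_polyC mulf_eq0 polyC_eq0 (negbTE d0) => /eqP.
Qed.

(** With z the last variable, a form of degree d is z^d times its value at (x / z, y / z, 1); the
    morphism [j] provides a field in which z is invertible. *)
Lemma dehomogenize3 (M : fieldType) (j : {rmorphism {mpoly K[3]} -> M}) d (P : {mpoly K[3]}) :
    injective j -> P \is d.-homog ->
    mmap (@mpolyC 2 K) (tnth [tuple 'X_ord0; 'X_ord_max; 1]) P = 0 ->
  P = 0.
Proof.
move=> j_inj hP Q0; apply: (j_inj); rewrite rmorph0.
pose z := j 'X_ord_max.
have z0 : z != 0.
  rewrite /z -(rmorph0 j) (inj_eq j_inj); apply/eqP => /mpolyP/(_ U_(ord_max)%MM).
  by rewrite mcoeffXU eqxx mcoeff0 => /eqP; rewrite oner_eq0.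
pose w (i : 'I_2) := j 'X_(widen_ord (leqnSn 2) i) / z.
have EP : P = mmap (@mpolyC 3 K) (fun i => 'X_i) P.
  exact: (esym (@mpoly_rmorph_ext _ _ _ (mmap (@mpolyC 3 K) (fun i => 'X_i)) idfun
    (fun c => mmapC _ _ c) (fun i => etrans (mmapX _ _ _) (mmap1U _ _)) P)).
pose v (i : 'I_3) := mmap (j \o @mpolyC 3 K) w (tnth [tuple 'X_ord0; 'X_ord_max; 1] i).
have Q1 : mmap (j \o @mpolyC 3 K) v P = 0.
  rewrite -[RHS](mmap0 w (j \o @mpolyC 3 K)) -Q0 mmap_comp.
  by apply: eq_mmap => // c /=; rewrite mmapC.
rewrite EP mmap_comp; transitivity (mmap (j \o @mpolyC 3 K) (fun i => z * v i) P).
  apply: eq_mmap => // i; rewrite /v; have [->|[i' ->]] := ord_max_or_widen i.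
    by rewrite (tnth_nth 0) /= rmorph1 mulr1.
  rewrite (tnth_nth 0) /=.
  by case: (ord2P i') => -> /=; rewrite mmapX mmap1U /w mulrCA mulfV ?mulr1.
by rewrite (mmap_scale _ _ _ hP) Q1 mulr0.
Qed.

(** Otherwise x and y are algebraically independent. A homogeneous relation P between z x, z y and z
    gives P(x, y, 1) = 0 after division by a power of z, so P(y_1, y_2, 1) = 0 and P = 0. *)
Lemma dependent_algebraic (M : fieldType) (j : {rmorphism {mpoly K[3]} -> M}) x y z :
    injective j -> z != 0 -> ~ algebraicOver iota x ->
    ~ hom_independent iota (tnth [tuple z * x; z * y; z]) ->
  algebraic_over (simple_ext iota x) y.
Proof.
move=> j_inj z0 Nx H; apply: NNPP => Ny; apply: H.
pose v := tnth [tuple x; y; 1].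
have Ezv : forall i, tnth [tuple z * x; z * y; z] i = z * v i.
  by move=> i; rewrite /v !(tnth_nth 0); case: i => -[|[|[|//]]] lti /=; rewrite ?mulr1.
apply/(hom_independent_scale iota z0 Ezv) => d P hP P0.
apply: (dehomogenize3 j_inj hP).
pose b : 'I_2 -> L := tnth [tuple x; y].
have bi : algebraically_independent iota b.
  apply/algebraically_independentS; split.
    apply/algebraically_independentS; split; first exact: algebraically_independent0.
    by move=> /acl_empty; rewrite /= /b (tnth_nth 0).
  rewrite {2}/b (tnth_nth 0) /= => Ay; apply: Ny; apply/algebraic_adjoin.
  apply: acl_mono Ay => _ [i ->]; exists ord0.
  by rewrite ord1 /b /= (tnth_nth 0).
apply: bi; rewrite mmap_comp -[RHS]P0; apply: eq_mmap => [c|i] /=; first by rewrite mmapC.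
rewrite /v !(tnth_nth 0); case: i => -[|[|[|//]]] lti /=; rewrite ?rmorph1 // mmapX mmap1U /b (tnth_nth 0) //.
Qed.

End Dependence.

Lemma constant_pairP (K : fieldType) n (p q : {mpoly K[n]}) :
  constant_row (pair_row p q) <-> exists a b, p = a%:MP /\ q = b%:MP.
Proof.
split=> [[c /rowP E]|[a [b [-> ->]]]].
  exists (c 0 ord0), (c 0 ord_max).
  by have := E ord0; have := E ord_max; rewrite pair_row0 pair_row1 !mxE.
exists (pair_row a b); apply/rowP => i; rewrite [RHS]mxE.
by case: (ord2P i) => ->; rewrite ?pair_row0 ?pair_row1.
Qed.

(** A nonconstant common divisor would, by degrees, be a constant multiple of both variables; its
    coefficient at y_2 would be zero and nonzero. *)
Lemma coprime_X01 (K : fieldType) :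
  coprime_elts ('X_ord0 : {mpoly K[2]}) 'X_ord_max.
Proof.
move=> d [e Ee] [e' Ee'].
have Xneq0 (i : 'I_2) : ('X_i : {mpoly K[2]}) != 0.
  apply/eqP => /mpolyP/(_ U_(i)%MM); rewrite mcoeffXU eqxx mcoeff0 => /eqP.
  by rewrite oner_eq0.
have [e0 d0] : e != 0 /\ d != 0 by apply/andP; rewrite -negb_or -mulf_eq0 -Ee.
have [e'0 _] : e' != 0 /\ d != 0 by apply/andP; rewrite -negb_or -mulf_eq0 -Ee'.
have sd : msize d = 1%N \/ msize d = 2%N /\ msize e = 1%N /\ msize e' = 1%N.
  have := congr1 (fun p => msize p) Ee; have := congr1 (fun p => msize p) Ee'.
  rewrite /= !msizeX !mdeg1 !msizeM //.
  have [] : (0 < msize d)%N /\ (0 < msize e)%N /\ (0 < msize e')%N.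
    by rewrite !lt0n !mmeasure_poly_eq0.
  move: (msize d) (msize e) (msize e') => a b c [a0 [b0 c0]] E1 E2; lia.
case: sd => [/eqP/msize_poly1P[c c0 ->]|[_ []]].
  by apply: (rmorph_unit (@mpolyC 2 K)); rewrite unitfE.
move=> /eqP/msize_poly1P[c c0 Ec] /eqP/msize_poly1P[c' c'0 Ec'].
have := congr1 (mcoeff U_(ord_max)) Ee; have := congr1 (mcoeff U_(ord_max)) Ee'.
rewrite Ec Ec' !mcoeffCM !mcoeffXU eqxx /= => E1 /esym/eqP.
rewrite mulf_eq0 (negbTE c0) /= => /eqP d1.
by move/eqP: E1; rewrite d1 mulr0 oner_eq0.
Qed.

(** * Decompositions *)

Section RationalFunctionRows.
Variables (K : fieldType) (n : nat) (L : fieldType) (j : {rmorphism {mpoly K[n]} -> L}).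
Hypothesis j_inj : injective j.
Hypothesis j_frac : forall z, exists a b, b != 0 /\ z = j a / j b.
Local Notation jK := (j \o @mpolyC n K).
Local Notation hv := (hval (@mpolyC n K)).

(** An algebraic quotient would be a constant c; then p = c q, and coprimality makes q, and with it
    p, constant. *)
Lemma nonconstant_quotient (p q : {mpoly K[n]}) :
    coprime_elts p q -> ~ constant_row (pair_row p q) ->
  q != 0 /\ ~ algebraicOver jK (j p / j q).
Proof.
move=> cop Npq.
have q0 : q != 0.
  apply: contra_not_neq Npq => q0; apply/constant_pairP.
  have [a ->] : exists a, p = a%:MP.
    by apply: mpoly_unitC; right; apply: cop; [exact: divides_refl | rewrite q0; exact: divides0].
  by exists a, 0; rewrite q0 mpolyC0.
split=> // /(algebraic_constant j_inj j_frac)[c Ec]; apply: Npq; apply/constant_pairP.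
have jq0 : j q != 0 by rewrite (fraction_eq0 j_inj).
have Ep : p = c%:MP * q.
  by apply: j_inj; rewrite rmorphM -[j c%:MP]/(jK c) -Ec divfK.
have [b Eb] : exists b, q = b%:MP.
  apply: mpoly_unitC; right; apply: cop; last exact: divides_refl.
  by exists c%:MP.
by exists (c * b), b; rewrite Ep Eb mpolyCM.
Qed.

Lemma hval_nonconstant_eq0 (p q : {mpoly K[n]}) d (f : {poly K}) :
    coprime_elts p q -> ~ constant_row (pair_row p q) ->
  (size f <= d.+1)%N -> hv d f p q = 0 -> f = 0.
Proof.
move=> cop Npq sf E; have [q0 Nalg] := nonconstant_quotient cop Npq.
have jq0 : j q != 0 by rewrite (fraction_eq0 j_inj).
apply/eqP/negPn/negP => f0; apply: Nalg; exists f => //; apply/rootP.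
have := congr1 j E; rewrite rmorph0 hval_morph hval_frac // => /eqP.
by rewrite mulf_eq0 expf_eq0 (negbTE jq0) andbF => /eqP.
Qed.

(** A homogeneous relation evaluated at binary forms of the same degree is again a binary form. Its
    value at (p, q) vanishes only if the form does, because p / q is transcendental. *)
Lemma hom_independent_hval s k (f : 'I_k -> {poly K}) p q :
    coprime_elts p q -> ~ constant_row (pair_row p q) ->
  hom_independent (@mpolyC n K) (fun i => hv s (f i) p q) <->
  hom_independent (@mpolyC 2 K) (fun i => hval (@mpolyC 2 K) s (f i) 'X_ord0 'X_ord_max).
Proof.
move=> cop Npq; set F := fun i : 'I_k => hval (@mpolyC 2 K) _ _ _ _.
have hF i : F i \is s.-homog by rewrite -[s]mul1n; apply: hval_homog; apply: dhomogXi.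
have E d (P : {mpoly K[k]}) : P \is d.-homog ->
    mmap (@mpolyC n K) (fun i => hv s (f i) p q) P = 0 <-> mmap (@mpolyC 2 K) F P = 0.
  move=> hP; have hR := dhomog_mmap hF hP; set R := mmap _ F P in hR *.
  have -> : mmap (@mpolyC n K) (fun i => hv s (f i) p q) P = R \mPo [tuple p; q].
    rewrite /R -[RHS]/((comp_mpoly [tuple p; q] : {rmorphism _ -> _}) _) mmap_comp.
    apply: eq_mmap => [c|i] /=; first by rewrite comp_mpolyC.
    rewrite /F -[RHS]/((comp_mpoly [tuple p; q] : {rmorphism _ -> _}) _) hval_morph /= !comp_mpolyXU /=.
    by apply: eq_bigr => l _; rewrite /= comp_mpolyC.
  split=> [|->]; last by rewrite comp_mpoly0.
  rewrite (comp_dehom _ _ hR) => /(hval_nonconstant_eq0 cop Npq (size_dehom hR)) R0.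
  by rewrite (hval_dehom hR) R0 hval0.
by split=> H d P hP P0; apply: (H d P hP); apply/(E d P hP).
Qed.

Lemma good_decomposition m (H : 'I_m -> L) k0 (M : fieldType) (i : {rmorphism {poly K} -> M})
    (M3 : fieldType) (j3 : {rmorphism {mpoly K[3]} -> M3}) :
    injective i -> (forall z, exists a b, b != 0 /\ z = i a / i b) -> injective j3 ->
    (0 < n)%N -> H k0 != 0 ->
    (forall tau : 'I_3 -> 'I_m, ~ hom_independent jK (fun l => H (tau l))) ->
  exists g s (f : 'I_m -> {poly K}) p q, [/\ g != 0, good s f, coprime_elts p q,
    ~ constant_row (pair_row p q) & forall l, H l = g * j (hv s (f l) p q)].
Proof.
move=> i_inj i_frac j3_inj n0 H0 Hdep; pose r l := H l / H k0.
have Er l : H l = H k0 * r l by rewrite mulrC divfK.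
have [C|NC] := classic (forall l, exists c, r l = jK c).
  have [c Ec] := fin_all_exists C.
  have ck0 : c k0 = 1.
    have := Ec k0; rewrite /r divff // => /esym/eqP.
    rewrite -[jK (c k0)]/(j _) -(rmorph1 j) (inj_eq j_inj).
    by move=> /eqP/(congr1 (mcoeff 0%MM)); rewrite mpolyCK mcoeff1 eqxx.
  (* All ratios are constant, so h is a constant tuple and any coprime nonconstant pair will do;
     (x_1, 1) exists since n > 0. *)
  exists (H k0), 0%N, (fun l => (c l)%:P), 'X_(Ordinal n0), 1; split=> //.
  - split; first by move=> l; rewrite size_polyC leq_b1.
      by exists k0; rewrite ck0 size_poly1.
    exists (fun l => (l == k0)%:R); rewrite (bigD1 k0) //= eqxx ck0 mulr1 big1 ?addr0 // => l /negbTE->.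
    by rewrite mul0r.
  - by move=> d _ [e /esym E]; apply/unitrP; exists e; rewrite (mulrC d) E.
  - move=> /constant_pairP[a [b [/mpolyP/(_ U_(Ordinal n0)%MM) E _]]].
    by move: E; rewrite mcoeffXU eqxx mcoeffC mnm1_eq0 mulr0 => /eqP; rewrite oner_eq0.
  by move=> l; rewrite hvalC Er Ec.
have [i0 Ni0] : exists i0, forall c, r i0 <> jK c.
  apply: NNPP => N; apply: NC => l; apply: NNPP => N'; apply: N; exists l => c E.
  by apply: N'; exists c.
have Nalg : ~ algebraicOver jK (r i0).
  by move=> /(algebraic_constant j_inj j_frac)[c]; apply: Ni0.
have ralg l : algebraic_over (simple_ext jK (r i0)) (r l).
  apply: (dependent_algebraic j3_inj H0 Nalg) => Hi.
  apply: (Hdep (tnth [tuple i0; l; k0])) => d P hP P0; apply: (Hi d P hP).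
  rewrite -[RHS]P0; apply: eq_mmap => // t; rewrite !(tnth_nth 0) (tnth_nth k0).
  by case: t => -[|[|[|//]]] lt3 /=; rewrite -?Er.
have [u Hu] := gordan_igusa j_inj j_frac i_inj i_frac Ni0 ralg.
have [p [q [cop q0 Eu]]] := coprime_fraction j_inj j_frac (@factorial_mpoly K n) u.
have jq0 : j q != 0 by rewrite (fraction_eq0 j_inj).
have Npq : ~ constant_row (pair_row p q).
  move=> /constant_pairP[a [b [Ea Eb]]].
  have b0 : b != 0 by apply: contra_neq q0 => b0; rewrite Eb b0 mpolyC0.
  have Euc : u = jK (a / b) by rewrite Eu Ea Eb -[j _]/(jK a) -[j b%:MP]/(jK b) fmorph_div.
  have : exists c, r i0 = jK c; last by case=> c; apply: Ni0.
  apply: (simple_ext_min (E := fun x => exists c, x = jK c) _ _ _ (Hu i0)).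
  - split; first by exists 1; rewrite rmorph1.
      by move=> _ _ [x ->] [y ->]; exists (x - y); rewrite rmorphB.
    by move=> _ _ [x ->] [y ->]; exists (x / y); rewrite fmorph_div.
  - by move=> c; exists c.
  by exists (a / b).
have [A [B [B0 EA]]] := simple_ext_common_denominator Hu.
have A0 : A k0 != 0.
  apply: contra_neq H0 => A0.
  have r0 : r k0 = 0 by rewrite EA A0 map_poly0 horner0 mul0r.
  by rewrite Er r0 mulr0.
have [G [s [f [G0 EG fgood]]]] := normalize_family A0.
have [sf _ _] := fgood.
(* Here r l = A l(u) / B(u) = f l(u) G(u) / B(u), and homogenizing f l at u = p / q brings in the
   denominator q^s. All that does not depend on l goes into g. *)
exists (H k0 * ((map_poly jK G).[u] / (map_poly jK B).[u]) / j q ^+ s), s, f, p, q; split=> //.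
  rewrite !mulf_neq0 ?invr_eq0 ?expf_neq0 //.
  apply: contra_neq H0 => GU0.
  have r0 : r k0 = 0 by rewrite EA EG (rmorphM (map_poly jK)) hornerM GU0 mulr0 mul0r.
  by rewrite Er r0 mulr0.
move=> l; rewrite hval_morph hval_frac // -Eu Er EA EG rmorphM hornerM.
have jqs : j q ^+ s != 0 by rewrite expf_neq0.
rewrite -[in RHS]mulrA [_^-1 * _]mulrA mulVf // mul1r -!mulrA; congr (_ * _).
by rewrite mulrC -!mulrA; congr (_ * _); rewrite mulrC.
Qed.

End RationalFunctionRows.

Lemma hom_dependent_constants (K L : fieldType) (iota : {rmorphism K -> L}) (F : 'I_2 -> L)
  (c : 'I_2 -> K) : (forall i, F i = iota (c i)) -> ~ hom_independent iota F.
Proof.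
move=> EF Hi; set a := c ord0; set b := c ord_max.
have E (x y : K) : x * a + y * b = 0 -> x = 0 /\ y = 0.
  move=> E0; have : x *: 'X_ord0 + y *: 'X_ord_max = 0 :> {mpoly K[2]}.
    apply: (Hi 1%N); first by apply: rpredD; apply: rpredZ; apply: dhomogXi.
    by rewrite mmapD !mmapZ !mmapX !mmap1U !EF -!rmorphM -rmorphD E0 rmorph0.
  move=> /mpolyP P0; have := P0 U_(ord0)%MM; have := P0 U_(ord_max)%MM.
  by rewrite !mcoeffD !mcoeffZ !mcoeffXU !mcoeff0 /= !mulr0 !mulr1 add0r addr0.
(* The linear form b y_1 - a y_2 is a relation between the constants a and b; if a = 0, the form y_1
   is one. *)
have [a0|a0] := eqVneq a 0.
  by have [|/eqP] := E 1 0; rewrite ?oner_eq0 // a0 !(mulr0, mul0r) addr0.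
have [|_ /eqP] := E b (- a); first by rewrite mulNr mulrC subrr.
by rewrite oppr_eq0 (negbTE a0).
Qed.

Section Decompositions.
Variables (K : fieldType) (n m : nat).
Implicit Types (H : 'rV[ratfun K n]_m) (g : ratfun K n) (h : 'rV[{mpoly K[2]}]_m).
Implicit Types (p q : {mpoly K[n]}) (f : 'I_m -> {poly K}).
Local Notation C2 := (@mpolyC 2 K).
Local Notation Cn := (@mpolyC n K).
Local Notation X0 := ('X_ord0 : {mpoly K[2]}).
Local Notation X1 := ('X_ord_max : {mpoly K[2]}).
Local Notation jn := (@tofrac {mpoly K[n]}).

Lemma comp_hval k s (f : {poly K}) (a b : {mpoly K[k]}) n' (t : k.-tuple {mpoly K[n']}) :
  hval (@mpolyC k K) s f a b \mPo t = hval (@mpolyC n' K) s f (a \mPo t) (b \mPo t).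
Proof.
rewrite -[LHS]/((comp_mpoly t : {rmorphism _ -> _}) _) hval_morph.
by apply: eq_bigr => l _; rewrite /= comp_mpolyC.
Qed.

Lemma subst_hval_row s f p q :
  subst_pair (hval_row C2 s f X0 X1) p q = hval_row Cn s f p q.
Proof. by apply/rowP => i; rewrite !mxE comp_hval !comp_mpolyXU. Qed.

(** A uniform description of both alternatives for h: the zero tuple is given by zero polynomials of
    formal degree 0, and [good] is claimed only for nonzero h. *)
Lemma decomposition_hval H g h p q : decomposition H g h p q ->
  exists s f, [/\ h = hval_row C2 s f X0 X1, subst_pair h p q = hval_row Cn s f p q,
    forall i, (size (f i) <= s.+1)%N & h != 0 -> good s f].
Proof.
case=> _ [[[h0 [s hh]] hP]|->] _; last first.
  exists 0%N, (fun=> 0); split=> [|||/eqP//]; try by move=> i; rewrite size_poly0.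
    by apply/rowP => i; rewrite !mxE hval0.
  by apply/rowP => i; rewrite !mxE hval0 comp_mpoly0.
have Eh : h = hval_row C2 s (fun i => dehom (h 0 i)) X0 X1.
  by apply/rowP => i; rewrite mxE -hval_dehom.
exists s, (fun i => dehom (h 0 i)); split=> //.
- by rewrite {1}Eh subst_hval_row.
- by move=> i; apply: size_dehom.
- by move=> _; apply: good_of_primitive.
Qed.

Lemma good_homogeneous s f p q e : good s f -> p \is e.-homog -> q \is e.-homog ->
  p != 0 \/ q != 0 -> homogeneous (hval_row Cn s f p q).
Proof.
move=> fgood hp hq pq0; split.
  have [i Ni] := good_hval_neq0 Cn fgood pq0.
  by apply: contra_neq Ni => /rowP/(_ i); rewrite !mxE.
by exists (e * s)%N => i; rewrite mxE; apply: hval_homog.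
Qed.

Lemma decomposition_of_good H g s f p q : g != 0 -> good s f -> coprime_elts p q ->
  ~ constant_row (pair_row p q) -> (forall i, H 0 i = g * jn (hval Cn s (f i) p q)) ->
  (homogeneous (hval_row C2 s f X0 X1) /\ primitive (hval_row C2 s f X0 X1)) /\
  decomposition H g (hval_row C2 s f X0 X1) p q.
Proof.
move=> g0 fgood cop Npq EH.
have hP : primitive (hval_row C2 s f X0 X1).
  by apply: good_primitive; [exact: factorial_mpoly | | exact: coprime_X01].
have hh : homogeneous (hval_row C2 s f X0 X1).
  split; first by case: hP.
  by exists (1 * s)%N => i; rewrite mxE; apply: hval_homog; apply: dhomogXi.
split=> //; split; last by split=> //; apply/primitive_pairP.
- by split=> //; apply/rowP => i; rewrite EH subst_hval_row !mxE.
- by left.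
Qed.

Section OneDecomposition.
Variables (H : 'rV[ratfun K n]_m) (g : ratfun K n) (h : 'rV[{mpoly K[2]}]_m).
Variables (p q : {mpoly K[n]}).
Hypothesis dec : decomposition H g h p q.
Local Notation pq := (pair_row p q).
Local Notation hpq := (subst_pair h p q).

Lemma decomposition_coprime : coprime_elts p q /\ ~ constant_row pq.
Proof. by case: dec => _ _ [/primitive_pairP]. Qed.

Lemma decomposition_trdeg : trdeg_t H = trdeg_t (ratfun_row hpq) /\
  trdeg_t (ratfun_row hpq) = trdeg_t (ratfun_row h).
Proof.
have [cop Npq] := decomposition_coprime.
have [s [f [Eh Ehpq _ _]]] := decomposition_hval dec.
have [[EH g0] _ _] := dec.
split; apply: trdeg_t_eq => l tau.
  by apply: (hom_independent_scale _ g0) => i; rewrite EH !mxE.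
have A1 : hom_independent (@ratfunC K n) (fun i => ratfun_row hpq 0 (tau i)) <->
    hom_independent Cn (fun i => hval Cn s (f (tau i)) p q).
  rewrite -(hom_independent_inj _ _ (@tofrac_inj {mpoly K[n]})) Ehpq.
  by split=> Hi d P hP P0; apply: (Hi d P hP); rewrite -[RHS]P0; apply: eq_mmap => // i; rewrite !mxE.
have A2 : hom_independent (@ratfunC K 2) (fun i => ratfun_row h 0 (tau i)) <->
    hom_independent C2 (fun i => hval C2 s (f (tau i)) X0 X1).
  rewrite -(hom_independent_inj _ _ (@tofrac_inj {mpoly K[2]})) Eh.
  by split=> Hi d P hP P0; apply: (Hi d P hP); rewrite -[RHS]P0; apply: eq_mmap => // i; rewrite !mxE.
by rewrite A1 A2; apply: (hom_independent_hval (@tofrac_inj {mpoly K[n]}) (@fraction_rep _) _ _ cop Npq).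
Qed.

Lemma decomposition_primitive : h != 0 -> primitive hpq.
Proof.
move=> h0; have [s [f [_ -> _ /(_ h0) fgood]]] := decomposition_hval dec.
apply: good_primitive => //; first exact: factorial_mpoly.
by have [] := decomposition_coprime.
Qed.

Lemma decomposition_neq0 : [<-> H != 0; primitive hpq; primitive h; h != 0].
Proof.
have [[EH g0] hP _] := dec.
have h0H : H != 0 -> h != 0.
  apply: contra_neq => h0; apply/rowP => i; rewrite EH h0 !mxE comp_mpoly0.
  by rewrite tofrac0 mulr0.
tfae.
- by move/h0H/decomposition_primitive.
- move=> [hpq0 _]; have h0 : h != 0.
    by apply: contra_neq hpq0 => ->; apply/rowP => i; rewrite !mxE comp_mpoly0.
  by case: hP => [[]|E] //; rewrite E eqxx in h0.
- by case.
- move/decomposition_primitive => [hpq0 _]; apply: contra_neq hpq0 => H0.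
  apply/rowP => i; move/rowP/(_ i): EH; rewrite H0 !mxE => /esym/eqP.
  by rewrite mulf_eq0 (negbTE g0) tofrac_eq0 => /eqP.
Qed.

Lemma decomposition_deg : h != 0 -> exists s D C,
  [/\ forall i, h 0 i \is s.-homog, has_deg h s /\ has_codeg h s,
      has_deg pq D /\ has_codeg pq C &
      has_deg hpq (s * D) /\ has_codeg hpq (s * C)].
Proof.
move=> h0; have [s [f [Eh Ehpq _ /(_ h0) fgood]]] := decomposition_hval dec.
have [cop _] := decomposition_coprime.
have hh i : h 0 i \is s.-homog.
  have := hval_homog s (f i) (dhomogXi K (ord0 : 'I_2)) (dhomogXi K ord_max).
  by rewrite mul1n Eh mxE.
have pq0 : pq != 0 by case: dec => _ _ [[]].
have [D HD] := has_deg_exists pq0; have [C HC] := has_codeg_exists pq0.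
exists s, D, C; split=> //; first exact: homogeneous_has_deg.
by rewrite Ehpq; split; [exact: good_has_deg | exact: good_has_codeg].
Qed.

Lemma decomposition_deg_pos D : has_deg pq D -> (0 < D)%N.
Proof.
have [_ Npq] := decomposition_coprime; move=> HD; rewrite lt0n; apply: contra_notN Npq.
by move=> /eqP D0; apply: constant_row_deg0; move: HD; rewrite D0.
Qed.

(** For h nonzero, the degree s D of a constant h(p, q) is 0, while D > 0 because (p, q) is not
    constant; hence s = 0. *)
Lemma decomposition_const_hpq : constant_row hpq -> constant_row h.
Proof.
have [->|h0] := eqVneq h 0.
  by exists 0; apply/rowP => i; rewrite !mxE mpolyC0.
have [s [D [C [_ [Hh _] [HD _] [Hs _]]]]] := decomposition_deg h0.
move=> /(has_deg0_constant Hs)/eqP; rewrite muln_eq0 => /orP[/eqP s0|/eqP D0].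
  by apply: constant_row_deg0; move: Hh; rewrite s0.
by have := decomposition_deg_pos HD; rewrite D0.
Qed.

Lemma const_h_hpq : constant_row h -> constant_row hpq.
Proof.
by move=> [c ->]; exists c; apply/rowP => i; rewrite !mxE comp_mpolyC.
Qed.

End OneDecomposition.

(** Any two components satisfy a homogeneous relation; dehomogenized, it makes h_i / h_k algebraic
    over K, hence constant. So a nonzero h_k divides all components and is a unit by primitivity. *)
Lemma trdeg_t_le1_constant h : (primitive h \/ h = 0) -> (trdeg_t (ratfun_row h) <= 1)%N ->
  constant_row h.
Proof.
case=> [[h0 hP] le1|->]; last by exists 0; apply/rowP => i; rewrite !mxE mpolyC0.
have [k hk0] := row_neq0 h0.
pose j2 := @tofrac {mpoly K[2]}; have jk0 : j2 (h 0 k) != 0 by rewrite tofrac_eq0.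
have [_ maxF] := trdeg_t_independent (ratfun_row h).
have Hc i : exists c, h 0 i = c%:MP * h 0 k.
  pose tau := tnth [tuple i; k] : 'I_2 -> 'I_m.
  have Ndep : ~ hom_independent (@ratfunC K 2) (fun l => ratfun_row h 0 (tau l)).
    by move/maxF => /leq_trans/(_ le1).
  have [d [P [hP' P0 NP]]] : exists d (P : {mpoly K[2]}), [/\ P \is d.-homog,
      mmap (@ratfunC K 2) (fun l => ratfun_row h 0 (tau l)) P = 0 & P != 0].
    apply: NNPP => N; apply: Ndep => d P hP' P0; apply/eqP/negPn/negP => NP.
    by apply: N; exists d, P.
  have f0 : dehom P != 0.
    by apply: contra_neq NP => f0; rewrite (hval_dehom hP') f0 hval0.
  have : algebraicOver (j2 \o C2) (j2 (h 0 i) / j2 (h 0 k)).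
    exists (dehom P) => //; apply/rootP; move: P0; rewrite {1}(hval_dehom hP') hval_morph /=.
    rewrite !mmapX !mmap1U !mxE /tau !(tnth_nth k) /= => P0.
    have : hval (j2 \o C2) d (dehom P) (j2 (h 0 i)) (j2 (h 0 k)) = 0.
      by rewrite -[RHS]P0; apply: eq_bigr => l _; rewrite /= mmapC.
    rewrite hval_frac ?size_dehom // => /eqP.
    by rewrite mulf_eq0 expf_eq0 (negbTE jk0) andbF => /eqP.
  move=> /(algebraic_constant (@tofrac_inj {mpoly K[2]}) (@fraction_rep {mpoly K[2]}))[c Ec].
  exists c; apply: (@tofrac_inj {mpoly K[2]}); rewrite tofracM.
  by rewrite -[tofrac c%:MP]/((j2 \o C2) c) -Ec divfK.
have [b Eb] : exists b, h 0 k = b%:MP.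
  by apply: mpoly_unitC; right; apply: hP => i; have [c Ec] := Hc i; exists c%:MP.
have [c Ec] := fin_all_exists Hc.
exists (\row_i (c i * b)); apply/rowP => i; rewrite !mxE Ec Eb.
by rewrite mpolyCM.
Qed.

Lemma trdeg_t_constant h : constant_row h -> (trdeg_t (ratfun_row h) <= 1)%N.
Proof.
move=> [c Ec].
have EF i : ratfun_row h 0 i = ratfunC K 2 (c 0 i) by rewrite Ec !mxE.
have [[s si] _] := trdeg_t_independent (ratfun_row h).
rewrite leqNgt; apply/negP => lt; have := hom_independent_sub (lek := lt) si.
exact: (hom_dependent_constants (c := fun i => c 0 (s (widen_ord lt i))) (fun i => EF _)).
Qed.

End Decompositions.

(** The equation v (d0 + d1 u) = n0 + n1 u is solved for u. The factor d1 v - n1 is nonzero: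
    otherwise v = n1 / d1 is constant, or n1 = d1 = 0 and no member of f has degree 1. *)
Lemma moebius_inverse (K L : fieldType) (iota : {rmorphism K -> L}) (u v : L) (f : 'I_2 -> {poly K}) :
    good 1 f -> (forall c, v <> iota c) -> (map_poly iota (f ord_max)).[u] != 0 ->
    v = (map_poly iota (f ord0)).[u] / (map_poly iota (f ord_max)).[u] ->
  simple_ext iota v u.
Proof.
move=> [sf [i0 si0] _] Nv D0 Ev.
have lin i : (map_poly iota (f i)).[u] = iota (f i)`_0 + iota (f i)`_1 * u.
  rewrite [in LHS](poly_wide (sf i)) big_ord_recl big_ord1 /= rmorphD /= !map_polyZ hornerD !hornerZ.
  by rewrite !map_polyXn !hornerXn expr0 expr1 mulr1.
rewrite !lin in D0 Ev; set n0 := (f ord0)`_0 in Ev; set n1 := (f ord0)`_1 in Ev.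
set d0 := (f ord_max)`_0 in D0 Ev; set d1 := (f ord_max)`_1 in D0 Ev.
have E1 : u * (iota d1 * v - iota n1) = iota n0 - iota d0 * v.
  by rewrite Ev; field.
have N1 : iota d1 * v - iota n1 != 0.
  apply/eqP => E2; have [d10|d10] := eqVneq d1 0.
    move: E2; rewrite d10 rmorph0 mul0r sub0r => /eqP; rewrite oppr_eq0 fmorph_eq0 => /eqP n10.
    have : (f i0)`_1 != 0 by rewrite -[1%N]/(2.-1) -si0 -lead_coefE lead_coef_eq0 -size_poly_gt0 si0.
    by case: (ord2P i0) => ->; rewrite -/n1 -/d1 ?n10 ?d10 eqxx.
  apply: (Nv (n1 / d1)); rewrite fmorph_div; apply: (canRL (mulfK _)); rewrite ?fmorph_eq0 //.
  by rewrite mulrC; apply/eqP; rewrite -subr_eq0 E2.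
have -> : u = (iota n0 - iota d0 * v) / (iota d1 * v - iota n1) by rewrite -E1 mulfK.
have HS := simple_ext_subfield iota v; have [_ SB SD] := HS.
have Sv := simple_ext_gen iota v; have SK c := simple_extK iota v c.
by apply: SD; apply: SB => //; apply: (subfieldM HS).
Qed.

(** * Change of the pair (p, q) and minimal degree *)

Section Quotients.
Variables (K : fieldType) (n : nat) (L : fieldType) (j : {rmorphism {mpoly K[n]} -> L}).
Hypothesis j_inj : injective j.
Local Notation jK := (j \o @mpolyC n K).

(** Without their common factor, the numerator and denominator of p / q as a rational function of u
    stay coprime when homogenized at (p', q'). So they agree with p and q up to a common unit, a
    constant that is absorbed into f. *)
Lemma quotient_of_simple_ext (p q p' q' : {mpoly K[n]}) u :
    coprime_elts p q -> q != 0 -> coprime_elts p' q' -> q' != 0 -> u = j p' / j q' ->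
    simple_ext jK u (j p / j q) ->
  exists r (f : 'I_2 -> {poly K}), [/\ good r f, (map_poly jK (f ord_max)).[u] != 0,
    j p / j q = (map_poly jK (f ord0)).[u] / (map_poly jK (f ord_max)).[u],
    p = hval (@mpolyC n K) r (f ord0) p' q' & q = hval (@mpolyC n K) r (f ord_max) p' q'].
Proof.
move=> cop q0 cop' q'0 Eu /simple_extP[N [D [D0 EN]]].
pose A := tnth [tuple N; D] : 'I_2 -> {poly K}.
have A1 : A ord_max = D by rewrite /A (tnth_nth 0).
have A0 : A ord0 = N by rewrite /A (tnth_nth 0).
have An0 : A ord_max != 0.
  by rewrite A1; apply: contra_neq D0 => ->; rewrite map_poly0 horner0.
have [G [r [f [G0 EG fgood]]]] := normalize_family An0.
have [sf _ _] := fgood.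
have ev (x y : {poly K}) : (map_poly jK (x * y)).[u] = (map_poly jK x).[u] * (map_poly jK y).[u].
  by rewrite (rmorphM (map_poly jK)) hornerM.
have GU : (map_poly jK G).[u] != 0.
  by apply: contra_neq D0 => GU; rewrite -A1 EG ev GU mulr0.
have fU : (map_poly jK (f ord_max)).[u] != 0.
  by apply: contra_neq D0 => fU; rewrite -A1 EG ev fU mul0r.
have Ef : j p / j q = (map_poly jK (f ord0)).[u] / (map_poly jK (f ord_max)).[u].
  rewrite EN -A0 -A1 !EG !ev invfM mulrACA divff // mulr1 //.
have jq'0 : j q' != 0 by rewrite (fraction_eq0 j_inj).
have jhv i : j (hval (@mpolyC n K) r (f i) p' q') = j q' ^+ r * (map_poly jK (f i)).[u].
  by rewrite hval_morph hval_frac // Eu.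
pose hv i := hval (@mpolyC n K) r (f i) p' q'.
have copH : coprime_elts (hv ord0) (hv ord_max).
  apply/primitive_pairP; suff -> : pair_row (hv ord0) (hv ord_max) = hval_row (@mpolyC n K) r f p' q'.
    by apply: good_primitive => //; apply: factorial_mpoly.
  by apply/rowP => i; rewrite [RHS]mxE; case: (ord2P i) => ->; rewrite ?pair_row0 ?pair_row1.
have hv0 : hv ord_max != 0.
  by rewrite -(fraction_eq0 j_inj) jhv mulf_neq0 // expf_neq0.
have E : p * hv ord_max = hv ord0 * q.
  apply: j_inj; rewrite !rmorphM; apply/eqP.
  have jq0 : j q != 0 by rewrite (fraction_eq0 j_inj).
  have jhv0 : j (hv ord_max) != 0 by rewrite (fraction_eq0 j_inj).
  rewrite -(eqr_div _ _ jq0 jhv0) Ef !jhv invfM mulrACA divff ?mul1r //.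
  exact: expf_neq0.
have [w wU [Ep Eq]] := coprime_fraction_eq (@factorial_mpoly K n) cop copH q0 hv0 E.
have [c Ec] := mpoly_unitC (or_intror wU).
have c0 : c != 0 by apply: contraTneq wU => c0; rewrite Ec c0 mpolyC0 unitr0.
have Ew x : w * hval (@mpolyC n K) r x p' q' = hval (@mpolyC n K) r (c *: x) p' q'.
  rewrite Ec; exact: (esym (hvalZ (@mpolyC n K) r c x p' q')).
exists r, (fun i => c *: f i); split.
- case: fgood => _ [i1 si1] [x Ex]; split; first by move=> i; rewrite size_scale.
    by exists i1; rewrite size_scale.
  exists (fun i => c^-1 *: x i); rewrite -[RHS]Ex; apply: eq_bigr => i _.
  by rewrite -scalerAl -scalerAr scalerA mulVf // scale1r.
- by rewrite map_polyZ hornerZ mulf_neq0 // fmorph_eq0.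
- by rewrite Ef !map_polyZ !hornerZ invfM mulrACA divff ?mul1r // fmorph_eq0.
- exact: etrans Ep (Ew _).
- exact: etrans Eq (Ew _).
Qed.

End Quotients.

Section MinimalDecomposition.
Variables (K : fieldType) (n m : nat).
Local Notation C2 := (@mpolyC 2 K).
Local Notation Cn := (@mpolyC n K).
Local Notation X0 := ('X_ord0 : {mpoly K[2]}).
Local Notation X1 := ('X_ord_max : {mpoly K[2]}).
Local Notation jn := (@tofrac {mpoly K[n]}).

Lemma coprime_X1 (i : 'I_n) : coprime_elts ('X_i : {mpoly K[n]}) 1.
Proof. by move=> d _ [e E]; apply/unitrP; exists e; rewrite (mulrC d) -E. Qed.

Lemma nonconstant_X1 (i : 'I_n) : ~ constant_row (pair_row ('X_i : {mpoly K[n]}) 1).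
Proof.
move=> /constant_pairP[a [b [/mpolyP/(_ U_(i)%MM) E _]]].
by move: E; rewrite mcoeffXU eqxx mcoeffC mnm1_eq0 mulr0 => /eqP; rewrite oner_eq0.
Qed.

Lemma decomposition_exists (H : 'rV[ratfun K n]_m) : (0 < n)%N -> (trdeg_t H <= 2)%N ->
  exists (g : ratfun K n) (h : 'rV[{mpoly K[2]}]_m) (p q : {mpoly K[n]}),
    decomposition H g h p q.
Proof.
move=> n0 trH; have [H0|/row_neq0[k0 Hk0]] := eqVneq H 0.
  exists 1, 0, 'X_(Ordinal n0), 1; split; [split|by right|split].
  - by apply/rowP => i; rewrite H0 !mxE comp_mpoly0 tofrac0 mulr0.
  - exact: oner_neq0.
  - exact/primitive_pairP/coprime_X1.
  - exact: nonconstant_X1.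
have [_ maxH] := trdeg_t_independent H.
have [|g [s [f [p [q [g0 fgood cop Npq EH]]]]]] := @good_decomposition K n (ratfun K n) jn
  (@tofrac_inj _) (@fraction_rep _) m (fun i => H 0 i) k0 {fraction {poly K}} (@tofrac {poly K})
  {fraction {mpoly K[3]}} (@tofrac {mpoly K[3]}) (@tofrac_inj _) (@fraction_rep _) (@tofrac_inj _) n0 Hk0.
- by move=> tau /maxH /leq_trans/(_ trH).
exists g, (hval_row C2 s f X0 X1), p, q.
by have [] := decomposition_of_good g0 fgood cop Npq EH.
Qed.

Lemma decomposition_closed (H : 'rV[ratfun K n]_m) g h p q : decomposition H g h p q ->
    (forall (g' : ratfun K n) (h' : 'rV[{mpoly K[2]}]_m) (p' q' : {mpoly K[n]}),
       decomposition H g' h' p' q' -> (deg (pair_row p q) <= deg (pair_row p' q'))%E) ->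
  algebraically_closed_in (adjoin_quot p q).
Proof.
move=> dec min a aalg; have [cop Npq] := decomposition_coprime dec.
have j_inj := @tofrac_inj {mpoly K[n]}; have j_frac := @fraction_rep {mpoly K[n]}.
have [q0 Nalg] := nonconstant_quotient j_inj j_frac cop Npq.
pose v := jn p / jn q; rewrite -/v in Nalg.
pose phi := tnth [tuple v; a] : 'I_2 -> ratfun K n.
have phi0 : phi ord0 = v by rewrite /phi (tnth_nth 0).
have phi1 : phi ord_max = a by rewrite /phi (tnth_nth 0).
have Nv c : phi ord0 <> (jn \o Cn) c.
  by rewrite phi0 => E; apply: Nalg; rewrite E; apply: algebraic_id.
have phialg k : algebraic_over (simple_ext (jn \o Cn) (phi ord0)) (phi k).
  rewrite phi0; case: (ord2P k) => ->; rewrite ?phi0 ?phi1; last exact: aalg.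
  by apply: (algebraic_over_id (simple_ext_subfield _ _)); apply: simple_ext_gen.
have [u Hu] := gordan_igusa j_inj j_frac (@tofrac_inj {poly K}) (@fraction_rep {poly K}) Nv phialg.
have Sv := Hu ord0; have Sa := Hu ord_max; rewrite phi0 in Sv; rewrite phi1 in Sa.
suff Su : simple_ext (jn \o Cn) v u.
  apply: (simple_ext_min (E := simple_ext (jn \o Cn) v) _ _ Su Sa).
    exact: simple_ext_subfield.
  by move=> c; apply: simple_extK.
have [p' [q' [cop' q'0 Eu]]] := coprime_fraction j_inj j_frac (@factorial_mpoly K n) u.
have [r [f [fgood D0 Ev Ep Eq]]] := quotient_of_simple_ext j_inj cop q0 cop' q'0 Eu Sv.
have Epq : pair_row p q = hval_row Cn r f p' q'.
  by apply/rowP => i; rewrite [RHS]mxE; case: (ord2P i) => ->; rewrite ?pair_row0 ?pair_row1.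
have Npq' : ~ constant_row (pair_row p' q').
  move=> /constant_pairP[b [b' [Eb Eb']]]; apply: Npq; apply/constant_pairP.
  exists (hval idfun r (f ord0) b b'), (hval idfun r (f ord_max) b b').
  by split; [rewrite Ep | rewrite Eq]; rewrite Eb Eb'; apply: esym (hval_morph idfun Cn _ _ _ _).
have [h' dec'] : exists h', decomposition H g h' p' q'.
  have [[EH g0] _ _] := dec; have pq'P := iffRL (primitive_pairP p' q') cop'.
  have [h0|h0] := eqVneq h 0.
    exists h; split; [split; last exact: g0 | by right | exact: conj pq'P Npq'].
    rewrite EH h0; congr (_ *: ratfun_row _); apply/rowP => i.
    by rewrite mxE [RHS]mxE mxE !comp_mpoly0.
  have [s [fh [Eh Esub _ /(_ h0) hgood]]] := decomposition_hval dec.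
  (* Since p and q are the values of these forms at (p', q'), substituting the forms into h gives
     the new tuple; it is primitive because the two forms are coprime. *)
  pose A i := hval C2 r (f i) X0 X1.
  have hA i : A i \is (1 * r).-homog by apply: hval_homog; apply: dhomogXi.
  have copA : coprime_elts (A ord0) (A ord_max).
    apply/primitive_pairP; suff -> : pair_row (A ord0) (A ord_max) = hval_row C2 r f X0 X1.
      by apply: good_primitive; [exact: factorial_mpoly | | exact: coprime_X01].
    by apply/rowP => i; rewrite [RHS]mxE; case: (ord2P i) => ->; rewrite ?pair_row0 ?pair_row1.
  exists (hval_row C2 s fh (A ord0) (A ord_max)); split; last exact: conj pq'P Npq'.
  - split; last exact: g0.
    rewrite EH Esub; congr (_ *: ratfun_row _); apply/rowP => i.
    by rewrite !mxE comp_hval /A !comp_hval !comp_mpolyXU /= -Ep -Eq.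
  - left; split; last by apply: good_primitive => //; apply: factorial_mpoly.
    exact: good_homogeneous hgood (hA _) (hA _) (coprime_neq0 copA).
have [_ _ [[pq'0 _] _]] := dec'; have [D HD] := has_deg_exists pq'0.
have D_gt0 := decomposition_deg_pos dec' HD.
have HrD := good_has_deg fgood HD; rewrite -Epq in HrD.
have := min _ _ _ _ dec'; rewrite (has_degP HD) (has_degP HrD) lee_fin lez_nat.
rewrite -[X in (_ <= X)%N]mul1n (leq_pmul2r D_gt0) => ler1.
(* The case r = 0 is excluded because (p, q) would have degree 0 and be constant. *)
case: r fgood Ep Eq Epq HrD ler1 => [|[|r]] fgood Ep Eq Epq HrD ler1; last by [].
  by case: Npq; apply: constant_row_deg0.
by apply: (moebius_inverse fgood _ D0 Ev) => c; rewrite /v -[X in X <> _]phi0; apply: Nv.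
Qed.

End MinimalDecomposition.

(* In the homogeneity clause, the implication from h(p, q) to (p, q) needs h  *)
(* to be nonconstant: for h = 1 and (p, q) = (x_1, 1), the tuple h(p, q) = 1  *)
(* is homogeneous of degree 0 but (p, q) is not homogeneous.                  *)
Theorem theorem2p7 (K : fieldType) (n m : nat) (n_gt0 : (0 < n)%N)
    (m_gt0 : (0 < m)%N) (H : 'rV[ratfun K n]_m)
    (trdegH : (trdeg_t H <= 2)%N) :
  (exists (g : ratfun K n) (h : 'rV[{mpoly K[2]}]_m) (p q : {mpoly K[n]}),
     decomposition H g h p q)
  /\
  (forall (g : ratfun K n) (h : 'rV[{mpoly K[2]}]_m) (p q : {mpoly K[n]}),
     decomposition H g h p q ->
     let pq := pair_row p q in
     let hpq := subst_pair h p q in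
     (trdeg_t H = trdeg_t (ratfun_row hpq)
        /\ trdeg_t (ratfun_row hpq) = trdeg_t (ratfun_row h))
     /\ [<-> H != 0; primitive hpq; primitive h; h != 0]
     /\ [<-> (trdeg_t H <= 1)%N; constant_row hpq; constant_row h]
     /\ (h != 0 ->
         [/\ deg h = codeg h,
             deg hpq = (deg h * deg pq)%E
           & codeg hpq = (deg h * codeg pq)%E])
     /\ (h != 0 ->
         (homogeneous pq -> homogeneous hpq)
         /\ (~ constant_row h -> homogeneous hpq -> homogeneous pq))
     /\ ((forall (g' : ratfun K n) (h' : 'rV[{mpoly K[2]}]_m)
                 (p' q' : {mpoly K[n]}),
            decomposition H g' h' p' q' -> (deg pq <= deg (pair_row p' q'))%E) ->
         algebraically_closed_in (adjoin_quot p q))).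
Proof.
split=> [|g h p q dec pq hpq]; first exact: decomposition_exists.
have [tr1 tr2] := decomposition_trdeg dec.
split; first exact: (conj tr1 tr2).
split; first exact: decomposition_neq0 dec.
split; [ | split; [ | split]].
- tfae.
  + move=> le1; apply: const_h_hpq; apply: trdeg_t_le1_constant; last by rewrite -tr2 -tr1.
    by have [_ [[_ hP]|->] _] := dec; [left | right].
  + exact: decomposition_const_hpq dec.
  + by move=> hC; rewrite tr1 tr2; apply: trdeg_t_constant.
- move=> h0; have [s [D [C [_ [Hh Ch] [HD HC] [HsD HsC]]]]] := decomposition_deg dec h0.
  rewrite (has_degP Hh) (has_codegP Ch) (has_degP HsD) (has_codegP HsC).
  rewrite (has_degP HD) (has_codegP HC) !PoszM !EFinM.
  by split.
- move=> h0; have [s [D [C [_ [Hh Ch] [HD HC] [HsD HsC]]]]] := decomposition_deg dec h0.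
  split=> [pqh|Nh [hpq0 [d hd]]].
    have [DC] : D = C.
      have [pq0 [d /homogeneous_has_deg/(_ pq0)[H1 H2]]] := pqh.
      by rewrite (has_deg_fun HD H1) (has_codeg_fun HC H2).
    by apply: (homogeneous_of_deg HsD); rewrite DC.
  have [H1 H2] := homogeneous_has_deg hd hpq0.
  have s0 : (0 < s)%N.
    rewrite lt0n; apply: contra_notN Nh => /eqP s0.
    by apply: constant_row_deg0; move: Hh; rewrite s0.
  (* A tuple is homogeneous once its degree and codegree agree. For h(p, q) these are s D and s C,
     and s > 0 can be cancelled. *)
  apply: (homogeneous_of_deg HD); suff -> : D = C by [].
  apply/eqP; rewrite -(eqn_pmul2l s0).
  by rewrite (has_deg_fun HsD H1) (has_codeg_fun HsC H2).
- exact: decomposition_closed dec.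
Qed.
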